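(* Let $p$ be an odd prime and let $G$ be a pro-$p$ Demushkin group with an even number $d\ge 2$ of generators and $q$-invariant $q$. If $q=p=3$, then the differential graded $\mathbb{F}_3$-algebra $\mathcal{C}^\bullet(G,\mathbb{F}_3)$ is not $A_3$-formal. If $q=0$ or $q\ge 5$, then the differential graded $\mathbb{F}_p$-algebra $\mathcal{C}^\bullet(G,\mathbb{F}_p)$ is $A_3$-formal.
   Context: **Demushkin groups.** A pro-$p$ group $G$ is a Demushkin group if $\dim_{\mathbb{F}_p}H^1(G,\mathbb{F}_p)<\infty$, $\dim_{\mathbb{F}_p}H^2(G,\mathbb{F}_p)=1$, and the cup product $H^1(G,\mathbb{F}_p)\times H^1(G,\mathbb{F}_p)\to H^2(G,\mathbb{F}_p)$ is a non-degenerate bilinear form. For odd $p$ it is known that $G$ is characterised by an even number $d\ge2$ and an invariant $q$, which is either $0$ or a power $q=p^f$ with $f\ge1$: $G$ is the pro-$p$ group topologically presented by generators $x_1,\dots,x_d$ and the single relation $x_1^q[x_1,x_2][x_3,x_4]\cdots[x_{d-1},x_d]=1$, where $[x,y]=x^{-1}y^{-1}xy$ (and $x_1^0=1$). **Cochains.** $\mathcal{C}^n(G,\mathbb{F}_p)$ is the space of continuous functions $G^n\to\mathbb{F}_p$ (discrete $\mathbb{F}_p$), with differential $(\delta\varphi)(g_1,\dots,g_{n+1})=\varphi(g_2,\dots,g_{n+1})+\sum_{i=1}^n(-1)^i\varphi(g_1,\dots,g_ig_{i+1},\dots,g_{n+1})+(-1)^{n+1}\varphi(g_1,\dots,g_n)$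 and product $(\varphi\cup\psi)(g_1,\dots,g_{i+j})=\varphi(g_1,\dots,g_i)\psi(g_{i+1},\dots,g_{i+j})$. This is a differential graded algebra with cohomology $H^\bullet(G,\mathbb{F}_p)$. **$A_3$-formality.** A differential graded algebra $\mathcal{A}$ over a field $\mathbb{F}$ with differential $\delta$ is connected if $\mathcal{A}^i=0$ for $i<0$ and $\mathcal{A}^0=\mathbb{F}$. A connected $\mathcal{A}$ is called $A_3$-formal if its cohomology algebra $H=H^\bullet(\mathcal{A})$, regarded as an $A_3$-algebra with $m_1=0$, $m_2$ the induced multiplication and $m_3=0$, is a minimal $A_3$-model of $\mathcal{A}$. That is, there are graded $\mathbb{F}$-linear maps $f_i:H^{\otimes i}\to\mathcal{A}$ of degree $1-i$ for $i=1,2,3$ such that: $\delta f_1=0$ and $f_1$ induces an isomorphism on cohomology; $\delta f_2(x,y)=f_1(xy)-f_1(x)f_1(y)$; and $\delta f_3(x,y,z)+(-1)^{|x|}f_1(x)f_2(y,z)-f_2(x,y)f_1(z)=f_2(xy,z)-f_2(x,yz)$ for all homogeneous $x,y,z\in H$. *)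

(* Defs.v *)
From HB Require Import structures.
From mathcomp Require Import all_boot all_order all_algebra.
From mathcomp Require Import ring_quotient ring zify.
From mathcomp Require Import all_classical topology.

Set Implicit Arguments.
Unset Strict Implicit.
Unset Printing Implicit Defensive.

Import Order.TTheory GRing.Theory Num.Theory.

Local Open Scope classical_set_scope.
Local Open Scope ring_scope.
Local Open Scope quotient_scope.

(* Degrees are related by explicit equations, such as [m + 1 = n] for the
   differential [A m -> A n]: this avoids transports along equalities of
   integers. The maps do not depend on the choice of these proofs, since
   equality proofs in [int] are unique. *)
Record dga (F : fieldType) := Dga {
  dga_deg :> int -> lmodType F;
  dga_d : forall m n : int, m + 1 = n -> dga_deg m -> dga_deg n;
  dga_one : dga_deg 0;
  dga_mul : forall i j n : int,
    i + j = n -> dga_deg i -> dga_deg j -> dga_deg n;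
  dga_d_linear : forall (m n : int) (e : m + 1 = n), linear (dga_d e);
  dga_mul_linearl : forall (i j n : int) (e : i + j = n) y,
    linear (fun x => dga_mul e x y);
  dga_mul_linearr : forall (i j n : int) (e : i + j = n) x,
    linear (dga_mul e x);
  dga_mul1l : forall (n : int) (e : 0 + n = n) x, dga_mul e dga_one x = x;
  dga_mul1r : forall (n : int) (e : n + 0 = n) x, dga_mul e x dga_one = x;
  dga_mulA : forall (i j k ij jk n : int) (eij : i + j = ij) (ejk : j + k = jk)
      (el : ij + k = n) (er : i + jk = n) x y z,
    dga_mul er x (dga_mul ejk y z) = dga_mul el (dga_mul eij x y) z;
  dga_dd : forall (m n k : int) (e1 : m + 1 = n) (e2 : n + 1 = k) x,
    dga_d e2 (dga_d e1 x) = 0;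
  dga_leibniz : forall (i j n i' j' n' : int) (e : i + j = n)
      (ei : i + 1 = i') (ej : j + 1 = j') (en : n + 1 = n')
      (el : i' + j = n') (er : i + j' = n') x y,
    dga_d en (dga_mul e x y) =
      dga_mul el (dga_d ei x) y + (-1) ^ i *: dga_mul er x (dga_d ej y)
}.

HB.instance Definition _ (F : fieldType) (A : dga F) m n (e : m + 1 = n) :=
  GRing.isLinear.Build F (A m) (A n) *:%R (dga_d e) (dga_d_linear e).

Record connected_dga (F : fieldType) := ConnectedDga {
  cdga_dga :> dga F;
  cdga_neg : forall n, n < 0 -> forall x : cdga_dga n, x = 0;
  cdga_deg0 : bijective (fun a : F => a *: dga_one cdga_dga)
}.

Section Cohomology.
Variables (F : fieldType) (A : dga F).
Implicit Types i j k m n : int.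

Lemma dga_mul0l i j n (e : i + j = n) y : dga_mul e 0 y = 0 :> A n.
Proof.
have /= := dga_mul_linearl e y (-1) 0 0.
by rewrite scaler0 addr0 scaleN1r addNr.
Qed.

Lemma dga_mul0r i j n (e : i + j = n) x : dga_mul e x 0 = 0 :> A n.
Proof.
have := dga_mul_linearr e x (-1) 0 0.
by rewrite scaler0 addr0 scaleN1r addNr.
Qed.

Lemma dga_mulBl i j n (e : i + j = n) x x' y :
  dga_mul e (x - x') y = dga_mul e x y - dga_mul e x' y :> A n.
Proof.
have /= := dga_mul_linearl e y (-1) x' x.
by rewrite !scaleN1r (addrC (- x')) (addrC (- dga_mul _ _ _)).
Qed.

Lemma dga_mulBr i j n (e : i + j = n) x y y' :
  dga_mul e x (y - y') = dga_mul e x y - dga_mul e x y' :> A n.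
Proof.
have := dga_mul_linearr e x (-1) y' y.
by rewrite !scaleN1r (addrC (- y')) (addrC (- dga_mul _ _ _)).
Qed.

Definition is_cocycle n : {pred A n} :=
  fun x => dga_d (erefl (n + 1)) x == 0.

Lemma is_cocycleP n n' (e : n + 1 = n') (x : A n) :
  (x \in @is_cocycle n) = (dga_d e x == 0).
Proof. by case: n' / e. Qed.

Lemma is_cocycle_submod n : submod_closed (@is_cocycle n).
Proof.
split=> [|a x y]; rewrite !unfold_in /is_cocycle ?linear0 //.
by move=> /eqP dx /eqP dy; rewrite dga_d_linear dx dy scaler0 addr0.
Qed.

HB.instance Definition _ n :=
  GRing.isSubmodClosed.Build F (A n) (@is_cocycle n) (@is_cocycle_submod n).

Record cocycle n := Cocycle {
  cocycle_val : A n;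
  cocycle_valP : cocycle_val \in @is_cocycle n
}.

HB.instance Definition _ n := [isSub for @cocycle_val n].
HB.instance Definition _ n := [Choice of cocycle n by <:].
HB.instance Definition _ n :=
  [SubChoice_isSubLmodule of cocycle n by <:].

Definition is_coboundary n : {pred cocycle n} := fun z =>
  `[< exists (m : int) (e : m + 1 = n) (y : A m), dga_d e y = val z >].

Lemma is_coboundary_submod n : submod_closed (@is_coboundary n).
Proof.
split=> [|a x y]; rewrite !unfold_in /is_coboundary.
  apply/asboolP; exists (n - 1), (subrK 1 n), 0.
  by rewrite linear0.
move=> /asboolP[m [e [u du]]] /asboolP[m' [e' [v dv]]].
apply/asboolP; have emm' : m' = m by apply: (addIr 1); rewrite e e'.
subst m'; exists m, e, (a *: u + v).
by rewrite dga_d_linear du {1}(eq_irrelevance e e') dv.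
Qed.

HB.instance Definition _ n :=
  GRing.isSubmodClosed.Build F (cocycle n) (@is_coboundary n)
    (@is_coboundary_submod n).

Definition cohomology n : Type := Quotient.quot (@is_coboundary n).

HB.instance Definition _ n := GRing.Zmodule.on (cohomology n).
HB.instance Definition _ n := EqQuotient.on (cohomology n).

Lemma cohomology_eqP n (x y : cocycle n) :
  \pi_(cohomology n) x = \pi_(cohomology n) y <->
  x - y \in @is_coboundary n.
Proof.
rewrite Quotient.idealrBE; split=> [->|/eqP //]; exact: eqxx.
Qed.

Lemma cohomology_piD n :
  {morph \pi_(cohomology n) : x y / x + y}.
Proof. exact: Quotient.pi_add. Qed.

Definition cohomology_scale n (a : F) (x : cohomology n) : cohomology n :=
  \pi_(cohomology n) (a *: repr x).

Lemma cohomology_piZ n a (x : cocycle n) :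
  cohomology_scale a (\pi_(cohomology n) x) = \pi_(cohomology n) (a *: x).
Proof.
apply/cohomology_eqP; rewrite -scalerBr rpredZ //.
by apply/cohomology_eqP; rewrite reprK.
Qed.

Fact cohomology_scaleA n a b (x : cohomology n) :
  cohomology_scale a (cohomology_scale b x) = cohomology_scale (a * b) x.
Proof.
elim/quotW: x => x.
by rewrite (cohomology_piZ b) (cohomology_piZ a) cohomology_piZ scalerA. Qed.

Fact cohomology_scale1 n : left_id 1 (@cohomology_scale n).
Proof. by elim/quotW => x; rewrite cohomology_piZ scale1r. Qed.

Fact cohomology_scaleDr n : right_distributive (@cohomology_scale n) +%R.
Proof.
move=> a; elim/quotW=> x; elim/quotW=> y.
rewrite -cohomology_piD !cohomology_piZ.
by rewrite scalerDr cohomology_piD.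
Qed.

Fact cohomology_scaleDl n (x : cohomology n) :
  {morph (@cohomology_scale n)^~ x : a b / a + b}.
Proof.
move=> a b; elim/quotW: x => x.
by rewrite !cohomology_piZ scalerDl cohomology_piD.
Qed.

HB.instance Definition _ n := GRing.Zmodule_isLmodule.Build F (cohomology n)
  (@cohomology_scaleA n) (@cohomology_scale1 n) (@cohomology_scaleDr n)
  (@cohomology_scaleDl n).

Definition cohomology_class n (x : A n)
    (dx : dga_d (erefl (n + 1)) x = 0) : cohomology n :=
  \pi_(cohomology n) (Cocycle (introT eqP dx : x \in @is_cocycle n)).

Lemma cocycle_mul_subproof i j n (e : i + j = n)
  (x : cocycle i) (y : cocycle j) :
  dga_mul e (val x) (val y) \in @is_cocycle n.
Proof.
have el : (i + 1) + j = n + 1 by rewrite -e addrAC.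
have er : i + (j + 1) = n + 1 by rewrite -e addrA.
rewrite (is_cocycleP erefl) (dga_leibniz e erefl erefl erefl el er).
rewrite (eqP (cocycle_valP x)) (eqP (cocycle_valP y)).
by rewrite dga_mul0l dga_mul0r scaler0 addr0.
Qed.

Definition cocycle_mul i j n (e : i + j = n)
    (x : cocycle i) (y : cocycle j) : cocycle n :=
  Cocycle (cocycle_mul_subproof e x y).

Definition cohomology_mul i j n (e : i + j = n)
    (x : cohomology i) (y : cohomology j) : cohomology n :=
  \pi_(cohomology n) (cocycle_mul e (repr x) (repr y)).

Lemma cohomology_mulE i j n (e : i + j = n)
    (x : cocycle i) (y : cocycle j) :
  cohomology_mul e (\pi_(cohomology i) x) (\pi_(cohomology j) y)
  = \pi_(cohomology n) (cocycle_mul e x y).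
Proof.
pose x' := repr (\pi_(cohomology i) x).
pose y' := repr (\pi_(cohomology j) y).
transitivity (\pi_(cohomology n) (cocycle_mul e x y')).
  have : x' - x \in @is_coboundary i by apply/cohomology_eqP; rewrite reprK.
  move=> /asboolP[m [em [u du]]]; apply/cohomology_eqP/asboolP.
  have e1 : (m + j) + 1 = n by rewrite -e -em addrAC.
  have e2 : m + (j + 1) = n by rewrite -e1 addrA.
  exists (m + j), e1, (dga_mul erefl u (val y')).
  rewrite (dga_leibniz erefl em erefl e1 e e2) du (eqP (cocycle_valP y')).
  by rewrite dga_mul0r scaler0 addr0 !raddfB /= dga_mulBl.
have : y' - y \in @is_coboundary j by apply/cohomology_eqP; rewrite reprK.
move=> /asboolP[m [em [u du]]]; apply/cohomology_eqP/asboolP.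
have e1 : (i + m) + 1 = n by rewrite -e -em addrA.
have e2 : (i + 1) + m = n by rewrite -e1 addrAC.
exists (i + m), e1, ((-1) ^ i *: dga_mul erefl (val x) u).
rewrite linearZ /= (dga_leibniz erefl erefl em e1 e2 e) du.
rewrite (eqP (cocycle_valP x)) dga_mul0l add0r scalerA -expfzMl.
by rewrite mulrNN mulr1 exp1rz scale1r !raddfB /= dga_mulBr.
Qed.

End Cohomology.

(* In [fm_f3E] the degrees are: [ij], [jk] those of the products [x y] and
   [y z], [a] and [b] those of [f2 x y] and [f2 y z], [l] that of
   [f3 x y z], and [m = l + 1] the common degree of all terms. *)
Record A3_formality (F : fieldType) (A : connected_dga F) := A3Formality {
  fm_f1 : forall n : int, cohomology A n -> A n;
  fm_f2 : forall i j n : int, i + j = n + 1 ->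
    cohomology A i -> cohomology A j -> A n;
  fm_f3 : forall i j k n : int, i + j + k = n + 2 ->
    cohomology A i -> cohomology A j -> cohomology A k -> A n;
  fm_f1_linear : forall n, linear (@fm_f1 n);
  fm_f2_linear1 : forall (i j n : int) (e : i + j = n + 1) y,
    linear (fun x => fm_f2 e x y);
  fm_f2_linear2 : forall (i j n : int) (e : i + j = n + 1) x,
    linear (fun y => fm_f2 e x y);
  fm_f3_linear1 : forall (i j k n : int) (e : i + j + k = n + 2) y z,
    linear (fun x => fm_f3 e x y z);
  fm_f3_linear2 : forall (i j k n : int) (e : i + j + k = n + 2) x z,
    linear (fun y => fm_f3 e x y z);
  fm_f3_linear3 : forall (i j k n : int) (e : i + j + k = n + 2) x y,
    linear (fun z => fm_f3 e x y z);
  fm_df1 : forall n (x : cohomology A n),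
    dga_d (erefl (n + 1)) (fm_f1 x) = 0;
  fm_f1_iso : forall n,
    bijective (fun x : cohomology A n => cohomology_class (fm_df1 x));
  fm_f2E : forall (i j m n : int) (e : i + j = n) (e' : i + j = m + 1)
      (ed : m + 1 = n) (x : cohomology A i) (y : cohomology A j),
    dga_d ed (fm_f2 e' x y) =
      fm_f1 (cohomology_mul e x y) - dga_mul e (fm_f1 x) (fm_f1 y);
  fm_f3E : forall (i j k ij jk a b l m : int)
      (eij : i + j = ij) (ejk : j + k = jk)
      (ea : i + j = a + 1) (eb : j + k = b + 1)
      (el : i + j + k = l + 2) (ed : l + 1 = m)
      (eib : i + b = m) (eak : a + k = m)
      (eijk : ij + k = m + 1) (eijk' : i + jk = m + 1)
      (x : cohomology A i) (y : cohomology A j) (z : cohomology A k),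
    dga_d ed (fm_f3 el x y z)
      + (-1) ^ i *: dga_mul eib (fm_f1 x) (fm_f2 eb y z)
      - dga_mul eak (fm_f2 ea x y) (fm_f1 z)
    = fm_f2 eijk (cohomology_mul eij x y) z
      - fm_f2 eijk' x (cohomology_mul ejk y z)
}.

Definition A3_formal (F : fieldType) (A : connected_dga F) : Prop :=
  inhabited (A3_formality A).

HB.mixin Record isTopGroup G & Topological G & monoid.Group G := {
  mulg_continuous : continuous (fun x : G * G => (x.1 * x.2)%g);
  invg_continuous : continuous (fun x : G => (x^-1)%g)
}.

#[short(type="topGroupType")]
HB.structure Definition TopGroup :=
  {G of Topological G & monoid.Group G & isTopGroup G}.

Section ProP.
Local Open Scope group_scope.
Implicit Types (G P : topGroupType) (p q d : nat).

Definition subgroup G (H : set G) : Prop :=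
  [/\ H 1, forall x y, H x -> H y -> H (x * y) & forall x, H x -> H x^-1].

Definition normal_subgroup G (N : set G) : Prop :=
  subgroup N /\ forall x y, N x -> N (x ^ y).

Definition cosets G (H : set G) : set (set G) :=
  [set [set x * h | h in H] | x in [set: G]].

Definition profinite G : Prop :=
  [/\ compact [set: G], hausdorff_space G &
      forall U : set G, nbhs 1 U ->
        exists H : set G, [/\ open H, subgroup H & H `<=` U]].

Definition pro_p_group p G : Prop :=
  profinite G /\
  forall N : set G, open N -> normal_subgroup N ->
    exists k : nat, (cosets N #= `I_(p ^ k))%card.

Definition is_free_pro_p p d G (x : d.-tuple G) : Prop :=
  pro_p_group p G /\
  forall P (y : d.-tuple P), pro_p_group p P ->
    exists! f : G -> P,
      [/\ continuous f, {morph f : a b / a * b} &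
          forall i, f (tnth x i) = tnth y i].

Definition closed_normal_closure G (r : G) : set G :=
  [set g | forall N : set G, closed N -> normal_subgroup N -> N r -> N g].

(* [x] is indexed from 0, so the factors are the commutators
   [x_0, x_1], [x_2, x_3], ... of consecutive entries. *)
Definition demushkin_relator q d G (x : d.-tuple G) : G :=
  nth 1 x 0 ^+ q * \prod_(i < d./2) [~ nth 1 x i.*2, nth 1 x i.*2.+1].

Definition demushkin_presentation p d q G : Prop :=
  exists (E : topGroupType) (x : d.-tuple E) (f : E -> G),
    [/\ is_free_pro_p p x,
        continuous f /\ {morph f : a b / a * b},
        forall g, exists a, f a = g &
        f @^-1` [set 1] = closed_normal_closure (demushkin_relator q x)].

Definition demushkin_invariants p d q G : Prop :=
  (q = 0 \/ exists2 f, 0 < f & q = p ^ f)%N /\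
  demushkin_presentation p d q G.

End ProP.

Definition cart_power (G : Type) (n : nat) : Type :=
  prod_topology (fun _ : 'I_n => G).

HB.instance Definition _ (G : topologicalType) n :=
  Topological.on (cart_power G n).

Section Cochains.
Variables (p : nat) (G : topGroupType).

(* The value 1 out of range is never used in degrees for which the formulas
   below are meaningful, see [cobound] and [cup]. *)
Definition entry n (g : cart_power G n) (k : nat) : G :=
  oapp (g : 'I_n -> G) 1%g (insub k).

Definition merge_entries n (g : cart_power G n) (i k : nat) : G :=
  if (k < i)%N then entry g k
  else if k == i then (entry g k * entry g k.+1)%g
  else entry g k.+1.

(* Meant for [n = m.+1]; entries being numbered from 0, the [i]-th summand
   has sign exponent [i.+1]. *)
Definition cobound m n (f : cart_power G m -> 'F_p) (g : cart_power G n)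
    : 'F_p :=
  f (fun k : 'I_m => entry g k.+1)
  + \sum_(i < m) (-1) ^+ i.+1 * f (fun k : 'I_m => merge_entries g i k)
  + (-1) ^+ m.+1 * f (fun k : 'I_m => entry g k).

(* Meant for [n = (i + j)%N]. *)
Definition cup i j n (f : cart_power G i -> 'F_p) (h : cart_power G j -> 'F_p)
    (g : cart_power G n) : 'F_p :=
  f (fun k : 'I_i => entry g k) * h (fun k : 'I_j => entry g (i + k)%N).

(* In negative degrees the only cochain is 0. *)
Definition is_cochain (n : int) : {pred cart_power G `|n| -> ('F_p)^o} :=
  fun f => `[< continuous (f : cart_power G `|n| -> discrete_topology 'F_p)
               /\ (n < 0 -> f = 0) >].

Lemma locally_constP (T : topologicalType) (f : T -> discrete_topology 'F_p) :
  continuous f <-> forall x, \forall y \near x, f y = f x.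
Proof.
split=> [cf x|cf x]; first exact: (cf x [set f x] (discrete_set1 (f x))).
by apply/discrete_cvg; exact: cf.
Qed.

Lemma is_cochain_submod n : submod_closed (@is_cochain n).
Proof.
split=> [|a f g]; rewrite !unfold_in /is_cochain.
  by apply/asboolP; split=> // x; exact: cst_continuous.
move=> /asboolP[/locally_constP cf f0] /asboolP[/locally_constP cg g0].
apply/asboolP; split; last by move=> n0; rewrite f0 // g0 // scaler0 addr0.
apply/locally_constP => x; near=> y.
have fy : f y = f x by near: y; exact: cf.
have gy : g y = g x by near: y; exact: cg.
by rewrite [LHS]/(a *: f y + g y) fy gy.
Unshelve. all: by end_near. Qed.

HB.instance Definition _ n :=
  GRing.isSubmodClosed.Build 'F_p _ (@is_cochain n) (@is_cochain_submod n).

Record cochain (n : int) := Cochain {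
  cochain_fun :> cart_power G `|n| -> ('F_p)^o;
  cochainP : cochain_fun \in @is_cochain n
}.

HB.instance Definition _ n := [isSub for @cochain_fun n].
HB.instance Definition _ n := [Choice of cochain n by <:].
HB.instance Definition _ n :=
  [SubChoice_isSubLmodule of cochain n by <:].

Lemma cart_power_continuous (T : topologicalType) n
    (h : T -> cart_power G n) :
  (forall i : 'I_n, continuous (fun x => (h x : 'I_n -> G) i)) ->
  continuous h.
Proof.
move=> ch x; apply/cvg_sup => i U [V] [[W] oW <-] Whx VU.
apply: filterS VU _; apply: (ch i x W).
exact: open_nbhs_nbhs.
Qed.

Lemma entry_continuous n k : continuous (fun g : cart_power G n => entry g k).
Proof.
rewrite /entry; case: insubP => [i _ _|_] /=; last exact: cst_continuous.
exact: (@proj_continuous _ (fun _ : 'I_n => G) i).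
Qed.

Lemma mulg_fun_continuous (T : topologicalType) (f g : T -> G) :
  continuous f -> continuous g -> continuous (fun x => (f x * g x)%g).
Proof.
move=> cf cg x.
apply: (@continuous_comp _ _ _ (fun x => (f x, g x)) (fun z => (z.1 * z.2)%g)).
  by apply: cvg_pair; [exact: cf|exact: cg].
exact: mulg_continuous.
Qed.

Lemma merge_continuous n i k :
  continuous (fun g : cart_power G n => merge_entries g i k).
Proof.
rewrite /merge_entries; case: (k < i)%N; first exact: entry_continuous.
case: (k == i); last exact: entry_continuous.
by apply: mulg_fun_continuous; exact: entry_continuous.
Qed.

Lemma locally_const_comp m n (f : cart_power G m -> 'F_p)
    (h : cart_power G n -> cart_power G m) (x : cart_power G n) :
  (forall z, \forall y \near z, f y = f z) -> continuous h ->
  \forall y \near x, f (h y) = f (h x).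
Proof. by move=> cf ch; exact: (ch x _ (cf (h x))). Qed.

Lemma cochain_locally_const (m : int) (f : cochain m) x :
  \forall y \near x, f y = f x.
Proof.
by move: x; apply/locally_constP; case: f => f /= /asboolP[].
Qed.

Lemma cochain_neg (n : int) (f : cochain n) :
  n < 0 -> (f : cart_power G `|n| -> ('F_p)^o) = 0.
Proof. by case: f => f /= /asboolP[]. Qed.

Lemma cobound_is_cochain (m n : int) (e : m + 1 = n) (f : cochain m) :
  (cobound f : cart_power G `|n| -> ('F_p)^o) \in @is_cochain n.
Proof.
rewrite unfold_in; apply/asboolP; split; last first.
  move=> n0; apply/funext => g; rewrite /cobound cochain_neg; last by lia.
  by rewrite big1 ?mulr0 ?addr0 // => i _; rewrite mulr0.
apply/locally_constP => x.
have near_f (h : cart_power G `|n| -> cart_power G `|m|) :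
    continuous h -> \forall y \near x, f (h y) = f (h x).
  move=> ch.
  exact: (@locally_const_comp _ _ _ _ x (@cochain_locally_const m f) ch).
have near_sum : \forall y \near x, forall i : 'I_`|m|,
    f (fun k : 'I_`|m| => merge_entries y i k) =
    f (fun k : 'I_`|m| => merge_entries x i k).
  apply: (@filter_forall _ _ _ _ (nbhs_filter x)) => i.
  apply: (near_f (fun y k => merge_entries y i k)).
  apply: cart_power_continuous => k.
  exact: merge_continuous.
near=> y; rewrite /cobound; congr (_ + _ + _ * _).
- near: y; apply: (near_f (fun y k => entry y k.+1)).
  by apply: cart_power_continuous => k; exact: entry_continuous.
- apply: eq_bigr => i _; congr (_ * _).
  by move: i; near: y; exact: near_sum.
- near: y; apply: (near_f (fun y k => entry y k)).
  by apply: cart_power_continuous => k; exact: entry_continuous.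
Unshelve. all: by end_near. Qed.

Lemma cup_is_cochain (i j n : int) (e : i + j = n)
    (f : cochain i) (h : cochain j) :
  (cup f h : cart_power G `|n| -> ('F_p)^o) \in @is_cochain n.
Proof.
rewrite unfold_in; apply/asboolP; split; last first.
  move=> n0; apply/funext => g; rewrite /cup.
  have [i0|i0] := ltP i 0; first by rewrite cochain_neg // mul0r.
  by rewrite (@cochain_neg j) ?mulr0 //; lia.
apply/locally_constP => x; near=> y; rewrite /cup; congr (_ * _); near: y.
- apply: (@locally_const_comp _ _ _ (fun y k => entry y k)).
    exact: cochain_locally_const.
  by apply: cart_power_continuous => k; exact: entry_continuous.
- apply: (@locally_const_comp _ _ _ (fun y k => entry y (`|i| + k)%N)).
    exact: cochain_locally_const.
  by apply: cart_power_continuous => k; exact: entry_continuous.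
Unshelve. all: by end_near. Qed.

Lemma one_is_cochain :
  ((fun=> 1) : cart_power G `|0%:Z| -> ('F_p)^o) \in @is_cochain 0.
Proof.
by rewrite unfold_in; apply/asboolP; split=> // x; exact: cst_continuous.
Qed.

Definition cochain_d (m n : int) (e : m + 1 = n) (f : cochain m) : cochain n :=
  Cochain (cobound_is_cochain e f).

Definition cochain_mul (i j n : int) (e : i + j = n)
    (f : cochain i) (h : cochain j) : cochain n :=
  Cochain (cup_is_cochain e f h).

Definition cochain_one : cochain 0 := Cochain one_is_cochain.

(* The face maps on infinite sequences, in which the three kinds of terms of
   the differential become uniform. *)
Definition face (i : nat) (h : nat -> G) (k : nat) : G :=
  if i is j.+1 then
    if (k < j)%N then h k
    else if k == j then (h k * h k.+1)%g else h k.+1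
  else h k.+1.

Definition cut m (h : nat -> G) : cart_power G m := fun k => h k.
Arguments cut : clear implicits.

Lemma entry_cut m h k : (k < m)%N -> entry (cut m h) k = h k.
Proof. by move=> km; rewrite /entry insubT. Qed.

Lemma eq_cut m h h' :
  (forall k, (k < m)%N -> h k = h' k) -> cut m h = cut m h'.
Proof. by move=> hh'; apply/funext => k; exact: hh'. Qed.

Lemma eq_face i m h h' : (forall k, (k < m.+1)%N -> h k = h' k) ->
  cut m (face i h) = cut m (face i h').
Proof.
move=> hh'; apply: eq_cut => k km; rewrite /face.
have h1 := hh' k (ltnW km); have h2 := hh' k.+1 km.
by case: i => // i; rewrite h1 h2.
Qed.

Lemma face_face i j h k : (j <= i)%N ->
  face j (face i.+1 h) k = face i (face j h) k.
Proof.
case: j i => [|j] [|i] //= ji.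
rewrite /face; do !case: ifPn => ? //; rewrite ?mulgA //; exfalso; lia.
Qed.

Lemma coboundE m n (f : cart_power G m -> 'F_p) (g : cart_power G n) :
  cobound f g =
  \sum_(i < m.+2) (-1) ^+ i * f (cut m (face i (entry g))).
Proof.
rewrite big_ord_recl big_ord_recr /= expr0 mul1r addrA /cobound.
congr (_ + _ + _ * f _); apply/funext => k /=.
by rewrite /cut /= ltn_ord.
Qed.

Lemma alternating_sum0 n (a : nat -> nat -> 'F_p) :
  (forall i j, (j <= i)%N -> a j i.+1 = a i j) ->
  \sum_(i < n.+1) \sum_(j < n) (-1) ^+ i * ((-1) ^+ j * a j i) = 0.
Proof.
move=> aE; elim: n => [|n IHn].
  by rewrite big1 // => i _; rewrite big_ord0.
rewrite big_ord_recr /=.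
under eq_bigr do rewrite big_ord_recr /=.
rewrite big_split /= IHn add0r -big_split big1 // => i _ /=.
rewrite aE -1?ltnS // exprS; ring.
Qed.

Lemma cobound_cobound m (f : cart_power G m -> 'F_p) (g : cart_power G m.+2) :
  cobound (cobound f : cart_power G m.+1 -> 'F_p) g = 0.
Proof.
rewrite coboundE -[RHS](@alternating_sum0 m.+2
  (fun j i => f (cut m (face j (face i (entry g)))))).
  apply: eq_bigr => i _; rewrite coboundE big_distrr; apply: eq_bigr => j _.
  congr (_ * (_ * f _)); apply: eq_face => k km; exact: entry_cut.
by move=> i j ji; congr (f _); apply: eq_cut => k _; exact: face_face.
Qed.

Lemma cobound_cup i j (f : cart_power G i -> 'F_p) (h : cart_power G j -> 'F_p)
    (g : cart_power G (i + j).+1) :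
  cobound (cup f h : cart_power G (i + j) -> 'F_p) g =
  cup (cobound f : cart_power G i.+1 -> 'F_p) h g
  + (-1) ^+ i * cup f (cobound h : cart_power G j.+1 -> 'F_p) g.
Proof.
set e := entry g; pose s k := e (i + k)%N; pose s' k := e (i.+1 + k)%N.
transitivity (\sum_(0 <= t < i.+1 + j.+1)
  (-1) ^+ t * (f (cut i (face t e)) * h (cut j (fun k => face t e (i + k)%N)))).
  rewrite coboundE addSn addnS big_mkord; apply: eq_bigr => t _.
  congr (_ * (f _ * h _)); apply/funext => k.
    by rewrite entry_cut // ltn_addr.
  by rewrite entry_cut // ltn_add2l.
rewrite (big_cat_nat (n := i.+1)) //=; last exact: leq_addr.
have -> : cup (cobound f : cart_power G i.+1 -> 'F_p) h g =
    (\sum_(0 <= t < i.+1) (-1) ^+ t * f (cut i (face t e))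
     + (-1) ^+ i.+1 * f (cut i e)) * h (cut j s').
  rewrite /cup coboundE big_ord_recr /= big_mkord; congr ((_ + _ * f _) * _).
    apply: eq_bigr => t _; congr (_ * f _); apply: eq_face => k ki.
    exact: entry_cut.
  apply/funext => k; rewrite /cut /= ltn_ord.
  by apply: entry_cut; rewrite ltnS ltnW.
have -> : cup f (cobound h : cart_power G j.+1 -> 'F_p) g =
    f (cut i e) * (h (cut j s') +
      \sum_(1 <= t < j.+2) (-1) ^+ t * h (cut j (face t s))).
  rewrite /cup coboundE; congr (_ * _).
  rewrite -(big_mkord xpredT (fun t => (-1) ^+ t * h (cut j (face t _)))).
  rewrite big_ltn //=; congr (_ + _).
    rewrite expr0 mul1r; congr (h _); apply/funext => k; rewrite /cut /=.
    by rewrite [LHS](@entry_cut j.+1 s) ?ltnS // /s /s' addSnnS.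
  apply: eq_bigr => t _; congr (_ * h _); apply: eq_face => k kj.
  exact: entry_cut.
have -> : \sum_(0 <= t < i.+1) (-1) ^+ t *
      (f (cut i (face t e)) * h (cut j (fun k => face t e (i + k)%N)))
    = (\sum_(0 <= t < i.+1) (-1) ^+ t * f (cut i (face t e))) * h (cut j s').
  rewrite big_distrl; apply: eq_big_nat => t /andP[_ ti] /=.
  rewrite -mulrA; congr (_ * (_ * h _)); apply: eq_cut => k _.
  rewrite /s' addSn /face; case: t ti => [|t] ti //.
  have -> : (i + k < t)%N = false by lia.
  have -> : (i + k == t)%N = false by lia.
  by [].
have -> : \sum_(i.+1 <= t < i.+1 + j.+1) (-1) ^+ t *
      (f (cut i (face t e)) * h (cut j (fun k => face t e (i + k)%N)))
    = (-1) ^+ i * (f (cut i e) *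
      \sum_(1 <= t < j.+2) (-1) ^+ t * h (cut j (face t s))).
  have -> : (i.+1 + j.+1 = j.+2 + i)%N by lia.
  rewrite -[X in index_iota X _]add1n big_addn addnK.
  rewrite !big_distrr; apply: eq_big_nat => -[//|t] /andP[_ tj] /=.
  rewrite exprD [(-1) ^+ t.+1 * _]mulrC -mulrA; congr (_ * _).
  rewrite [RHS]mulrCA; congr (_ * (f _ * h _)); apply: eq_cut => k kl.
    by rewrite /face /= ltn_addl.
  by rewrite /face /s [(t + i)%N]addnC ltn_add2l eqn_add2l addnS.
by rewrite exprS; ring.
Qed.

Lemma cup_assoc i j k (f : cart_power G i -> 'F_p) (h : cart_power G j -> 'F_p)
    (l : cart_power G k -> 'F_p) (g : cart_power G (i + j + k)) :
  cup f (cup h l : cart_power G (j + k) -> 'F_p) g =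
  cup (cup f h : cart_power G (i + j) -> 'F_p) l g.
Proof.
rewrite /cup mulrA; congr (_ * _ * _); congr (_ _); apply/funext => t.
- by apply/esym/(@entry_cut (i + j) (entry g)); rewrite ltn_addr.
- rewrite (@entry_cut (j + k) (fun t => entry g (i + t))) ?ltn_addr //.
  by rewrite (@entry_cut (i + j) (entry g)) // ltn_add2l.
- rewrite (@entry_cut (j + k) (fun t => entry g (i + t))) ?ltn_add2l //.
  by rewrite addnA.
Qed.

Lemma cochain_eqP (n : int) (f h : cochain n) :
  (forall g, f g = h g) -> f = h.
Proof. by move=> fh; apply/val_inj/funext. Qed.

Lemma cochain_eq0 (n : int) (f : cochain n) : n < 0 -> f = 0.
Proof. by move=> n0; apply/val_inj; exact: cochain_neg. Qed.

Lemma cochain0E (n : int) g : (0 : cochain n) g = 0.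
Proof. by []. Qed.

Lemma cochain_addE (n : int) (f h : cochain n) g : (f + h) g = f g + h g.
Proof. by []. Qed.

Lemma cochain_scaleE (n : int) a (f : cochain n) g : (a *: f) g = a * f g.
Proof. by []. Qed.

Lemma cobound_linear m n a (f h : cart_power G m -> 'F_p)
    (g : cart_power G n) :
  cobound (fun x => a * f x + h x) g = a * cobound f g + cobound h g.
Proof.
rewrite /cobound (eq_bigr (fun i : 'I_m =>
  a * ((-1) ^+ i.+1 * f (fun k : 'I_m => merge_entries g i k))
  + (-1) ^+ i.+1 * h (fun k : 'I_m => merge_entries g i k))).
  by rewrite big_split /= -big_distrr /=; ring.
by move=> i _; ring.
Qed.

Lemma cochain_d_linear (m n : int) (e : m + 1 = n) : linear (cochain_d e).
Proof.
by move=> a f h; apply: cochain_eqP => g;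
 exact: (cobound_linear a f h g).
Qed.

Lemma cup_linearl i j n a (f f' : cart_power G i -> 'F_p)
    (h : cart_power G j -> 'F_p) (g : cart_power G n) :
  cup (fun x => a * f x + f' x) h g = a * cup f h g + cup f' h g.
Proof. by rewrite /cup mulrDl mulrA. Qed.

Lemma cup_linearr i j n a (f : cart_power G i -> 'F_p)
    (h h' : cart_power G j -> 'F_p) (g : cart_power G n) :
  cup f (fun x => a * h x + h' x) g = a * cup f h g + cup f h' g.
Proof. by rewrite /cup mulrDr mulrCA. Qed.

Lemma cochain_mul_linearl (i j n : int) (e : i + j = n) (h : cochain j) :
  linear (fun f => cochain_mul e f h).
Proof.
by move=> a f f'; apply: cochain_eqP => g;
 exact: (cup_linearl a f f' h g).
Qed.

Lemma cochain_mul_linearr (i j n : int) (e : i + j = n) (f : cochain i) :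
  linear (cochain_mul e f : cochain j -> cochain n).
Proof.
by move=> a h h'; apply: cochain_eqP => g;
 exact: (cup_linearr a f h h' g).
Qed.

Lemma cochain_d0 (m n : int) (e : m + 1 = n) : cochain_d e 0 = 0.
Proof.
have := cochain_d_linear e (-1) 0 0.
by rewrite scaler0 addr0 scaleN1r addNr => ->.
Qed.

Lemma cochain_mul0l (i j n : int) (e : i + j = n) (h : cochain j) :
  cochain_mul e 0 h = 0.
Proof. by apply: cochain_eqP => g; exact: mul0r. Qed.

Lemma cochain_mul0r (i j n : int) (e : i + j = n) (f : cochain i) :
  cochain_mul e f 0 = 0.
Proof. by apply: cochain_eqP => g; exact: mulr0. Qed.

Lemma cut_entry n (g : cart_power G n) : cut n (entry g) = g.
Proof.
apply/funext => k; rewrite /cut /entry insubT //= => kn.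
by apply: (congr1 (g : 'I_n -> G)); exact: val_inj.
Qed.

Lemma cochain_mul1l (n : int) (e : 0 + n = n) (f : cochain n) :
  cochain_mul e cochain_one f = f.
Proof.
apply: cochain_eqP => g; rewrite /= /cup mul1r; congr (f _).
exact: cut_entry.
Qed.

Lemma cochain_mul1r (n : int) (e : n + 0 = n) (f : cochain n) :
  cochain_mul e f cochain_one = f.
Proof.
apply: cochain_eqP => g; rewrite /= /cup mulr1; congr (f _).
exact: cut_entry.
Qed.

Lemma cochain_mulA (i j k ij jk n : int) (eij : i + j = ij) (ejk : j + k = jk)
    (el : ij + k = n) (er : i + jk = n) (f : cochain i) (h : cochain j)
    (l : cochain k) :
  cochain_mul er f (cochain_mul ejk h l) =
  cochain_mul el (cochain_mul eij f h) l.
Proof.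
have [i0|] := ltP i 0.
  by rewrite (cochain_eq0 f i0) !cochain_mul0l.
have [j0|] := ltP j 0.
  by rewrite (cochain_eq0 h j0) cochain_mul0l !cochain_mul0r cochain_mul0l.
have [k0|] := ltP k 0.
  by rewrite (cochain_eq0 l k0) !cochain_mul0r.
case: k l ejk el => // k l ejk el _; case: j h eij ejk => // j h eij ejk _.
case: i f eij er => // i f eij er _.
have ijE : ij = (i + j)%N by lia.
have jkE : jk = (j + k)%N by lia.
have nE : n = (i + j + k)%N by lia.
move: eij ejk el er; rewrite ijE jkE nE => eij ejk el er.
by apply: cochain_eqP => g; exact: (@cup_assoc i j k f h l g).
Qed.

Lemma cochain_dd (m n k : int) (e1 : m + 1 = n) (e2 : n + 1 = k)
    (f : cochain m) :
  cochain_d e2 (cochain_d e1 f) = 0.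
Proof.
have [m0|] := ltP m 0; first by rewrite (cochain_eq0 f m0) !cochain_d0.
case: m f e1 => // m f e1 _.
have en : n = m.+1 by lia.
have ek : k = m.+2 by lia.
move: e1 e2; rewrite en ek => e1 e2; apply: cochain_eqP => g.
exact: (@cobound_cobound m f g).
Qed.

Lemma cochain_leibniz (i j n i' j' n' : int) (e : i + j = n)
    (ei : i + 1 = i') (ej : j + 1 = j') (en : n + 1 = n')
    (el : i' + j = n') (er : i + j' = n') (f : cochain i) (h : cochain j) :
  cochain_d en (cochain_mul e f h) =
  cochain_mul el (cochain_d ei f) h
  + (-1) ^ i *: cochain_mul er f (cochain_d ej h).
Proof.
have [i0|] := ltP i 0.
  by rewrite (cochain_eq0 f i0) cochain_d0 !cochain_mul0l cochain_d0 scaler0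
    addr0.
have [j0|] := ltP j 0.
  by rewrite (cochain_eq0 h j0) cochain_d0 !cochain_mul0r cochain_d0 scaler0
    addr0.
case: j h e ej el => // j h e ej el _; case: i f e ei er => // i f e ei er _.
have ei' : i' = i.+1 by lia.
have ej' : j' = j.+1 by lia.
have enn : n = (i + j)%N by lia.
have en' : n' = (i + j).+1 by lia.
move: e ei ej en el er; rewrite ei' ej' enn en' => e ei ej en el er.
by apply: cochain_eqP => g; exact: (@cobound_cup i j f h g).
Qed.

Definition cochain_dga : dga 'F_p :=
  Dga cochain_d_linear cochain_mul_linearl cochain_mul_linearr
    cochain_mul1l cochain_mul1r cochain_mulA cochain_dd cochain_leibniz.

Lemma cochain_deg0 : bijective (fun a : 'F_p => a *: cochain_one).
Proof.
exists (fun f : cochain 0 => f (fun=> 1%g)) => [a|f] /=.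
  exact: mulr1.
apply: cochain_eqP => g; apply: (etrans (mulr1 _)); congr (cochain_fun f _).
by apply/funext => -[].
Qed.

Definition cochains : connected_dga 'F_p :=
  @ConnectedDga _ cochain_dga
    (fun n n0 f => cochain_eq0 f n0) cochain_deg0.

End Cochains.

Definition has_dim (F : fieldType) (V : lmodType F) (n : nat) : Prop :=
  exists f : {linear V -> 'rV[F]_n}, bijective f.

Definition nondegenerate (F : fieldType) (U V W : lmodType F)
    (b : U -> V -> W) : Prop :=
  (forall x, (forall y, b x y = 0) -> x = 0) /\
  (forall y, (forall x, b x y = 0) -> y = 0).

Definition demushkin (p : nat) (G : topGroupType) : Prop :=
  let H n : lmodType 'F_p := cohomology (cochains p G) n in
  [/\ pro_p_group p G,
      (exists n : nat, has_dim (H 1) n),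
      has_dim (H 2) 1 &
      @nondegenerate _ (H 1) (H 1) (H 2)
        (cohomology_mul (erefl : 1 + 1 = 2))].

(* Main.v *)
Require Import Defs.
From HB Require Import structures.
From mathcomp Require Import all_boot all_order all_algebra.
From mathcomp Require Import all_fingroup all_solvable ring zify.
From mathcomp Require Import all_classical topology.

(* Let [E -> G] be the presentation of [G], with relator [r]. A function on [E]
   whose coboundary comes from [G] descends to [G] as soon as it vanishes at
   [r]; this is used both with trivial and with nontrivial coefficients.

   Dimension. For [n > 2], a cocycle of degree [n] is a 2-cocycle with values
   in the cochains of degree [n - 2], and it becomes a coboundary on [E], of [s]
   say. Modulo the square of the augmentation ideal, a derivation [D] satisfies
   [D r = sum (y - 1) D x - (x - 1) D y] over the pairs of generators [(x, y)];
   by Nakayama's lemma [D r] takes every value in the augmentation submodule.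
   Since [G] is infinite, [s r] lies in this submodule, over a smaller open
   subgroup if necessary. Hence some [s - D] vanishes at [r], and descends:
   the cohomology of [G] vanishes above degree 2.

   Formality. Sending the generators of each pair to [1 + X + YX] and
   [1 + Y + XY] defines a homomorphism from [E] to the units of the free
   noncommutative algebra truncated in degree 4. If [p] divides ['C(q, 2)] and
   ['C(q, 3)], it maps [r] to [1 + sum (XY - YX)], without cubic terms. Its
   quadratic and cubic coefficients then provide [f2] and [f3] in degree 1;
   what remains is unobstructed since the cohomology vanishes above degree 2.

   If [p = q = 3], the cubic term of [x_0 ^ 3] gives a Massey product
   [<chi, chi, chi>] which is nonzero. *)

Set Implicit Arguments.
Unset Strict Implicit.
Unset Printing Implicit Defensive.

Import Order.TTheory GRing.Theory FinRing.Theory Num.Theory.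

(** * Pro-p groups *)

(** The universal property of [E] yields only homomorphisms. So every function on [E] is obtained as
    a coordinate of a homomorphism into a finite p-group: a primitive of a 2-cocycle lives in the
    extension that the cocycle defines, a derivation in the split extension, the Magnus coefficients
    in a group of truncated series. The module argument takes place over a finite quotient [Q],
    where submodules allow induction on their order.

    Why a smaller open subgroup helps: a cocycle that factors through [G/V] is read over a larger
    quotient [Q], in which the image [K] of [V] has order divisible by [p]. For [n > 2] the
    coefficients are functions of at least one variable, which behave as an induced module. There a
    [K]-invariant element is congruent, modulo the augmentation submodule, to a sum of terms
    constant on the cosets of [K], and this sum is 0.

    The bound on [q] comes from the cubic coefficient ['C(q, 3)] of a [q]-th power: for [q] a power
    of an odd prime [p], [p] divides it unless [q = 3]. Since [H^2] is nonzero, [f3] on three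
    classes of degree 1 needs an explicit primitive. *)

Section Discrete.
Local Open Scope classical_set_scope.

(** The alias carries the discrete topology, which makes finite p-groups available as targets in
    [is_free_pro_p]. *)
Definition discrete (gT : finGroupType) : Type := gT.
HB.instance Definition _ gT := Finite.on (discrete gT).
HB.instance Definition _ gT :=
  Topological.copy (discrete gT) (discrete_topology gT).
HB.instance Definition _ gT := monoid.Group.copy (discrete gT) gT.

Variable gT : finGroupType.

Lemma discrete_nbhs (x : discrete gT) : nbhs x [set x].
Proof. exact: (@discrete_set1 (discrete_topology gT)). Qed.

Lemma discrete_continuous (T : topologicalType) (f : T -> discrete gT) :
  continuous f <-> forall x, \forall y \near x, f y = f x.
Proof.
split=> [cf x|cf x]; first exact: (cf x [set f x] (@discrete_nbhs (f x))).
by apply/(@discrete_cvg (discrete_topology gT)); exact: cf.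
Qed.

Fact discrete_mulg_continuous :
  continuous (fun x : discrete gT * discrete gT => (x.1 * x.2)%g).
Proof.
apply/discrete_continuous => -[x y].
exists ([set x], [set y]); first by split; exact: discrete_nbhs.
by move=> [u v] /= [-> ->].
Qed.

Fact discrete_invg_continuous : continuous (fun x : discrete gT => (x^-1)%g).
Proof.
apply/discrete_continuous => x; near=> y; congr (_ ^-1)%g.
by near: y; exact: discrete_nbhs.
Unshelve. all: by end_near. Qed.

HB.instance Definition _ := isTopGroup.Build (discrete gT)
  discrete_mulg_continuous discrete_invg_continuous.

Lemma discrete_finite_set (A : set (discrete gT)) : finite_set A.
Proof. exact: finite_finset. Qed.

Lemma card_cosets_discrete (H : {group gT}) (N : set (discrete gT)) :
  (forall x, N x <-> x \in H) -> (cosets N #= `I_(#|[set: gT]%SET : H|)%g)%card.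
Proof.
move=> NH; rewrite -card_lcosets.
set n := #|_|.
pose f (i : 'I_n) : set (discrete gT) := [set x | x \in enum_val i].
have -> : cosets N = [set f i | i in [set: 'I_n]].
  apply/seteqP; split=> [A [x _ <-]|A [i _ <-]].
    have xL : (x *: H)%g \in lcosets H [set: gT]%SET by apply/lcosetsP; exists x; rewrite ?inE.
    exists (enum_rank_in xL (x *: H)%g) => //; rewrite /f enum_rankK_in //.
    apply/seteqP; split=> [y /=|y /= [h Nh <-]].
      rewrite mem_lcoset => xy; exists (x^-1 * y)%g; first exact/NH.
      by rewrite mulVKg.
    by rewrite mem_lcoset mulKg; apply/NH.
  have /lcosetsP[x _ iE] := enum_valP i.
  exists x => //; rewrite /f iE.
  apply/seteqP; split=> [y /= [h Nh <-]|y /=].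
    by rewrite mem_lcoset mulKg; apply/NH.
  rewrite mem_lcoset => xy; exists (x^-1 * y)%g; first exact/NH.
  by rewrite mulVKg.
apply: card_eq_trans (card_esym card_II).
apply: inj_card_eq => i j _ _ fij.
apply: enum_val_inj; apply/setP => x.
have e : f i x <-> f j x by rewrite fij.
by apply/idP/idP => h; apply/e.
Qed.

Lemma subgroup_discrete (N : set (discrete gT)) : subgroup N ->
  exists H : {group gT}, forall x, N x <-> x \in H.
Proof.
case=> N1 NM _; pose A : {set gT} := [set x | `[< N x >]]%SET.
have AE x : x \in A <-> N x by rewrite finset.in_set; split=> /asboolP.
have gA : group_set A.
  apply/group_setP; split=> [|x y]; first by apply/AE; exact: N1.
  by move=> /AE Nx /AE Ny; apply/AE; exact: NM.
by exists (Group gA) => x; split=> /AE.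
Qed.

Lemma pro_p_discrete (p : nat) : (p.-group [set: gT]%SET)%g -> pro_p_group p (discrete gT).
Proof.
move=> pG; split.
  split.
  - exact: finite_compact (discrete_finite_set _).
  - exact: (@discrete_hausdorff (discrete_topology gT)).
  move=> U U1; exists [set 1%g]; split.
  - exact: (@discrete_open (discrete_topology gT)).
  - split=> //= [x y -> ->|x ->]; [exact: mulg1|exact: invg1].
  by move=> _ ->; exact: nbhs_singleton U1.
move=> N _ [/subgroup_discrete[H NH] _].
have /p_natP[k kE] : p.-nat #|[set: gT]%SET : H|%g.
  by apply: pnat_dvd pG; exact: dvdn_indexg.
by exists k; rewrite -kE; exact: card_cosets_discrete.
Qed.

End Discrete.

(** * Open normal subgroups and finite quotients *)

Section Quotients.
Local Open Scope classical_set_scope.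
Local Open Scope group_scope.
Variable G : topGroupType.
Implicit Types (N U : set G) (x y : G).

Lemma mulgl_continuous x : continuous (fun y => x * y).
Proof. by apply: mulg_fun_continuous => [|? //]; exact: cst_continuous. Qed.

Lemma open_subgroupP N : subgroup N -> nbhs 1 N -> open N.
Proof.
move=> [_ NM _] N1; rewrite openE => x Nx; rewrite /interior.
have Nx1 : \forall y \near x, N (x^-1 * y).
  by apply: (@mulgl_continuous x^-1 x); rewrite mulVg.
near=> y; have : N (x^-1 * y) by near: y; exact: Nx1.
by move=> /(NM _ _ Nx); rewrite mulVKg.
Unshelve. all: by end_near. Qed.

(** [N] is the intersection of the conjugates of [H]. It is open because conjugation is jointly
    continuous and [G] is compact: a single neighbourhood of 1 is carried into [H] by all
    conjugations at once. *)
Lemma open_normal_basis U : profinite G -> nbhs 1 U ->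
  exists N, [/\ open N, normal_subgroup N & N `<=` U].
Proof.
move=> [cG _ basis] /basis[H [oH [H1 HM HV] HU]].
pose N : set G := [set g | forall x, H (g ^ x)].
have sN : subgroup N.
  split=> [x|x y Nx Ny z|x Nx z]; first by rewrite conj1g.
    by rewrite conjMg; exact: HM.
  by rewrite conjVg; exact: HV.
exists N; split; last by move=> g /(_ 1); rewrite conjg1; exact: HU.
- apply: open_subgroupP => //.
  have cc : continuous (fun z : G * G => z.2 ^ z.1).
    apply: mulg_fun_continuous.
      move=> z; apply: continuous_comp; last exact: invg_continuous.
      exact: cvg_fst.
    apply: mulg_fun_continuous => ?; [exact: cvg_snd|exact: cvg_fst].
  have near1 x : [set: G] x -> \forall y \near x & g \near (1 : G), H (g ^ y).
    by move=> _; apply: (cc (x, 1) H); rewrite /= conj1g; exact: open_nbhs_nbhs.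
  have cov := (@compact_near_coveringP _ [set: G]).1 cG.
  have : \forall g \near (1 : G), [set: G] `<=` (fun x => H (g ^ x)).
    exact: cov (nbhs_filter _) near1.
  by apply: filterS => g Hg x; exact: Hg.
- by split=> // x y Nx z; rewrite -conjgM.
Qed.

(* The coset space is enumerated by the definition of a pro-[p] group, so the
   quotient group can be put on a type of ordinals. *)
Lemma open_normal_quotient p N : prime p -> pro_p_group p G -> open N ->
  normal_subgroup N ->
  exists (Q : finGroupType) (pi : G -> Q),
    [/\ p.-group [set: Q]%SET, {morph pi : x y / x * y},
        forall q, exists x, pi x = q & forall x y, pi x = pi y <-> N (x^-1 * y)].
Proof.
move=> p_pr [_ pG] oN nN; have [k /card_set_bijP[b [bI bi bs]]] := pG N oN nN.
have [[N1 NM NV] NJ] := nN.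
have cN x : cosets N [set x * h | h in N] by exists x.
pose pi x : 'I_(p ^ k) := Ordinal (bI _ (cN x)).
have piP x y : pi x = pi y <-> N (x^-1 * y).
  split=> [/(congr1 val) /= /bi|Nxy]; last first.
    apply: val_inj => /=; congr b; apply/seteqP.
    split=> _ [h Nh <-]; [exists ((x^-1 * y)^-1 * h)|exists (x^-1 * y * h)].
    - by apply: NM => //; exact: NV.
    - by rewrite invMg invgK !mulgA mulgV mul1g.
    - exact: NM.
    - by rewrite !mulgA mulgV mul1g.
  rewrite !inE => /(_ (cN _) (cN _)) e.
  have : [set y * h | h in N] y by exists 1 => //; rewrite mulg1.
  by rewrite -e => -[h Nh <-]; rewrite mulKg.
have pi_surj q : exists x, pi x = q.
  have [_ [x _ <-] bx] := bs q (ltn_ord q).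
  by exists x; exact: val_inj.
have [s sK] := choice pi_surj.
have sN x : N (x^-1 * s (pi x)) by apply/piP; rewrite sK.
have piM x x' y y' : pi x = pi x' -> pi y = pi y' -> pi (x * y) = pi (x' * y').
  move=> /piP Nx /piP Ny; apply/piP.
  have -> : (x * y)^-1 * (x' * y') = (x^-1 * x') ^ y * (y^-1 * y').
    by rewrite conjgE invMg !mulgA mulgK.
  by apply: NM => //; exact: NJ.
pose mul q q' := pi (s q * s q').
have piE x y : mul (pi x) (pi y) = pi (x * y) by apply: piM; rewrite sK.
have mulA : associative mul.
  by move=> q q' q''; rewrite -(sK q) -(sK q') -(sK q'') !piE mulgA.
have mul1 : left_id (pi 1) mul by move=> q; rewrite -(sK q) piE mul1g.
have mulV : left_inverse (pi 1) (fun q => pi (s q)^-1) mul.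
  by move=> q; rewrite -{2}(sK q) piE mulVg.
pose Q : finGroupType := HB.pack 'I_(p ^ k)
  (Finite_isGroup.Build 'I_(p ^ k) mulA mul1 mulV).
exists Q, pi; split=> //.
- by rewrite /pgroup cardsT card_ord pnatX pnat_id ?orbT.
Qed.

(** Compactness of the power of [G], in its near-covering form: what holds near each point for all
    small [N] holds everywhere for some [N]. *)
Lemma uniformly_locally_constant (A : Type) n (z : cart_power G n -> A) :
  profinite G -> (forall u, \forall v \near u, z v = z u) ->
  exists N, [/\ open N, normal_subgroup N &
    forall u v : cart_power G n,
      (forall i : 'I_n, N (((u : 'I_n -> G) i)^-1 * (v : 'I_n -> G) i)) -> z u = z v].
Proof.
move=> pfG zc.
pose box (u : cart_power G n) (N : set G) : set (cart_power G n) :=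
  [set v : cart_power G n |
    forall i : 'I_n, N (((u : 'I_n -> G) i)^-1 * (v : 'I_n -> G) i)].
pose on N := open N /\ normal_subgroup N.
have onI N N' : on N -> on N' -> on (N `&` N').
  move=> [oN [[N1 NM NV] NJ]] [oN' [[N1' NM' NV'] NJ']]; split; first exact: openI.
  split; first split.
  - by split.
  - by move=> x y [? ?] [? ?]; split; [exact: NM|exact: NM'].
  - by move=> x [? ?]; split; [exact: NV|exact: NV'].
  - by move=> x y [? ?]; split; [exact: NJ|exact: NJ'].
have onT : on setT by split; [exact: openT|].
(* The filter generated by the sets [b N]. With [box u] it converges to [u]; with the down-sets of
   [N] it expresses validity for all sufficiently small [N]. *)
pose FT (T : Type) (b : set G -> set T) : set_system T :=
  [set S | exists N, on N /\ b N `<=` S].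
have FTF T (b : set G -> set T) :
    (forall N N', N `<=` N' -> b N `<=` b N') -> Filter (FT T b).
  move=> bS; split.
  - by exists setT.
  - move=> S S' [N [oN NS]] [N' [oN' NS']]; exists (N `&` N'); split; first exact: onI.
    by move=> t bt; split; [apply: NS|apply: NS']; apply: bS bt => // ? [].
  - by move=> S S' SS' [N [oN NS]]; exists N; split=> // t /NS /SS'.
have box_cvg u : FT _ (box u) --> u.
  have F : Filter (FT _ (box u)).
    by apply: FTF => N N' NN' v bv i; exact: NN'.
  apply/cvg_sup => i U [V] [[W] oW <-] Whx VU.
  apply: filterS VU _.
  have : nbhs 1 (fun g => W ((u : 'I_n -> G) i * g)).
    by apply: (@mulgl_continuous ((u : 'I_n -> G) i) 1); rewrite mulg1; exact: open_nbhs_nbhs.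
  move=> /(open_normal_basis pfG)[N [oN nN NW]]; exists N; split=> // v bv.
  by have := NW _ (bv i); rewrite mulVKg.
have cT : compact [set: cart_power G n].
  have := @tychonoff _ (fun _ : 'I_n => G) (fun _ => setT) (fun _ => let: And3 c _ _ := pfG in c).
  by congr compact; apply/seteqP.
have F : Filter (FT _ (fun N : set G => [set N' | N' `<=` N])).
  by apply: FTF => N N' NN' M MN; exact: subset_trans NN'.
have near1 u : [set: cart_power G n] u ->
    \forall u' \near u & N \near FT _ (fun N : set G => [set N' | N' `<=` N]),
      forall v, box u' N v -> z u' = z v.
  move=> _; have [N [oN NS]] := box_cvg u _ (zc u).
  have [[N1 NM NV] NJ] := oN.2.
  exists (box u N, [set N' | N' `<=` N]); first split=> /=.
  - apply: (@filter_forall _ _ _ _ (nbhs_filter u)) => i.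
    have c : continuous (fun v : cart_power G n => ((u : 'I_n -> G) i)^-1 * (v : 'I_n -> G) i).
      apply: mulg_fun_continuous; first exact: cst_continuous.
      exact: (@proj_continuous _ (fun _ : 'I_n => G) i).
    apply: (c u N); rewrite /= mulVg; apply: open_nbhs_nbhs; split=> //; exact: oN.1.
  - by exists N; split.
  - move=> [u' N'] /= [bu' N'N] v bv; rewrite (NS _ bu') (NS v) // => i.
    have -> : ((u : 'I_n -> G) i)^-1 * (v : 'I_n -> G) i =
        (((u : 'I_n -> G) i)^-1 * (u' : 'I_n -> G) i) *
        (((u' : 'I_n -> G) i)^-1 * (v : 'I_n -> G) i) by rewrite mulgA mulgK.
    by apply: NM => //; apply: N'N.
have [N [oN NP]] := (@compact_near_coveringP _ [set: cart_power G n]).1 cT _ _ _ F near1.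
exists N; split; [exact: oN.1|exact: oN.2|].
by move=> u v; exact: (NP N (@subset_refl _ N) u I v).
Qed.
End Quotients.

(** Continuity for the discrete topology, stated without putting a topology on [A]. *)
Definition locally_constant (T : topologicalType) (A : Type) (s : T -> A) :=
  forall x, \forall y \near x, s y = s x.

Lemma locally_constant_comp (T : topologicalType) (A B : Type) (s : T -> A)
  (h : A -> B) : locally_constant s -> locally_constant (h \o s).
Proof. by move=> sc x; apply: filterS (sc x) => y /= ->. Qed.

Lemma locally_constant_comp2 (T : topologicalType) (A B C : Type) (s : T -> A)
  (s' : T -> B) (h : A -> B -> C) :
  locally_constant s -> locally_constant s' ->
  locally_constant (fun x => h (s x) (s' x)).
Proof. by move=> sc sc' x; apply: filterS2 (sc x) (sc' x) => y -> ->. Qed.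

Lemma locally_constant_precomp (T U : topologicalType) (A : Type) (s : U -> A)
  (h : T -> U) : continuous h -> locally_constant s -> locally_constant (s \o h).
Proof. by move=> hc sc x; exact: (hc x _ (sc (h x))). Qed.

Lemma locally_constant_closed (T : topologicalType) (A : Type) (s : T -> A)
  (P : A -> Prop) : locally_constant s -> closed [set x | P (s x)]%classic.
Proof.
move=> sc x clx; have [y [/= Py]] := clx _ (sc x).
by rewrite /= => <-.
Qed.

(** * Homomorphisms from a free pro-p group to finite p-groups *)

Section Free.
Local Open Scope classical_set_scope.
Local Open Scope group_scope.
Variables (p d : nat) (E : topGroupType) (x : d.-tuple E).
Hypothesis freeE : is_free_pro_p p x.

Lemma free_pro_p_lift (Q : finGroupType) (y : 'I_d -> Q) :
  p.-group [set: Q]%SET ->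
  exists2 h : E -> Q, locally_constant h &
    {morph h : a b / a * b} /\ forall i, h (tnth x i) = y i.
Proof.
move=> pQ.
have [h [[hc hM hx] _]] := freeE.2 _ [tuple (y i : discrete Q) | i < d] (pro_p_discrete pQ).
exists h; first exact/discrete_continuous.
by split=> // i; rewrite hx tnth_mktuple.
Qed.

Lemma free_pro_p_unique (Q : finGroupType) (h h' : E -> Q) :
  p.-group [set: Q]%SET -> locally_constant h -> locally_constant h' ->
  {morph h : a b / a * b} -> {morph h' : a b / a * b} ->
  (forall i, h (tnth x i) = h' (tnth x i)) -> h =1 h'.
Proof.
move=> pQ hc hc' hM hM' hx.
have [k [_ ku]] := freeE.2 _ [tuple (h (tnth x i) : discrete Q) | i < d] (pro_p_discrete pQ).
have e1 : k = h.
  by apply: ku; split=> [||i]; rewrite ?tnth_mktuple //; exact/discrete_continuous.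
have e2 : k = h'.
  by apply: ku; split=> [||i]; rewrite ?tnth_mktuple ?hx //; exact/discrete_continuous.
by move=> e; rewrite -e1 e2.
Qed.

(** Lift the values on the generators to a homomorphism into [H]; by uniqueness its composite with
    the inclusion is [h]. *)
Lemma free_pro_p_gen (Q : finGroupType) (h : E -> Q) (H : {group Q}) :
  p.-group [set: Q]%SET -> locally_constant h -> {morph h : a b / a * b} ->
  (forall i, h (tnth x i) \in H) -> forall e, h e \in H.
Proof.
move=> pQ hc hM hx.
have pH : p.-group [set: subg_of H]%SET.
  rewrite /pgroup cardsT card_sub (eq_card (_ : _ =i H)); last first.
    by move=> z; rewrite inE.
  by apply: pnat_dvd pQ; exact: cardSg (finset.subsetT H).
have [k kc [kM kx]] := free_pro_p_lift (fun i => subg H (h (tnth x i))) pH.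
have -> : h = val \o k :> (E -> Q).
  apply/funext; apply: free_pro_p_unique => //.
  - exact: locally_constant_comp.
  - by move=> a b /=; rewrite kM.
  - by move=> i /=; rewrite kx subgK.
by move=> e /=; exact: valP.
Qed.

Lemma relator_abelian (Q : finGroupType) (h : E -> Q) q : 0 < d ->
  {morph h : a b / a * b} -> (forall a b, commute (h a) (h b)) ->
  forall i : 'I_d, i = 0 :> nat -> h (demushkin_relator q x) = h (tnth x i) ^+ q.
Proof.
move=> d_gt0 hM hC i i0.
have h1 : h 1 = 1 by apply: (mulgI (h 1)); rewrite -hM !mulg1.
have hX e n : h (e ^+ n) = h e ^+ n.
  by elim: n => [|n IHn]; rewrite ?expg0 // !expgS hM IHn.
rewrite /demushkin_relator hM hX (big_morph h hM h1) big1 => [|k _].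
  by rewrite mulg1 (tnth_nth 1) i0.
set a := nth 1 x _; set b := nth 1 x _.
by apply: (mulgI (h (b * a))); rewrite -hM -commgC !hM mulg1; exact: hC.
Qed.

End Free.

(** * Descent of functions along the presentation *)

Section Descent.
Local Open Scope classical_set_scope.
Variables (E G : topGroupType) (f : E -> G) (r : E).
Hypotheses (cE : compact [set: E]) (hG : hausdorff_space G).
Hypotheses (fc : continuous f) (fM : {morph f : a b / (a * b)%g}).
Hypothesis fs : forall g, exists a, f a = g.
Hypothesis fK : (f @^-1` [set 1%g]) = closed_normal_closure r.

Lemma fmorph1 : f 1%g = 1%g.
Proof. by apply: (mulgI (f 1%g)); rewrite -fM !mulg1. Qed.

Lemma fmorphV e : f e^-1%g = (f e)^-1%g.
Proof. by apply: (mulgI (f e)); rewrite -fM !mulgV fmorph1. Qed.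

Lemma f_relator : f r = 1%g.
Proof.
have : closed_normal_closure r r by [].
by rewrite -fK.
Qed.

(** [f] is a closed map, [E] being compact and [G] Hausdorff; so the set where [s'] differs from a
    given value is closed, as the image of a closed set. *)
Lemma factor_locally_constant (A : Type) (s : E -> A) :
  locally_constant s -> (forall e e', f e = f e' -> s e = s e') ->
  exists2 s' : G -> A, locally_constant s' & forall e, s' (f e) = s e.
Proof.
move=> sc sf; have [g fg] := choice fs.
pose s' h := s (g h).
have s'E e : s' (f e) = s e by apply: sf; rewrite fg.
exists s' => // h.
have cl : closed (f @` [set e | s e <> s' h]).
  apply: compact_closed => //; apply: (@continuous_compact _ _ f).
    exact: continuous_subspaceT.
  apply: subclosed_compact cE _ => //.
  exact: (@locally_constant_closed _ _ s (fun a => a <> s' h)).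
have op : open (~` (f @` [set e | s e <> s' h])) by rewrite openC.
have nh : (~` (f @` [set e | s e <> s' h])) h.
  by move=> [e /= se fe]; apply: se; rewrite -s'E fe.
have := open_nbhs_nbhs (conj op nh); apply: filterS => h' /= nh'.
apply: contra_notP nh' => s'h; exists (g h') => //=.
Qed.

Local Open Scope ring_scope.
Variables (A : zmodType) (T : G -> A -> A) (c : G -> G -> A) (s : E -> A).
Hypotheses (sc : locally_constant s) (T0 : forall g, T g 0 = 0).
Hypotheses (T1 : forall e, T 1%g (s e) = s e).
Hypotheses (c1l : forall g, c 1%g g = 0) (c1r : forall g, c g 1%g = 0).
Hypothesis sM : forall e e',
  s (e * e')%g = T (f e') (s e) + s e' - c (f e) (f e').
Hypothesis sr : s r = 0.

(** The elements of the kernel of [f] at which [s] vanishes form a closed normal subgroup containing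
    the relator, hence the whole kernel. Right multiplication by a kernel element adds its value to
    [s], so [s] is constant on the fibres of [f]. *)
Lemma descent : exists2 s' : G -> A, locally_constant s' & s' \o f = s.
Proof.
pose Z : set E := [set e | f e = 1%g /\ s e = 0].
have s1 : s 1%g = 0.
  apply: (addIr (s 1%g)).
  by rewrite add0r -{3}[1%g]mulg1 sM fmorph1 T1 c1l subr0.
have rule e e' : f e = 1%g -> s (e * e')%g = T (f e') (s e) + s e'.
  by move=> fe; rewrite sM fe c1l subr0.
have ruler e e' : f e' = 1%g -> s (e * e')%g = s e + s e'.
  by move=> fe; rewrite sM fe c1r subr0 T1.
have Zcl : closed Z.
  rewrite /Z (_ : [set _ | _] = f @^-1` [set 1%g] `&` [set e | s e = 0]) //.
  apply: closedI; last exact: (@locally_constant_closed _ _ s (fun a => a = 0)).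
  apply: closed_comp => //.
  exact: (@accessible_closed_set1 _ (hausdorff_accessible hG)).
have ZN : normal_subgroup Z.
  split; first split.
  - by split; [exact: fmorph1|].
  - move=> e e' [fe se] [fe' se']; split; first by rewrite fM fe fe' mulg1.
    by rewrite rule // se se' T0 addr0.
  - move=> e [fe se]; have fV : f e^-1%g = 1%g by rewrite fmorphV fe invg1.
    by split=> //; have := ruler e _ fV; rewrite mulgV s1 se add0r.
  - move=> e e' [fe se]; have fJ : f (e ^ e')%g = 1%g.
      by rewrite conjgE !fM fmorphV fe mul1g mulVg.
    split=> //; apply: (addrI (s e')); rewrite -ruler // -conjgC rule //.
    by rewrite se T0 add0r addr0.
have RZ e : f e = 1%g -> s e = 0.
  move=> fe; have : closed_normal_closure r e by rewrite -fK.
  by case/(_ Z Zcl ZN) => //; split=> //; exact: f_relator.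
have [|s' s'c s'E] := factor_locally_constant sc; last by exists s'=> //; exact/funext.
move=> e e' fee'; rewrite -[e'](mulVKg e) ruler; last first.
  by rewrite fM fmorphV fee' mulVg.
by rewrite [s (_ * _)%g]RZ ?addr0 // fM fmorphV fee' mulVg.
Qed.

End Descent.

(** * Extensions and derivations of modules over a finite p-group *)

Section Module.
Local Open Scope ring_scope.
Variables (p : nat) (Q : finGroupType) (B : finZmodType) (T : Q -> B -> B).
Hypotheses (p_pr : prime p) (pQ : (p.-group [set: Q]%SET)%g).
Hypothesis Bp : forall b : B, b *+ p = 0.
Hypothesis TD : forall g, {morph T g : a b / a + b}.
Hypothesis TM : forall g h b, T (g * h)%g b = T h (T g b).
Implicit Types (S : {group B}) (g h : Q) (a b : B).

(** [TM] only makes [T 1] idempotent, and the action on cochains used later is indeed not unital; so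
    modules are subgroups on which [T 1] is the identity. *)
Definition stable S :=
  (forall g b, b \in S -> T g b \in S) /\ (forall b, b \in S -> T 1%g b = b).

Lemma action0 g : T g 0 = 0.
Proof. by apply: (addIr (T g 0)); rewrite -TD !add0r. Qed.

Lemma actionN g b : T g (- b) = - T g b.
Proof. by apply: (addIr (T g b)); rewrite -TD !addNr action0. Qed.

Lemma actionB g a b : T g (a - b) = T g a - T g b.
Proof. by rewrite TD actionN. Qed.

Lemma sub_mem0 S : 0 \in S. Proof. exact: group1. Qed.
Lemma sub_memD S a b : a \in S -> b \in S -> a + b \in S.
Proof. exact: groupM. Qed.
Lemma sub_memN S b : b \in S -> - b \in S.
Proof. by move=> bS; exact: groupVr. Qed.
Lemma sub_memB S a b : a \in S -> b \in S -> a - b \in S.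
Proof. by move=> aS bS; apply: sub_memD => //; exact: sub_memN. Qed.
Lemma sub_memMn S b n : b \in S -> b *+ n \in S.
Proof. by move=> bS; rewrite -zmodXgE groupX. Qed.

Lemma group_set_zmod (P : B -> Prop) : P 0 ->
  (forall a b, P a -> P b -> P (a + b)) ->
  exists H : {group B}, forall b, b \in H <-> P b.
Proof.
move=> P0 PD.
have gP : group_set [set b | `[< P b >]]%SET.
  apply/group_setP; split=> [|a b]; rewrite !finset.in_set; first exact/asboolP.
  by move=> /asboolP Pa /asboolP Pb; apply/asboolP; exact: PD.
by exists (Group gP) => b; rewrite finset.in_set; split=> /asboolP.
Qed.

Lemma zmod_p_group S : (p.-group S)%g.
Proof.
apply: abelem_pgroup; apply/abelemP => //; split; first exact: zmod_abelian.
by move=> b _; rewrite zmodXgE Bp.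
Qed.

Section Extension.
Variables (S : {group B}) (c : Q -> Q -> B).
Hypothesis stS : stable S.
Hypothesis cS : forall g h, c g h \in S.
Hypothesis c1l : forall g, c 1%g g = 0.
Hypothesis cE : forall g h k,
  c h k - c (g * h)%g k + c g (h * k)%g = T k (c g h).

(** [P] is the set of pairs with product [(g, a)(h, b) = (gh, T h a + b - c g h)]. Associativity is
    the cocycle identity [cE], and [c1l] makes [(1, 0)] the unit. The coordinates [u], [v] and the
    pairing [mk] are all that is exported of it. *)
Lemma extension_exists :
  exists (P : finGroupType) (u : P -> Q) (v : P -> B) (mk : Q -> B -> P),
  [/\ (p.-group [set: P]%SET)%g, {morph u : x y / (x * y)%g},
    forall x, v x \in S,
    forall x y, v (x * y)%g = T (u y) (v x) + v y - c (u x) (u y) &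
    (forall g b, b \in S -> u (mk g b) = g /\ v (mk g b) = b) /\
    forall x y, u x = u y -> v x = v y -> x = y].
Proof.
pose P0 := {x : Q * B | x.2 \in S}.
pose mul0 (x y : P0) :=
  ((val x).1 * (val y).1,
   T (val y).1 (val x).2 + (val y).2 - c (val x).1 (val y).1)%g.
have mulS x y : (mul0 x y).2 \in S.
  apply: sub_memB => //; apply: sub_memD; last exact: (valP y).
  by apply: stS.1; exact: (valP x).
pose mul (x y : P0) : P0 := exist _ (mul0 x y) (mulS x y).
pose one : P0 := exist (fun x : Q * B => x.2 \in S) (1%g, 0) (sub_mem0 S).
pose inv0 (x : P0) :=
  ((val x).1^-1%g,
   T (val x).1^-1%g (c (val x).1^-1%g (val x).1 - (val x).2)).
have invS x : (inv0 x).2 \in S.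
  by apply: stS.1; apply: sub_memB => //; exact: (valP x).
pose inv (x : P0) : P0 := exist _ (inv0 x) (invS x).
have mulA : associative mul.
  move=> [[g a] aS] [[h b] bS] [[k e] eS]; apply: val_inj; congr pair => /=.
    exact: mulgA.
  rewrite actionB TD TM -cE !opprD opprK !addrA.
  by rewrite [RHS](ACl (1*2*6*3*5*(4*7))) /= addrN addr0.
have mul1 : left_id one mul.
  move=> [[g a] aS]; apply: val_inj; congr pair => /=; first exact: mul1g.
  by rewrite action0 c1l add0r subr0.
have mulV : left_inverse one inv mul.
  move=> [[g a] aS]; apply: val_inj; congr pair => /=; first exact: mulVg.
  rewrite -TM mulVg stS.2 ?subrK ?subrr //.
  exact: sub_memB.
pose P : finGroupType := HB.pack P0 (Finite_isGroup.Build P0 mulA mul1 mulV).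
pose u (x : P) : Q := (val (x : P0)).1.
pose v (x : P) : B := (val (x : P0)).2.
pose mk g b : P := insubd one (g, b).
exists P, u, v, mk; split=> //.
- rewrite /pgroup cardsT card_sub.
  rewrite (eq_card (_ : _ =i finset.setX [set: Q]%SET S)); last first.
    by move=> [g b]; rewrite !inE.
  rewrite cardsX pnatM; apply/andP; split=> //.
  exact: zmod_p_group.
- by move=> x; exact: (valP (x : P0)).
- split=> [g b bS|x y uxy vxy]; first by rewrite /u /v /mk val_insubd bS.
  by apply: val_inj; rewrite [LHS]surjective_pairing [RHS]surjective_pairing; congr pair.
Qed.

End Extension.

(** The submodule [I S], for [I] the augmentation ideal of the group ring of [Q]. *)
Definition aug S : {group B} :=
  generated_group [set T g b - b | g in Q, b in S]%SET.

Lemma aug_mem S g b : b \in S -> T g b - b \in aug S.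
Proof. by move=> bS; apply: mem_gen; apply/imset2P; exists g b. Qed.

Lemma aug_ind S (P : B -> Prop) : P 0 ->
  (forall a b, P a -> P b -> P (a + b)) ->
  (forall g b, b \in S -> P (T g b - b)) -> forall b, b \in aug S -> P b.
Proof.
move=> P0 PD Pg b; have [H HP] := group_set_zmod P0 PD.
suff /fintype.subsetP sH : aug S \subset H by move=> /sH /HP.
by rewrite gen_subG; apply/fintype.subsetP => _ /imset2P[g a _ aS ->]; apply/HP/Pg.
Qed.

Lemma sub_aug S : stable S -> forall b, b \in aug S -> b \in S.
Proof.
move=> stS; apply: aug_ind => [|a b|g b bS]; first exact: sub_mem0.
  exact: sub_memD.
by apply: sub_memB => //; exact: stS.1.
Qed.

Lemma aug_stable S : stable S -> stable (aug S).
Proof.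
move=> stS; split=> [h b|b /(sub_aug stS)]; last exact: stS.2.
move: b; apply: aug_ind => [|a b|g b bS].
- by rewrite action0; exact: sub_mem0.
- by rewrite TD; exact: sub_memD.
- rewrite actionB -TM (conjgC g h) TM; apply: aug_mem; exact: stS.1.
Qed.

(* [S] is a normal subgroup of the semidirect product [P] of [Q] and [S], and
   [[S, P]] contains [aug S]; it is smaller than [S] since [P] is nilpotent. *)
Lemma aug_proper S : stable S -> S :!=: 1%g -> (aug S \proper S)%g.
Proof.
move=> stS S1.
have [P [u [v [mk [pP uM vS vM [mkE uvI]]]]]] :=
  @extension_exists S (fun _ _ => 0) stS (fun _ _ => sub_mem0 S)
    (fun=> erefl)
    (fun g h k => etrans (congr1 (+%R^~ 0) (subrr 0)) (etrans (addr0 0) (esym (action0 k)))).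
have u_mk g b : b \in S -> u (mk g b) = g by move=> /(mkE g)[].
have v_mk g b : b \in S -> v (mk g b) = b by move=> /(mkE g)[].
have u1 : u 1%g = 1%g by apply: (mulgI (u 1%g)); rewrite -uM !mulg1.
have vM1 x y : u x = 1%g -> u y = 1%g -> v (x * y)%g = v x + v y.
  by move=> ux uy; rewrite vM uy subr0 stS.2.
have v1 : v 1%g = 0 by apply: (addIr (v 1%g)); rewrite -vM1 // mulg1 add0r.
have gH : group_set [set x | u x == 1%g]%SET.
  apply/group_setP; split=> [|x y]; rewrite !finset.in_set ?u1 //.
  by move=> /eqP ux /eqP uy; rewrite uM ux uy mulg1.
pose H := Group gH.
have HE x : (x \in H) = (u x == 1%g) by rewrite finset.in_set.
have H1 : H :!=: 1%g.
  apply: contra_neq S1 => H1; apply/trivgP/fintype.subsetP => b bS.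
  have : mk 1%g b \in H by rewrite HE u_mk.
  by rewrite H1 => /set1P e; rewrite -(v_mk 1%g b bS) e v1; exact: group1.
have PH : ([set: P]%SET \subset 'N_([set: P]%SET)(H))%g.
  rewrite finset.subsetI finset.subsetT; apply/fintype.subsetP => y _.
  rewrite inE; apply/fintype.subsetP => _ /imsetP[x xH ->].
  have uV : u y^-1%g = (u y)^-1%g.
    by apply: (mulgI (u y)); rewrite -uM !mulgV.
  by move: xH; rewrite !HE conjgE !uM uV => /eqP->; rewrite mul1g mulVg.
have /properP[sHP [x xH xHP]] :=
  nil_comm_properl (pgroup_nil pP) (finset.subsetT H) H1 PH.
apply/properP; split; first by apply/fintype.subsetP => b; exact: sub_aug.
exists (v x) => //; apply: contraNN xHP => vx.
have ux : u x = 1%g by apply/eqP; rewrite -HE.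
suff Hmk b : b \in aug S -> b \in S /\ mk 1%g b \in [~: H, [set: P]%SET]%g.
  have [vxS m] := Hmk _ vx; suff -> : x = mk 1%g (v x) by [].
  by apply: uvI; rewrite ?u_mk ?v_mk.
move: b; apply: aug_ind => [|a b [aS ma] [bS mb]|g b bS].
- split; first exact: sub_mem0.
  suff -> : mk 1%g 0 = 1%g by exact: group1.
  by apply: uvI; rewrite ?u_mk ?v_mk //; exact: sub_mem0.
- have abS : a + b \in S by exact: sub_memD.
  split=> //; suff -> : mk 1%g (a + b) = (mk 1%g a * mk 1%g b)%g by exact: groupM.
  by apply: uvI; rewrite ?uM ?vM1 ?u_mk ?v_mk // mulg1.
- have TbS : T g b - b \in S by apply: sub_memB => //; exact: stS.1.
  split=> //; suff -> : mk 1%g (T g b - b) = [~ mk 1%g b, mk g 0]%g.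
    by rewrite mem_commg ?inE // u_mk.
  apply: (mulgI (mk g 0 * mk 1%g b)%g); rewrite -commgC.
  have S0 := sub_mem0 S.
  apply: uvI; rewrite !(uM, vM, subr0) !u_mk ?v_mk ?mul1g ?mulg1 //.
  by rewrite !action0 add0r stS.2 // addrCA subrr.
Qed.

(** * Primitives and derivations on the free group *)

Section Derivations.
Local Open Scope ring_scope.
Variables (d : nat) (E : topGroupType) (x : d.-tuple E) (theta : E -> Q).
Hypothesis freeE : is_free_pro_p p x.
Hypothesis theta_c : locally_constant theta.
Hypothesis thetaM : {morph theta : a b / (a * b)%g}.
Hypothesis theta_s : forall g, exists e, theta e = g.

(** The cocycle splits on [E] because [E] is free: [theta] lifts to a homomorphism into the
    extension defined by [c], and [s] is the module coordinate of this lift. *)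
Lemma cochain_lift S (c : Q -> Q -> B) (n : 'I_d -> B) :
  stable S -> (forall g h, c g h \in S) -> (forall g, c 1%g g = 0) ->
  (forall g h k, c h k - c (g * h)%g k + c g (h * k)%g = T k (c g h)) ->
  (forall i, n i \in S) ->
  exists s : E -> B, [/\ locally_constant s, forall e, s e \in S,
    forall e e', s (e * e')%g =
      T (theta e') (s e) + s e' - c (theta e) (theta e') &
    forall i, s (tnth x i) = n i].
Proof.
move=> stS cS c1l cE nS.
have [P [u [v [mk [pP uM vS vM [mkE uvI]]]]]] := extension_exists stS cS c1l cE.
have [h hc [hM hx]] :=
  free_pro_p_lift freeE (fun i => mk (theta (tnth x i)) (n i)) pP.
have uh : u \o h =1 theta.
  apply: (free_pro_p_unique freeE) => //; first exact: locally_constant_comp.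
    by move=> a b /=; rewrite hM uM.
  by move=> i /=; rewrite hx (mkE _ _ (nS i)).1.
exists (v \o h); split=> [|e|e e'|i] /=.
- exact: locally_constant_comp.
- exact: vS.
- by rewrite hM vM -!uh.
- by rewrite hx (mkE _ _ (nS i)).2.
Qed.

Definition derivation S (D : E -> B) :=
  [/\ locally_constant D, forall e, D e \in S &
    forall e e', D (e * e')%g = T (theta e') (D e) + D e'].

Lemma derivation_lift S (n : 'I_d -> B) : stable S -> (forall i, n i \in S) ->
  exists2 D, derivation S D & forall i, D (tnth x i) = n i.
Proof.
move=> stS nS.
have [D [Dc DS DM Dx]] := @cochain_lift S (fun _ _ => 0) n stS
  (fun _ _ => sub_mem0 S) (fun=> erefl)
  (fun g h k => etrans (congr1 (+%R^~ 0) (subrr 0))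
    (etrans (addr0 0) (esym (action0 k)))) nS.
by exists D => //; split=> // e e'; rewrite DM subr0.
Qed.

Section Congruence.
Variables (S : {group B}) (D : E -> B).
Hypotheses (stS : stable S) (dD : derivation S D).
Let L2 := aug (aug S).

Lemma augaug g h b : b \in S -> T h (T g b - b) - (T g b - b) \in L2.
Proof. by move=> bS; apply: aug_mem; exact: aug_mem. Qed.

Lemma derivation1 : D 1%g = 0.
Proof.
have [_ DS DM] := dD; apply: (addIr (D 1%g)).
have th1 : theta 1%g = 1%g by apply: (mulgI (theta 1%g)); rewrite -thetaM !mulg1.
by rewrite -{2}(stS.2 (D 1%g) (DS _)) -{1}th1 addrC -DM mulg1 add0r.
Qed.

Lemma aug2_stable b g : b \in L2 -> T g b \in L2.
Proof. exact: (aug_stable (aug_stable stS)).1. Qed.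

(** In the group ring, [gh - hg = (g - 1)(h - 1) - (h - 1)(g - 1)]. Writing [b] as the translate of
    some [m] by [e' e] turns the action of the commutator into such a difference. *)
Lemma commutator_aug2 e e' b : b \in S ->
  T (theta [~ e, e']%g) b - b \in L2.
Proof.
move=> bS; have [m mS bE] : exists2 m, m \in S & b = T (theta (e' * e)%g) m.
  exists (T (theta (e' * e)%g)^-1%g b); first exact: stS.1.
  by rewrite -TM mulVg stS.2.
rewrite {1}bE -TM -thetaM -commgC bE !thetaM !TM.
set g := theta e; set h := theta e'.
have -> : T h (T g m) - T g (T h m) =
   (T h (T g m - m) - (T g m - m)) - (T g (T h m - m) - (T h m - m)).
  rewrite !actionB !(opprD, opprK) !addrA.
  by rewrite [RHS](ACl (1*5*(2*7)*(4*8)*(3*6))) /= !(addNr, addrN) !addr0.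
by apply: sub_memB; exact: augaug.
Qed.

(** Expand both sides of [D (e e') = D (e' e [e, e'])]; the commutator acts trivially modulo
    [L2]. *)
Lemma derivation_commutator e e' :
  D [~ e, e']%g - ((T (theta e') (D e) - D e) - (T (theta e) (D e') - D e'))
    \in L2.
Proof.
have [_ DS DM] := dD; set w := [~ e, e']%g.
have : T (theta w) (T (theta e) (D e') + D e) + D w =
       T (theta e') (D e) + D e' by rewrite -!DM -commgC.
set b := (_ + D e) => eqD.
have bS : b \in S by apply: sub_memD => //; exact: stS.1.
have -> : D w = T (theta e') (D e) + D e' - T (theta w) b.
  by rewrite -eqD [RHS]addrC addKr.
have -> : T (theta e') (D e) + D e' - T (theta w) b -
    (T (theta e') (D e) - D e - (T (theta e) (D e') - D e')) =
    - (T (theta w) b - b).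
  rewrite !(opprD, opprK) /b !addrA.
  by rewrite [LHS](ACl (3*6*5*(1*4)*(2*7))) /= !(addNr, addrN) !addr0.
by apply: sub_memN; exact: commutator_aug2.
Qed.

Lemma derivation_expg e n :
  D (e ^+ n)%g - (D e *+ n + (T (theta e) (D e) - D e) *+ 'C(n, 2)) \in L2.
Proof.
have [_ DS DM] := dD; set z := _ - D e.
elim: n => [|n IHn].
  by rewrite expg0 derivation1 mulr0n bin0n mulr0n addr0 subr0; exact: sub_mem0.
have zL : z \in aug S by exact: aug_mem.
set w := D (e ^+ n)%g in IHn *; pose m := D e *+ n + z *+ 'C(n, 2).
have [y yL wE] : exists2 y, y \in L2 & w = y + m.
  by exists (w - m) => //; rewrite subrK.
have TMn k b : T (theta e) (b *+ k) - b *+ k = (T (theta e) b - b) *+ k.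
  elim: k => [|k IHk]; first by rewrite !mulr0n action0 subr0.
  by rewrite !mulrS TD -IHk opprD addrACA.
have TE b k : T (theta e) (b *+ k) = (T (theta e) b - b) *+ k + b *+ k.
  by rewrite -TMn subrK.
have Tz : T (theta e) (D e) - D e = z by [].
clearbody z.
have -> : D (e ^+ n.+1)%g - (D e *+ n.+1 + z *+ 'C(n.+1, 2)) =
   T (theta e) y + (T (theta e) z - z) *+ 'C(n, 2).
  rewrite expgSr DM -/w wE TD /m TD.
  rewrite !TE Tz binS bin1 mulrnDr mulrSr !opprD !addrA.
  by rewrite [LHS](ACl (1*4*(2*10)*(3*7)*(5*9)*(6*8))) /= !addrN !addr0.
apply: sub_memD; first exact: aug2_stable.
by apply: sub_memMn; exact: aug_mem.
Qed.

(** The second half, triviality of the action modulo [L2], is what makes the values of [D] on the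
    factors add up. *)
Lemma derivation_prod_commutators (I : Type) (s : seq I) (a b : I -> E) :
  D (\prod_(i <- s) [~ a i, b i])%g - \sum_(i <- s)
    ((T (theta (b i)) (D (a i)) - D (a i)) -
     (T (theta (a i)) (D (b i)) - D (b i))) \in L2 /\
  forall m, m \in S -> T (theta (\prod_(i <- s) [~ a i, b i])%g) m - m \in L2.
Proof.
have [_ DS DM] := dD.
elim: s => [|i s [IH1 IH2]].
  rewrite !big_nil derivation1 subr0; split=> [|m mS]; first exact: sub_mem0.
  have -> : theta 1%g = 1%g by apply: (mulgI (theta 1%g)); rewrite -thetaM !mulg1.
  by rewrite stS.2 // subrr; exact: sub_mem0.
rewrite !big_cons; set W := (\prod_(j <- s) _)%g in IH1 IH2 *.
set U := \sum_(j <- s) _ in IH1 *.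
split=> [|m mS]; last first.
  set m' := T (theta [~ a i, b i]%g) m; have m'S : m' \in S by exact: stS.1.
  rewrite thetaM TM -/m' -(subrK m' (T _ m')) -addrA.
  by apply: sub_memD; [exact: IH2|exact: commutator_aug2].
rewrite DM.
have c1 := derivation_commutator (a i) (b i).
set Dw := D [~ a i, b i]%g in c1 *; set u := (_ - _ - _) in c1 *.
have -> : T (theta W) Dw + D W - (u + U) =
    (T (theta W) Dw - Dw) + ((Dw - u) + (D W - U)).
  by rewrite [in RHS]addrA subrKA opprD addrACA.
apply: sub_memD; first by apply: IH2; exact: DS.
exact: sub_memD.
Qed.

(** The factor [x_0 ^ q] contributes nothing: [p] divides [q] and, being odd, also ['C(q, 2)]. *)
Lemma derivation_relator q : odd p -> (p %| q)%N ->
  D (demushkin_relator q x) - \sum_(i < d./2)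
    ((T (theta (nth 1%g x i.*2.+1)) (D (nth 1%g x i.*2)) - D (nth 1%g x i.*2)) -
     (T (theta (nth 1%g x i.*2)) (D (nth 1%g x i.*2.+1)) - D (nth 1%g x i.*2.+1)))
    \in L2.
Proof.
move=> p_odd pq; have [_ DS DM] := dD; rewrite /demushkin_relator DM.
have pMn b k : (p %| k)%N -> b *+ k = 0.
  by move=> /dvdnP[l ->]; rewrite mulnC mulrnA Bp mul0rn.
have pq2 : (p %| 'C(q, 2))%N.
  rewrite -(@Gauss_dvdr p 2); last by rewrite coprimen2.
  by rewrite -mul_bin_diag bin1 dvdn_mulr.
have := derivation_expg (nth 1%g x 0) q.
rewrite (pMn _ _ pq) (pMn _ _ pq2) addr0 subr0 => qL.
have [c1 c2] := derivation_prod_commutators (index_enum 'I_d./2)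
  (fun i => nth 1%g x i.*2) (fun i => nth 1%g x i.*2.+1).
rewrite -addrA; apply: sub_memD => //.
rewrite -(subrK (D (nth 1%g x 0 ^+ q)%g) (T _ _)); apply: sub_memD => //.
by apply: c2; exact: DS.
Qed.

End Congruence.
(* Nakayama's lemma: the values at the relator of the derivations into [S]
   generate [aug S] modulo [aug (aug S)]. *)
Lemma aug_derivation q S : odd p -> (p %| q)%N -> ~~ odd d -> stable S ->
  forall b, b \in aug S ->
  exists2 D, derivation S D & D (demushkin_relator q x) = b.
Proof.
move=> p_odd pq d_even.
have [w] := ubnP #|S|; elim: w S => // w IHw S leSw stS.
pose N b := exists2 D, derivation S D & D (demushkin_relator q x) = b.
have N0 : N 0.
  exists (fun=> 0) => //; split=> [e|e|e e']; last by rewrite action0 addr0.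
    by near=> e'.
  exact: sub_mem0.
have ND a b : N a -> N b -> N (a + b).
  move=> [D [Dc DS DM] <-] [D' [Dc' DS' DM'] <-]; exists (fun e => D e + D' e) => //.
  split=> [|e|e e']; first exact: locally_constant_comp2.
    exact: sub_memD.
  by rewrite DM DM' TD addrACA.
have NN b : N b -> N (- b).
  move=> [D [Dc DS DM] <-]; exists (fun e => - D e) => //.
  split=> [|e|e e']; first exact: (locally_constant_comp -%R Dc).
    exact: sub_memN.
  by rewrite DM actionN opprD.
have [S1|S1] := eqVneq (S : {set B}) 1%g.
  by move=> b /(sub_aug stS); rewrite S1 => /set1P ->.
have L2N b : b \in aug (aug S) -> N b.
  move=> bL; have [||D [Dc DS DM] Dr] := IHw (aug S) _ _ b bL.
  - exact: leq_trans (proper_card (aug_proper stS S1)) _.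
  - exact: aug_stable.
  - by exists D => //; split=> // e; exact: sub_aug.
(* The [g] with [(g - 1) S] inside [N] form a subgroup [H]. It is enough that [H] contains the
   images of the generators, for then it is all of [Q]. *)
have [H HP] : exists H : {group Q}, forall g,
    g \in H <-> forall m, m \in S -> N (T g m - m).
  have gH : group_set [set g | `[< forall m, m \in S -> N (T g m - m) >]]%SET.
    apply/group_setP; split=> [|g h]; rewrite !finset.in_set.
      by apply/asboolP => m mS; rewrite stS.2 // subrr.
    move=> /asboolP Ng /asboolP Nh; apply/asboolP => m mS.
    rewrite TM -(subrK (T g m) (T h _)) -addrA; apply: ND; last exact: Ng.
    by apply: Nh; exact: stS.1.
  by exists (Group gH) => g; rewrite finset.in_set; split=> /asboolP.
have Hx i : theta (tnth x i) \in H.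
  apply/HP => m mS.
  (* [i'] indexes the other member of the pair of [x_i]. A derivation equal to [m] at that generator
     and to 0 at the others takes at the relator the value [(x_i - 1) m], up to sign and modulo
     [aug (aug S)]. *)
  pose i' := if odd i then i.-1 else i.+1; pose k := i./2.
  have := odd_double_half i; have := odd_double_half d; rewrite (negPf d_even).
  move=> dE iE; have id := ltn_ord i.
  have k_lt : (k < d./2)%N by rewrite /k; lia.
  pose n j := if j == i' then m else 0.
  have nS j : n j \in S by rewrite /n; case: ifP => // _; exact: sub_mem0.
  have [D dD Dx] := derivation_lift stS (fun j : 'I_d => nS j).
  have Dn j : (j < d)%N -> D (nth 1%g x j) = n j.
    by move=> jd; rewrite -(Dx (Ordinal jd)) (tnth_nth 1%g).
  have := derivation_relator stS dD p_odd pq.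
  rewrite (bigD1 (Ordinal k_lt)) //= big1 ?addr0 => [|j jk]; last first.
    have jd := ltn_ord j.
    have jk' : (j : nat) != k by apply: contraNneq jk => jk; apply/eqP/val_inj.
    rewrite !Dn; try lia.
    have -> : n j.*2 = 0.
      by rewrite /n /i' ifF //; apply/eqP; case: ifP; rewrite /k in jk'; lia.
    have -> : n j.*2.+1 = 0.
      by rewrite /n /i' ifF //; apply/eqP; case: ifP; rewrite /k in jk'; lia.
    by rewrite !action0 !subrr.
  rewrite !Dn; try by rewrite /k; lia.
  set r := demushkin_relator q x => Dr.
  have Nr : N (D r) by exists D.
  have [i_odd|i_even] := boolP (odd i).
    have e1 : n k.*2 = m by rewrite /n /i' i_odd ifT //; apply/eqP; rewrite /k; lia.
    have e2 : n k.*2.+1 = 0 by rewrite /n /i' i_odd ifF //; apply/eqP; rewrite /k; lia.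
    have e3 : nth 1%g x k.*2.+1 = tnth x i.
      by rewrite (tnth_nth 1%g); congr nth; rewrite /k; lia.
    move: Dr; rewrite e1 e2 e3 action0 subr0 subr0 => /L2N/NN/ND/(_ Nr).
    by rewrite opprB subrK.
  have e1 : n k.*2 = 0 by rewrite /n /i' (negPf i_even) ifF //; apply/eqP; rewrite /k; lia.
  have e2 : n k.*2.+1 = m by rewrite /n /i' (negPf i_even) ifT //; apply/eqP; rewrite /k; lia.
  have e3 : nth 1%g x k.*2 = tnth x i.
    by rewrite (tnth_nth 1%g); congr nth; rewrite /k; lia.
  move: Dr; rewrite e1 e2 e3 action0 subr0 sub0r opprK => /L2N/ND/(_ (NN _ Nr)).
  by rewrite addrC addKr.
have HT g : g \in H.
  by have [e <-] := theta_s g; exact: (free_pro_p_gen freeE).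
by apply: aug_ind => // g b bS; apply: (HP g).1.
Unshelve. all: by end_near.
Qed.

End Derivations.
End Module.

(** * Vanishing of inflated 2-cocycles *)

Section Vanishing.
Local Open Scope ring_scope.
Variables (p : nat) (Q : finGroupType) (B : finZmodType) (T : Q -> B -> B).
Hypotheses (p_pr : prime p) (pQ : (p.-group [set: Q]%SET)%g).
Hypothesis Bp : forall b : B, b *+ p = 0.
Hypothesis TD : forall g, {morph T g : a b / a + b}.
Hypothesis TM : forall g h b, T (g * h)%g b = T h (T g b).

Variables (d q : nat) (E G : topGroupType) (x : d.-tuple E) (f : E -> G).
Hypotheses (p_odd : odd p) (pq : (p %| q)%N) (d_even : ~~ odd d).
Hypotheses (freeE : is_free_pro_p p x) (hG : hausdorff_space G).
Hypotheses (fc : continuous f) (fM : {morph f : a b / (a * b)%g}).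
Hypothesis fs : forall g, exists a, f a = g.
Hypothesis fK :
  (f @^-1` [set 1%g])%classic = closed_normal_closure (demushkin_relator q x).
Variable pi : G -> Q.
Hypotheses (pi_c : locally_constant pi) (piM : {morph pi : a b / (a * b)%g}).
Hypothesis pi_s : forall g, exists a, pi a = g.

Lemma normalized_cocycle_vanish (S : {group B}) (c : Q -> Q -> B) :
  stable T S -> (forall g h, c g h \in aug T S) ->
  (forall g, c 1%g g = 0) -> (forall g, c g 1%g = 0) ->
  (forall g h k, c h k - c (g * h)%g k + c g (h * k)%g = T k (c g h)) ->
  exists2 s : G -> B, locally_constant s & forall g h,
    s (g * h)%g = T (pi h) (s g) + s h - c (pi g) (pi h).
Proof.
move=> stS cS c1l c1r cE; pose theta := pi \o f.
have theta_c : locally_constant theta by exact: locally_constant_precomp.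
have thetaM : {morph theta : a b / (a * b)%g} by move=> a b; rewrite /theta /= fM piM.
have theta_s g : exists e, theta e = g.
  by have [h <-] := pi_s g; have [e <-] := fs h; exists e.
have stA := aug_stable TD TM stS.
(* Lifting into [aug S] rather than [S] forces the value of [s] at the relator into [aug S], where
   some derivation into [S] attains it. *)
have [s [sc sS sM _]] := @cochain_lift p Q B T p_pr pQ Bp TD TM d E x theta freeE
  theta_c thetaM (aug T S) c (fun=> 0) stA cS c1l cE (fun=> sub_mem0 _).
have [D [Dc DS DM] Dr] := @aug_derivation p Q B T p_pr pQ Bp TD TM d E x theta freeE
  theta_c thetaM theta_s q S p_odd pq d_even stS _ (sS (demushkin_relator q x)).
pose s1 e := s e - D e.
have s1c : locally_constant s1 by exact: (@locally_constant_comp2 _ _ _ _ s D (fun a b => a - b)).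
have T0 g : T (pi g) 0 = 0 by exact: action0 TD _.
have pi1 : pi 1%g = 1%g by apply: (mulgI (pi 1%g)); rewrite -piM !mulg1.
have T1 e : T (pi 1%g) (s1 e) = s1 e.
  rewrite pi1 stS.2 //; apply: sub_memB => //; exact: sub_aug (sS e).
have s1M e e' : s1 (e * e')%g = T (pi (f e')) (s1 e) + s1 e' - c (pi (f e)) (pi (f e')).
  rewrite /s1 sM DM (actionB TD) opprD !addrA.
  by rewrite [LHS](ACl (1*4*2*5*3)).
have s1r : s1 (demushkin_relator q x) = 0 by rewrite /s1 Dr subrr.
have c1l' g : c (pi 1%g) (pi g) = 0 by rewrite pi1.
have c1r' g : c (pi g) (pi 1%g) = 0 by rewrite pi1.
have cE' : compact [set: E] by case: freeE.1.1.
have [s' s'c s'E] := @descent E G f _ cE' hG fc fM fs fK B (fun g => T (pi g))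
  (fun g h => c (pi g) (pi h)) s1 s1c T0 T1 c1l' c1r' s1M s1r.
exists s' => // g h; have [e <-] := fs g; have [e' <-] := fs h.
by rewrite -fM -![s' (f _)]/((s' \o f) _) s'E.
Qed.

(** Normalization: adding the coboundary of [s0] turns [c] into [c2], which vanishes if an argument
    is 1 and takes values where [T 1] is the identity. Twice [w] is subtracted because
    [T h (c g 1) = c 1 h = T h w], which gives [T h (s0 g) = - T h w]. *)
Lemma cocycle_vanish (S : {group B}) (c : Q -> Q -> B) :
  stable T S ->
  (forall g h k, c h k - c (g * h)%g k + c g (h * k)%g = T k (c g h)) ->
  (forall g h, T 1%g (c g h) - T h (c 1%g 1%g) \in aug T S) ->
  exists2 s : G -> B, locally_constant s & forall g h,
    s (g * h)%g = T (pi h) (s g) + s h - c (pi g) (pi h).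
Proof.
move=> stS cE cA; pose w := c 1%g 1%g; pose s0 g := c g 1%g - w *+ 2.
pose c2 g h := T 1%g (c g h) - T h w.
have TB := actionB TD.
have cg1 g h : T h (c g 1%g) = c 1%g h.
  have := cE g 1%g h; by rewrite mulg1 mul1g subrK.
have c1h h : c 1%g h = T h w by rewrite -(cg1 1%g).
have T1w : T 1%g w = w by rewrite -c1h.
have c2E g h : c2 g h = c g h + (s0 h - s0 (g * h)%g + T h (s0 g)).
  rewrite /c2 -cE mulg1 /s0 TB cg1 c1h mulr2n TD !(opprD, opprK) !addrA.
  by rewrite [RHS](ACl (2*5*1*9*(3*6)*(4*7)*(8*10))) /= !(addNr, addrN) !addr0.
have c2l h : c2 1%g h = 0 by rewrite /c2 c1h -TM mulg1 subrr.
have c2r g : c2 g 1%g = 0 by rewrite /c2 cg1 c1h T1w subrr.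
have c2S g h : c2 g h \in aug T S by exact: cA.
clearbody c2 s0.
have c2C g h k : c2 h k - c2 (g * h)%g k + c2 g (h * k)%g = T k (c2 g h).
  rewrite !c2E mulgA !(TD, TB) -cE -TM (actionN TD) !(opprD, opprK) !addrA.
  by rewrite [LHS](ACl (1*5*9*4*8*12*(2*6)*(3*10)*(7*11))) /= !(addNr, addrN) !addr0.
have [s' s'c s'M] := @normalized_cocycle_vanish S c2 stS c2S c2l c2r c2C.
exists (fun g => s' g - s0 (pi g)).
  apply: (@locally_constant_comp2 _ _ _ _ s' (s0 \o pi) (fun a b => a - b)) => //.
  exact: (locally_constant_comp s0 pi_c).
move=> g h; rewrite s'M c2E piM TB !(opprD, opprK) !addrA.
by rewrite [LHS](ACl (1*6*2*4*3*(5*7))) /= addrN addr0.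
Qed.

End Vanishing.

(** * Inhomogeneous cochains as modules *)

Local Notation cutn m h := (@cut _ m h).

Section Faces.
Local Open Scope ring_scope.
Variables (p : nat) (H : topGroupType).
Implicit Types (g : H) (h u : nat -> H) (m : nat).

Definition prepend g h (n : nat) : H := if n is n'.+1 then h n' else g.

(** The coboundary read on infinite sequences, so that an argument can be added or removed in front
    without a change of type. *)
Definition delta m (b : cart_power H m -> 'F_p) h : 'F_p :=
  \sum_(i < m.+2) (-1) ^+ i * b (cutn m (face i h)).

Lemma eq_delta m (b : cart_power H m -> 'F_p) h h' :
  (forall k, (k < m.+1)%N -> h k = h' k) -> delta b h = delta b h'.
Proof.
move=> hh'; apply: eq_bigr => i _; congr (_ * b _); exact: eq_face.
Qed.

Lemma coboundE_delta m n (b : cart_power H m -> 'F_p) (u : cart_power H n) :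
  cobound b u = delta b (entry u).
Proof. exact: coboundE. Qed.

Lemma delta_cobound m (b : cart_power H m -> 'F_p) h :
  delta (cobound b : cart_power H m.+1 -> 'F_p) h = 0.
Proof.
rewrite -(cobound_cobound b (cutn m.+2 h)) coboundE_delta.
by apply: eq_delta => k km; rewrite entry_cut.
Qed.

Lemma cobound_cut m (b : cart_power H m -> 'F_p) h :
  cobound b (cutn m.+1 h) = delta b h.
Proof. by rewrite coboundE_delta; apply: eq_delta => k km; rewrite entry_cut. Qed.

Lemma face_prepend i g u n : face i.+2 (prepend g u) n = prepend g (face i.+1 u) n.
Proof. by case: n => [|n] //=. Qed.

Lemma prepend_cut (A : Type) m (y : cart_power H m.+1 -> A) g h :
  y (cutn m.+1 (prepend g (entry (cutn m h)))) = y (cutn m.+1 (prepend g h)).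
Proof. by congr y; apply: eq_cut => -[|n] //= nm; rewrite entry_cut. Qed.

(** Peels off the first argument. The third term compensates the face 0 of [y (g, -)]. Applied
    twice, this turns the cocycle identity in degree [j + 3] into that of a 2-cocycle with values in
    functions. *)
Lemma delta_prepend m (y : cart_power H m.+1 -> 'F_p) g u :
  delta y (prepend g u) = y (cutn m.+1 u)
  - y (cutn m.+1 (prepend (g * u 0)%g (fun n => u n.+1)))
  + y (cutn m.+1 (prepend g (fun n => u n.+1)))
  - delta (fun k : cart_power H m => y (cutn m.+1 (prepend g (entry k)))) u.
Proof.
rewrite /delta big_ord_recl [in RHS]big_ord_recl big_ord_recl.
have -> : cutn m.+1 (face (lift ord0 (ord0 : 'I_m.+2)) (prepend g u)) =
    cutn m.+1 (prepend (g * u 0)%g (fun n => u n.+1)).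
  by apply: eq_cut => -[].
have -> : cutn m.+1 (prepend g (entry (cutn m (face (ord0 : 'I_m.+2) u)))) =
    cutn m.+1 (prepend g (fun n => u n.+1)).
  by apply: eq_cut => -[|n] //= nm; rewrite entry_cut.
rewrite (eq_bigr (fun i : 'I_m.+1 => - ((-1) ^+ lift ord0 i *
  y (cutn m.+1 (prepend g (entry (cutn m (face (lift ord0 i) u)))))))).
  by rewrite sumrN /= !expr0 expr1; ring.
move=> i _; rewrite !lift0 exprS mulN1r mulNr; congr (- (_ * y _)).
apply: eq_cut => n nm; rewrite face_prepend; case: n nm => //= n nm.
by rewrite entry_cut.
Qed.

End Faces.

Section FunctionModule.
Local Open Scope ring_scope.
Variables (p j : nat) (Q : finGroupType).
Hypothesis p_pr : prime p.

Definition fun_module : Type := {ffun {ffun 'I_j -> Q} -> 'F_p}.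
HB.instance Definition _ :=
  Finite.copy fun_module {ffun {ffun 'I_j -> Q} -> 'F_p}.
HB.instance Definition _ :=
  GRing.Zmodule.copy fun_module {ffun {ffun 'I_j -> Q} -> 'F_p}.
Implicit Types b : fun_module.

Definition fm_eval b (k : cart_power (discrete Q) j) : 'F_p :=
  b (finfun (k : 'I_j -> Q)).

(* [b . g = b - (delta b)(g, -)]. This is a right action for which the
   2-cocycles are the cocycles of degree [j + 2], the first two arguments
   being those of the 2-cocycle; but [b . 1] need not be [b]. *)
Definition fm_act (g : Q) b : fun_module :=
  [ffun k : {ffun 'I_j -> Q} => b k -
    delta (fm_eval b) (prepend (g : discrete Q) (entry (k : cart_power (discrete Q) j)))].

Lemma fm_ext b b' :
  (forall h : nat -> discrete Q, fm_eval b (cut h) = fm_eval b' (cut h)) -> b = b'.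
Proof.
move=> e; apply/ffunP => k.
have kE : k = finfun ((k : cart_power (discrete Q) j) : 'I_j -> Q).
  by apply/ffunP => i; rewrite ffunE.
by have := e (entry (k : cart_power (discrete Q) j)); rewrite cut_entry /fm_eval -kE.
Qed.

Lemma fm_evalD a b k : fm_eval (a + b) k = fm_eval a k + fm_eval b k.
Proof. exact: ffunE. Qed.

Lemma fm_evalB a b k : fm_eval (a - b) k = fm_eval a k - fm_eval b k.
Proof. by rewrite fm_evalD; congr (_ + _); exact: ffunE. Qed.

Lemma fm_act_cut g b (h : nat -> discrete Q) : fm_eval (fm_act g b) (cut h) =
  fm_eval b (cut h) - delta (fm_eval b) (prepend (g : discrete Q) h).
Proof.
rewrite {1}/fm_eval ffunE; congr (_ - _); apply: eq_delta => -[|k] //= kj.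
rewrite /entry insubT /= ffunE.
by [].
Qed.

Lemma fm_actD g : {morph fm_act g : a b / a + b}.
Proof.
move=> a b; apply/ffunP => k; rewrite !ffunE addrACA -opprD; congr (_ - _).
rewrite -big_split; apply: eq_bigr => i _ /=.
by rewrite -mulrDr /fm_eval ffunE.
Qed.

(** This is the vanishing of the coboundary of a coboundary at [(g, h, -)], expanded along its first
    argument. *)
Lemma fm_actM (g h : Q) b : fm_act (g * h)%g b = fm_act h (fm_act g b).
Proof.
apply: fm_ext => u; rewrite !fm_act_cut -addrA; congr (_ + _).
pose y := (cobound (fm_eval b) : cart_power (discrete Q) j.+1 -> 'F_p).
have := delta_prepend y (g : discrete Q) (prepend (h : discrete Q) u).
have yE v : y (cut v) = delta (fm_eval b) v by exact: cobound_cut.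
rewrite delta_cobound !yE => /esym/eqP; rewrite subr_eq0 => /eqP /= dE.
have -> : delta (fm_eval (fm_act g b)) (prepend (h : discrete Q) u) =
  delta (fm_eval b) (prepend (h : discrete Q) u) -
  delta (fun k : cart_power (discrete Q) j =>
    y (cut (prepend (g : discrete Q) (entry k)))) (prepend (h : discrete Q) u).
  rewrite -sumrB; apply: eq_bigr => i _; rewrite -mulrBr fm_act_cut; congr (_ * (_ - _)).
  rewrite -yE; congr y; apply: eq_cut => -[|k] //= kj.
  by rewrite entry_cut.
rewrite -dE.
have -> : (fun n => u n) = u by apply/funext.
ring.
Qed.

Lemma fm_torsion b : b *+ p = 0.
Proof. by apply/ffunP => k; rewrite ffunMnE ffunE -mulr_natr pchar_Fp_0 // mulr0. Qed.

Lemma fm_act_sum g (I : Type) (s : seq I) (F : I -> fun_module) :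
  fm_act g (\sum_(i <- s) F i) = \sum_(i <- s) fm_act g (F i).
Proof.
by apply: (big_morph (fm_act g) (@fm_actD g)); exact: action0 fm_actD g.
Qed.

Variable K : {group Q}.
Hypotheses (nK : (K <| [set: Q]%SET)%g) (pK : (p %| #|K|)%N).

Definition fm_inv b := forall u v : cart_power (discrete Q) j,
  (forall i : 'I_j, ((u : 'I_j -> Q) i)^-1%g * (v : 'I_j -> Q) i \in K)%g ->
  fm_eval b u = fm_eval b v.

Lemma fm_inv_act g b : fm_inv b -> fm_inv (fm_act g b).
Proof.
move=> invb u v uv; rewrite -(cut_entry u) -(cut_entry v) !fm_act_cut.
have KJ (a a1 : Q) : a \in K -> (a ^ a1)%g \in K.
  by move=> aK; rewrite memJ_norm // (fintype.subsetP (normal_norm nK)) ?inE.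
have uvE n : ((entry u n)^-1 * entry v n)%g \in K.
  rewrite /entry; case: insubP => [i _ _|_] /=; first exact: uv.
  by rewrite mulVg; exact: group1.
have face_rel i (h h' : nat -> discrete Q) :
    (forall n, ((h n)^-1 * h' n)%g \in K) ->
    forall n, ((face i h n)^-1 * face i h' n)%g \in K.
  move=> hh' n; case: i => [|i] //=; case: ifP => // _; case: ifP => // _.
  have -> : ((h n * h n.+1)^-1 * (h' n * h' n.+1) =
      ((h n)^-1 * h' n) ^ h n.+1 * ((h n.+1)^-1 * h' n.+1))%g.
    by rewrite conjgE invMg !mulgA mulgK.
  by apply: groupM => //; exact: KJ.
congr (_ - _); first by apply: invb => i; exact: uvE.
apply: eq_bigr => i _; congr (_ * _); apply: invb => n; apply: face_rel => -[|l] //=.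
by rewrite mulVg; exact: group1.
Qed.

(** Each left coset of [K] contributes a multiple of its order, which [p] divides. *)
Lemma sum_coset_invariant (V : zmodType) (F : Q -> V) : (forall v : V, v *+ p = 0) ->
  (forall y k, k \in K -> F (y * k)%g = F y) -> \sum_y F y = 0.
Proof.
move=> Vp FK; rewrite (partition_big (fun y : Q => (y *: K)%g : {set Q}) predT) //=.
apply: big1 => A _.
have [[y /eqP yA]|nA] := pselect (exists y : Q, (y *: K)%g == A); last first.
  by rewrite big_pred0 // => y; apply/negP => yA; apply: nA; exists y.
rewrite (eq_bigl (fun z => z \in (y *: K)%g)) => [|z]; last first.
  rewrite -yA; apply/eqP/idP => [<-|/lcoset_eqP//].
  exact: lcoset_refl.
rewrite (eq_bigr (fun=> F y)) => [|z /lcosetP[k kK ->]]; last exact: FK.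
rewrite sumr_const card_lcoset.
by case/dvdnP: pK => k ->; rewrite mulnC mulrnA Vp mul0rn.
Qed.

(** [b] is the sum of its pieces [del y], supported where the first argument is [y], and [y^-1]
    moves [lam y], supported where it is 1, to [del y] up to the idempotent [fm_act 1]. So [b] is
    the sum of the translates of [beta y] by [y^-1], hence congruent modulo the augmentation
    submodule to the sum of the [beta y]. By invariance [beta y] depends only on the coset of [y],
    so this sum is 0. *)
Lemma fm_inv_aug (S : {group (fun_module : finZmodType)}) b : (0 < j)%N ->
  (forall b', b' \in S <-> fm_act 1%g b' = b') -> fm_inv b -> b \in S ->
  b \in aug fm_act S.
Proof.
move=> j_gt0 SE invb /SE bS.
pose i0 : 'I_j := Ordinal j_gt0.
pose tail (h : nat -> discrete Q) n := h n.+1.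
pose lam (y : Q) : fun_module := [ffun k : {ffun 'I_j -> Q} => (k i0 == 1%g)%:R *
  fm_eval b (cut (prepend (y : discrete Q)
    (tail (entry ((k : 'I_j -> Q) : cart_power (discrete Q) j)))))].
pose del (y : Q) : fun_module := [ffun k : {ffun 'I_j -> Q} => (k i0 == y)%:R * b k].
have lamE y h : fm_eval (lam y) (cut h) = (h 0%N == 1%g)%:R *
    fm_eval b (cut (prepend (y : discrete Q) (tail h))).
  rewrite {1}/fm_eval !ffunE; congr (_ * fm_eval b _).
  by apply: eq_cut => -[|n] //= nj; rewrite /tail /entry insubT /= ffunE.
have delE y h : fm_eval (del y) (cut h) = (h 0%N == y)%:R * fm_eval b (cut h).
  by rewrite /fm_eval !ffunE.
have sum_del : \sum_y del y = b.
  apply/ffunP => k; rewrite sum_ffunE (bigD1 (k i0)) //= big1.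
    by rewrite ffunE eqxx mul1r addr0.
  by move=> y yk; rewrite ffunE eq_sym (negPf yk) mul0r.
have act_lam y : fm_act y^-1%g (lam y) = fm_act 1%g (del y).
  have [->|y1] := eqVneq y 1%g.
    rewrite invg1; congr fm_act; apply: fm_ext => h; rewrite lamE delE.
    have [h0|] := eqVneq (h 0%N) 1%g; last by rewrite !mul0r.
    by congr (_ * fm_eval b _); apply: eq_cut => -[|n] //=.
  (* For [y != 1] all terms with first argument [y^-1] vanish, as [lam y] is supported at 1; only
     the face multiplying [y^-1] into the first argument survives. *)
  suff -> : del y = fm_act y^-1%g (lam y) by rewrite -fm_actM mulg1.
  apply: fm_ext => h; rewrite fm_act_cut delE.
  rewrite /delta big_ord_recl big_ord_recl big1 => [|i _]; last first.
    by rewrite lamE /= invg_eq1 (negPf y1) mul0r mulr0.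
  rewrite !lamE /= expr0 expr1 mul1r mulN1r addr0 opprD opprK addrA addrN add0r.
  rewrite -eq_invg_mul invgK eq_sym.
  have [h0|] := eqVneq (h 0%N) y; last by rewrite !mul0r.
  by congr (_ * fm_eval b _); apply: eq_cut => -[|n] //=.
pose beta y := fm_act 1%g (lam y).
have betaS y : beta y \in S by apply/SE; rewrite -fm_actM mulg1.
have bE : b = \sum_y (fm_act y^-1%g (beta y) - beta y).
  rewrite sumrB [X in _ - X]sum_coset_invariant ?subr0.
  - rewrite -[LHS]bS -{1}sum_del fm_act_sum; apply: eq_bigr => y _.
    by rewrite -act_lam -fm_actM mul1g.
  - exact: fm_torsion.
  - move=> y k kK; congr (fm_act _ _); apply/ffunP => h; rewrite !ffunE; congr (_ * _).
    apply: invb => -[[|n] nj]; rewrite /cut /=; last by rewrite mulVg group1.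
    by rewrite invMg mulgVK groupV.
rewrite bE; apply: (big_ind (fun a => a \in aug fm_act S)).
- exact: group1.
- by move=> a a'; exact: groupM.
- by move=> y _; exact: aug_mem.
Qed.

End FunctionModule.

(** * Cohomological dimension *)

Section CohomologicalDimension.
Local Open Scope ring_scope.
Variables (p d q : nat) (E G : topGroupType) (x : d.-tuple E) (f : E -> G).
Hypotheses (p_pr : prime p) (p_odd : odd p) (pq : (p %| q)%N).
Hypotheses (d_ge2 : (1 < d)%N) (d_even : ~~ odd d).
Hypotheses (freeE : is_free_pro_p p x) (pG : pro_p_group p G).
Hypotheses (fc : continuous f) (fM : {morph f : a b / (a * b)%g}).
Hypothesis fs : forall g, exists a, f a = g.
Hypothesis fK :
  (f @^-1` [set 1%g])%classic = closed_normal_closure (demushkin_relator q x).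

Let hG : hausdorff_space G. Proof. by case: pG.1. Qed.

(* [G] is infinite: it has quotients [Z/p^k] of every order, in which
   all generators but the second one are trivial. *)
Lemma open_normal_nontrivial (V : set G) : open V -> normal_subgroup V ->
  exists2 v, V v & v <> 1%g.
Proof.
move=> oV nV; apply: contrapT => nex.
have V1 v : V v -> v = 1%g by move=> Vv; apply: contrapT => v1; apply: nex; exists v.
have [Q [pi [pQ piM pi_s piE]]] := open_normal_quotient p_pr pG oV nV.
pose Z : finZmodType := 'Z_(p ^ #|Q|.+1).
have Zcard : #|Z| = (p ^ #|Q|.+1)%N.
  by rewrite card_ord Zp_cast // -(exp1n #|Q|.+1) ltn_exp2r // prime_gt1.
have pZ : (p.-group [set: (Z : finGroupType)]%SET)%g.
  by rewrite /pgroup cardsT Zcard pnatX pnat_id.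
pose i1 : 'I_d := Ordinal d_ge2.
have [l lc [lM lx]] := free_pro_p_lift freeE (fun i : 'I_d => (i == i1)%:R : Z) pZ.
have l1 : l 1%g = 1%g by apply: (mulgI (l 1%g)); rewrite -lM !mulg1.
have lX e n : l (e ^+ n)%g = l e *+ n.
  by elim: n => [|n IHn]; rewrite ?expg0 // expgS lM IHn mulrS.
have lV e : l e^-1%g = - l e.
  by apply: (addrI (l e)); rewrite subrr -[LHS]lM mulgV l1.
have lr : l (demushkin_relator q x) = 0.
  have lC a b : commute (l a) (l b) by exact: zmod_mulgC.
  rewrite (@relator_abelian _ _ x Z l q (ltnW d_ge2) lM lC (Ordinal (ltnW d_ge2))) //.
  by rewrite lx expg1n.
(* This power is trivial in [Q], hence in [G] if [V] is trivial; but [l] maps it to [#|Q|], which is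
   nonzero in [Z] since [#|Q| < p ^ (#|Q| + 1)]. *)
pose e := (tnth x i1 ^+ #|Q|)%g.
have pi1 : pi 1%g = 1%g by apply: (mulgI (pi 1%g)); rewrite -piM !mulg1.
have fe : f e = 1%g.
  have fX n : pi (f (tnth x i1 ^+ n)%g) = (pi (f (tnth x i1)) ^+ n)%g.
    elim: n => [|n IHn]; last by rewrite !expgS fM piM IHn.
    by rewrite !expg0 (fmorph1 fM).
  have : pi (f e) = pi 1%g.
    by rewrite fX pi1 -[#|Q|]cardsT expg_cardG ?inE.
  by move=> /piE; rewrite mulg1 => /V1 fe1; rewrite -(invgK (f e)) fe1 invg1.
have le : l e = 0.
  have : closed_normal_closure (demushkin_relator q x) e by rewrite -fK.
  move=> /(_ [set e | l e = 0]%classic); apply => //.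
    exact: (@locally_constant_closed _ _ l (fun a => a = 0)).
  split; first split.
  - exact: l1.
  - by move=> a b /= la lb; rewrite lM la lb mulg1.
  - by move=> a /= la; rewrite lV la oppr0.
  - move=> a b /= la; rewrite /conjg !lM !lV la.
    by rewrite -[LHS]/(- l b + (0 + l b)) add0r addNr.
move: le; rewrite /e lX lx eqxx => /(congr1 val) /=.
have n1 : (1 < p ^ #|Q|.+1)%N.
  by rewrite -(exp1n #|Q|.+1) ltn_exp2r // prime_gt1.
rewrite val_Zp_nat // modn_small; last first.
  by apply: leq_trans (ltn_expl _ (prime_gt1 p_pr)) _; rewrite leq_exp2l // prime_gt1.
have : (0 < #|Q|)%N by apply/card_gt0P; exists 1%g.
by move=> /[swap] ->.
Qed.

Lemma cochain_eval_locally_constant (Q : finGroupType) (pi : G -> Q) j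
  (s : G -> fun_module p j Q) :
  locally_constant pi -> locally_constant s ->
  locally_constant (fun u : cart_power G j.+1 => fm_eval (s (entry u 0))
    (cut (fun n => pi (entry u n.+1) : discrete Q))).
Proof.
move=> pic sc u.
have near0 : \forall v \near u, s (entry v 0) = s (entry u 0).
  exact: (locally_constant_precomp (@entry_continuous G j.+1 0) sc).
have nearS : \forall v \near u, forall i : 'I_j, pi (entry v i.+1) = pi (entry u i.+1).
  apply: (@filter_forall _ _ _ _ (nbhs_filter u)) => i.
  exact: (locally_constant_precomp (@entry_continuous G j.+1 i.+1) pic).
near=> v.
have -> : s (entry v 0) = s (entry u 0) by near: v.
congr fm_eval; apply/funext => i; rewrite /cut.
by move: i; near: v.
Unshelve. all: by end_near. Qed.

Theorem cocycle_cobound j (z : cart_power G j.+3 -> 'F_p) :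
  locally_constant z -> (forall u : cart_power G j.+4, cobound z u = 0) ->
  exists2 w : cart_power G j.+2 -> 'F_p, locally_constant w & forall u, cobound w u = z u.
Proof.
move=> zc dz.
have [V [oV nV zV]] := uniformly_locally_constant pG.1 zc.
have [v Vv v1] := open_normal_nontrivial oV nV.
(* [z] already factors modulo [V]. Excluding [v] from [V'] makes the image of [V] in [Q] a
   nontrivial p-group, so that [p] divides its order. *)
have [V' [oV' nV' V'V]] : exists V', [/\ open V', normal_subgroup V' &
    (V' `<=` V `&` ~` [set v])%classic].
  apply: open_normal_basis pG.1 _; apply: open_nbhs_nbhs; split.
    apply: openI => //; rewrite openC.
    exact: (@accessible_closed_set1 _ (hausdorff_accessible hG)).
  by split; [case: nV.1|move=> /esym].
have [Q [pi [pQ piM pi_s piE]]] := open_normal_quotient p_pr pG oV' nV'.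
have pi1 : pi 1%g = 1%g by apply: (mulgI (pi 1%g)); rewrite -piM !mulg1.
have piV g : pi g^-1%g = (pi g)^-1%g.
  by apply: (mulgI (pi g)); rewrite -piM !mulgV.
have [sg sgK] := choice pi_s.
have pic : locally_constant pi.
  move=> g; have : nbhs g [set h | V' (g^-1 * h)%g]%classic.
    apply: (@mulgl_continuous G g^-1%g g); rewrite mulVg.
    by apply: open_nbhs_nbhs; split=> //; case: nV'.1.
  by apply: filterS => h gh; apply/esym/piE.
have piVE g h : pi g = pi h -> V (g^-1 * h)%g by move=> /piE /V'V[].
pose z' (u : cart_power (discrete Q) j.+3) : 'F_p := z (fun i => sg ((u : 'I_j.+3 -> Q) i)).
have z'E h : z' (cut (fun n => pi (h n) : discrete Q)) = z (cut h).
  by apply: zV => i; apply: piVE; rewrite sgK.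
(* The first two arguments become those of a 2-cocycle. At least one argument remains for the
   coefficients, as [fm_inv_aug] demands. *)
pose c (g h : Q) : fun_module p j.+1 Q :=
  [ffun k : {ffun 'I_j.+1 -> Q} => z' (cut (prepend (g : discrete Q)
  (prepend (h : discrete Q) (entry (k : cart_power (discrete Q) j.+1)))))].
have cutc g h u : fm_eval (c g h) (cut u) =
    z' (cut (prepend (g : discrete Q) (prepend (h : discrete Q) u))).
  rewrite /fm_eval ffunE; congr z'; apply: eq_cut => -[|[|n]] //= nj.
  by rewrite /entry insubT /= ffunE.
have delta_pi m (b : cart_power (discrete Q) m -> 'F_p) h :
    delta b (fun n => pi (h n) : discrete Q) =
    delta (fun u : cart_power G m => b (cut (fun n => pi (entry u n) : discrete Q))) h.
  apply: eq_bigr => i _; congr (_ * b _); apply: eq_cut => n nm.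
  rewrite entry_cut //; case: (i : nat) => [|l] //=.
  by case: ifP => // _; case: ifP => // _; rewrite piM.
have dz' h : delta z' h = 0.
  have -> : h = fun n => pi (sg (h n)) by apply/funext => n; rewrite sgK.
  rewrite delta_pi -(dz (cut (fun n => sg (h n)))) cobound_cut.
  by apply: eq_bigr => i _; rewrite z'E cut_entry.
have cE g h k : c h k - c (g * h)%g k + c g (h * k)%g = fm_act k (c g h).
  apply: fm_ext => u; rewrite fm_act_cut.
  rewrite fm_evalD fm_evalB !cutc.
  have := delta_prepend z' (g : discrete Q) (prepend (h : discrete Q) (prepend (k : discrete Q) u)).
  rewrite dz' delta_prepend !prepend_cut.
  have -> : (fun u0 => z' (cut (prepend (g : discrete Q) (entry (cut (prepend (h : discrete Q) (entry u0))
      : cart_power (discrete Q) j.+2))))) = fm_eval (c g h) :> (cart_power (discrete Q) j.+1 -> _).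
    by apply/funext => a; rewrite prepend_cut -{2}(cut_entry a) cutc.
  have eta : (fun n => u n) = u by apply/funext.
  rewrite /= !eta => e.
  by apply/eqP; rewrite -subr_eq0; apply/eqP; rewrite [RHS]e; ring.
pose K : {set Q} := [set k | `[< exists2 v, V v & pi v = k >]]%SET.
have KE k : k \in K <-> exists2 v, V v & pi v = k.
  by rewrite finset.in_set; split=> /asboolP.
have [[V1 VM VV] VJ] := nV.
have gK : group_set K.
  apply/group_setP; split=> [|a b]; first by apply/KE; exists 1%g.
  move=> /KE[a' Va <-] /KE[b' Vb <-]; apply/KE; exists (a' * b')%g => //.
  exact: VM.
pose KG := Group gK.
have nK : (KG <| [set: Q]%SET)%g.
  rewrite /normal finset.subsetT; apply/fintype.subsetP => b _; rewrite inE.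
  apply/fintype.subsetP => _ /imsetP[a /KE[a' Va <-] ->]; apply/KE.
  have [b' <-] := pi_s b; exists (a' ^ b')%g; first exact: VJ.
  by rewrite /conjg !piM piV.
have pK : (p %| #|KG|)%N.
  have [|_ //] := pgroup_pdiv (pgroupS (finset.subsetT KG) pQ).
  apply/trivgPn; exists (pi v); first by apply/KE; exists v.
  rewrite -pi1; apply/eqP => /esym/piE; rewrite invg1 mul1g => /V'V[_].
  exact.
have [S SE] : exists S : {group (fun_module p j.+1 Q : finZmodType)},
    forall b, b \in S <-> fm_act 1%g b = b.
  apply: group_set_zmod; first exact: action0 (@fm_actD _ _ _) _.
  by move=> a b aE bE; rewrite fm_actD aE bE.
have stS : stable (@fm_act p j.+1 Q) S.
  by split=> [g b|b /SE //] /SE bE; apply/SE; rewrite -fm_actM mulg1.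
have inv_c g h : fm_inv KG (c g h).
  move=> u w uw; rewrite -(cut_entry u) -(cut_entry w) !cutc; apply: zV => -[[|[|n]] nj]; rewrite /cut /=.
  - by rewrite mulVg.
  - by rewrite mulVg.
  have nj' : (n < j.+1)%N by [].
  have /KE[a Va pia] := uw (Ordinal nj').
  have -> : entry u n = (u : 'I_j.+1 -> Q) (Ordinal nj') by rewrite /entry insubT.
  have -> : entry w n = (w : 'I_j.+1 -> Q) (Ordinal nj') by rewrite /entry insubT.
  rewrite -[(_ * _)%g](mulVKg a); apply: VM => //; apply: piVE.
  by rewrite piM piV !sgK.
have cA g h : fm_act 1%g (c g h) - fm_act h (c 1%g 1%g) \in aug (@fm_act p j.+1 Q) S.
  apply: sub_memB.
    apply: (fm_inv_aug p_pr pK (ltn0Sn j) SE); first by apply: (fm_inv_act nK); exact: inv_c.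
    by apply/SE; rewrite -fm_actM mulg1.
  apply: (fm_inv_aug p_pr pK (ltn0Sn j) SE); first by apply: (fm_inv_act nK); exact: inv_c.
  by apply/SE; rewrite -fm_actM mulg1.
have [s sc sM] := @cocycle_vanish p Q (fun_module p j.+1 Q) (@fm_act p j.+1 Q) p_pr pQ
  (@fm_torsion _ _ _ p_pr) (@fm_actD _ _ _) (@fm_actM _ _ _) d q E G x f p_odd pq
  d_even freeE hG fc fM fs fK pi pic piM pi_s S c stS cE cA.
exists (fun u : cart_power G j.+2 => fm_eval (s (entry u 0))
  (cut (fun n => pi (entry u n.+1) : discrete Q))).
  exact: cochain_eval_locally_constant.
move=> u; rewrite -[u]cut_entry; move: (entry u) => h.
set w := (fun u => _); rewrite cobound_cut.
have wE (a : nat -> G) : w (cut a) = fm_eval (s (a 0)) (cut (fun n => pi (a n.+1) : discrete Q)).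
  rewrite /w entry_cut //; congr fm_eval; apply: eq_cut => n nj.
  by rewrite entry_cut.
pose t n := h n.+2.
have -> : delta w h = delta w (prepend (h 0) (prepend (h 1) t)).
  by apply: eq_delta => -[|[|n]].
(* Once [h 0] is peeled off, the coboundary of [w] is that of the 1-cochain [s], because [fm_act]
   contains the remaining term. *)
rewrite delta_prepend !wE /=.
have -> : (fun k : cart_power G j.+1 => w (cut (prepend (h 0) (entry k)))) =
    (fun k => fm_eval (s (h 0)) (cut (fun n => pi (entry k n) : discrete Q))).
  by apply/funext => k; rewrite wE.
rewrite -delta_pi -[h 1%R]/(h 1%N) sM fm_evalB fm_evalD fm_act_cut cutc.
have -> : delta (fm_eval (s (h 0%N))) (fun n => pi (prepend (h 1%N) t n) : discrete Q) =
    delta (fm_eval (s (h 0%N))) (prepend (pi (h 1%N) : discrete Q) (fun n => pi (t n))).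
  by apply: eq_delta => -[|n].
have -> : z (cut h) = z' (cut (prepend (pi (h 0%N) : discrete Q)
    (prepend (pi (h 1%N) : discrete Q) (fun n => pi (t n))))).
  by rewrite -z'E; congr z'; apply: eq_cut => -[|[|n]].
ring.
Qed.

End CohomologicalDimension.

(** * The truncated Magnus group *)

Section Magnus.
Local Open Scope ring_scope.
Variables (p d : nat).
Local Notation F := 'F_p.

(* The triple [(a, b, c)] stands for [1 + sum a_i X_i + sum b_ij X_i X_j +
   sum c_ijk X_i X_j X_k] in the algebra of noncommutative polynomials
   truncated in degree 4. *)
Definition magnus : Type :=
  ({ffun 'I_d -> F} * {ffun 'I_d * 'I_d -> F} * {ffun 'I_d * 'I_d * 'I_d -> F})%type.
HB.instance Definition _ := Finite.on magnus.

Definition magnus1 (m : magnus) i : F := m.1.1 i.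
Definition magnus2 (m : magnus) i j : F := m.1.2 (i, j).
Definition magnus3 (m : magnus) i j k : F := m.2 (i, j, k).

Definition mk_magnus (a : 'I_d -> F) (b : 'I_d -> 'I_d -> F)
  (c : 'I_d -> 'I_d -> 'I_d -> F) : magnus :=
  ([ffun i => a i], [ffun ij => b ij.1 ij.2], [ffun ijk => c ijk.1.1 ijk.1.2 ijk.2]).

Lemma magnus_ext (m n : magnus) : magnus1 m =1 magnus1 n ->
  magnus2 m =2 magnus2 n -> (forall i j k, magnus3 m i j k = magnus3 n i j k) -> m = n.
Proof.
case: m n => [[a b] c] [[a' b'] c'] ea eb ec; congr (_, _, _); apply/ffunP.
- exact: ea.
- by move=> [i j]; exact: eb.
- by move=> [[i j] k]; exact: ec.
Qed.

Lemma mk_magnus1 a b c i : magnus1 (mk_magnus a b c) i = a i.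
Proof. exact: ffunE. Qed.
Lemma mk_magnus2 a b c i j : magnus2 (mk_magnus a b c) i j = b i j.
Proof. exact: ffunE. Qed.
Lemma mk_magnus3 a b c i j k : magnus3 (mk_magnus a b c) i j k = c i j k.
Proof. exact: ffunE. Qed.
Definition mk_magnusE := (mk_magnus1, mk_magnus2, mk_magnus3).

Definition magnus_mul (m n : magnus) := mk_magnus
  (fun i => magnus1 m i + magnus1 n i)
  (fun i j => magnus2 m i j + magnus1 m i * magnus1 n j + magnus2 n i j)
  (fun i j k => magnus3 m i j k + magnus2 m i j * magnus1 n k +
     magnus1 m i * magnus2 n j k + magnus3 n i j k).

Definition magnus_one := mk_magnus (fun=> 0) (fun _ _ => 0) (fun _ _ _ => 0).

Definition magnus_inv (m : magnus) := mk_magnus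
  (fun i => - magnus1 m i)
  (fun i j => magnus1 m i * magnus1 m j - magnus2 m i j)
  (fun i j k => magnus1 m i * magnus2 m j k + magnus2 m i j * magnus1 m k -
     magnus1 m i * magnus1 m j * magnus1 m k - magnus3 m i j k).

Fact magnus_mulA : associative magnus_mul.
Proof. by move=> l m n; apply: magnus_ext => [i1|i1 i2|i1 i2 i3]; rewrite !mk_magnusE; ring. Qed.

Fact magnus_mul1 : left_id magnus_one magnus_mul.
Proof. by move=> m; apply: magnus_ext => [i1|i1 i2|i1 i2 i3]; rewrite !mk_magnusE; ring. Qed.

Fact magnus_mulV : left_inverse magnus_one magnus_inv magnus_mul.
Proof. by move=> m; apply: magnus_ext => [i1|i1 i2|i1 i2 i3]; rewrite !mk_magnusE; ring. Qed.

HB.instance Definition _ :=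
  Finite_isGroup.Build magnus magnus_mulA magnus_mul1 magnus_mulV.

Lemma magnus1M (m n : magnus) i : magnus1 (m * n)%g i = magnus1 m i + magnus1 n i.
Proof. exact: mk_magnus1. Qed.

Lemma magnus2M (m n : magnus) i j : magnus2 (m * n)%g i j =
  magnus2 m i j + magnus1 m i * magnus1 n j + magnus2 n i j.
Proof. exact: mk_magnus2. Qed.

Lemma magnus3M (m n : magnus) i j k : magnus3 (m * n)%g i j k =
  magnus3 m i j k + magnus2 m i j * magnus1 n k +
     magnus1 m i * magnus2 n j k + magnus3 n i j k.
Proof. exact: mk_magnus3. Qed.

Lemma magnus1_1 i : magnus1 1%g i = 0. Proof. exact: mk_magnus1. Qed.
Lemma magnus2_1 i j : magnus2 1%g i j = 0. Proof. exact: mk_magnus2. Qed.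
Lemma magnus3_1 i j k : magnus3 1%g i j k = 0. Proof. exact: mk_magnus3. Qed.

Definition magnusE :=
  (mk_magnusE, (magnus1M, magnus2M, magnus3M), (magnus1_1, magnus2_1, magnus3_1)).

Lemma magnus_p_group : prime p -> (p.-group [set: magnus]%SET)%g.
Proof.
move=> p_pr; rewrite /pgroup cardsT !card_prod !card_ffun card_Fp //.
by rewrite !pnatM !pnatX pnat_id.
Qed.

(** The binomial expansion of [(1 + N) ^ n], with [N ^ 4 = 0]. *)
Lemma magnusX (m : magnus) n : (m ^+ n)%g = mk_magnus
  (fun i => n%:R * magnus1 m i)
  (fun i j => n%:R * magnus2 m i j + 'C(n, 2)%:R * (magnus1 m i * magnus1 m j))
  (fun i j k => n%:R * magnus3 m i j k +
    'C(n, 2)%:R * (magnus1 m i * magnus2 m j k + magnus2 m i j * magnus1 m k) +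
    'C(n, 3)%:R * (magnus1 m i * magnus1 m j * magnus1 m k)).
Proof.
elim: n => [|n IHn].
  by apply: magnus_ext => [i1|i1 i2|i1 i2 i3]; rewrite !magnusE !mul0r ?addr0.
have nS : (n.+1)%:R = n%:R + 1 :> F by rewrite -natr1.
have C2 : 'C(n.+1, 2)%:R = 'C(n, 2)%:R + n%:R :> F by rewrite binS bin1 natrD.
have C3 : 'C(n.+1, 3)%:R = 'C(n, 3)%:R + 'C(n, 2)%:R :> F by rewrite binS natrD.
rewrite expgSr IHn nS C2 C3.
by apply: magnus_ext => [i1|i1 i2|i1 i2 i3]; rewrite !magnusE; ring.
Qed.

Lemma Fp_natr_dvd n : prime p -> (p %| n)%N -> n%:R = 0 :> F.
Proof. by move=> p_pr /dvdnP[k ->]; rewrite natrM pchar_Fp_0 // mulr0. Qed.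

Lemma magnusX_eq1 (m : magnus) q : prime p -> (p %| q)%N -> (p %| 'C(q, 2))%N ->
  (p %| 'C(q, 3))%N -> (m ^+ q)%g = 1%g.
Proof.
move=> p_pr q1 q2 q3; rewrite magnusX !Fp_natr_dvd //.
by apply: magnus_ext => [i1|i1 i2|i1 i2 i3]; rewrite !magnusE; ring.
Qed.

Definition partner (i : nat) := if odd i then i.-1 else i.+1.

(* The quadratic terms are chosen so as to kill the cubic terms of the
   commutators: [(1 + Y + XY)(1 + X + YX)] divides [(1 + X + YX)(1 + Y + XY)]
   with quotient [1 + XY - YX]. *)
Definition magnus_gen (i : nat) : magnus := mk_magnus
  (fun j => ((j : nat) == i)%:R)
  (fun j k => ((j : nat) == partner i)%:R * ((k : nat) == i)%:R) (fun _ _ _ => 0).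

Definition magnus_quad (b : 'I_d -> 'I_d -> F) := mk_magnus (fun=> 0) b (fun _ _ _ => 0).

Lemma magnus_commutator k :
  [~ magnus_gen k.*2, magnus_gen k.*2.+1]%g = magnus_quad (fun i j =>
    ((i : nat) == k.*2)%:R * ((j : nat) == k.*2.+1)%:R -
    ((i : nat) == k.*2.+1)%:R * ((j : nat) == k.*2)%:R).
Proof.
apply: (mulgI (magnus_gen k.*2.+1 * magnus_gen k.*2)%g); rewrite -commgC.
have p0 : partner k.*2 = k.*2.+1 by rewrite /partner odd_double.
have p1 : partner k.*2.+1 = k.*2 by rewrite /partner /= odd_double.
apply: magnus_ext => [i1|i1 i2|i1 i2 i3]; rewrite !magnusE ?p0 ?p1; ring.
Qed.

Lemma magnus_quadM b b' :
  (magnus_quad b * magnus_quad b')%g = magnus_quad (fun i j => b i j + b' i j).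
Proof. by apply: magnus_ext => [i1|i1 i2|i1 i2 i3]; rewrite !magnusE; ring. Qed.

(** The alternating form given by the quadratic part of the relator; it becomes the matrix of the
    cup product in the dual basis. *)
Definition magnus_form (i j : 'I_d) : F :=
  ((j : nat) == partner i)%:R * (-1) ^+ odd i.

Lemma magnus_formE (i j : 'I_d) : ~~ odd d -> \sum_(k < d./2)
    (((i : nat) == k.*2)%:R * ((j : nat) == k.*2.+1)%:R -
     ((i : nat) == k.*2.+1)%:R * ((j : nat) == k.*2)%:R) = magnus_form i j.
Proof.
move=> d_even; have id := ltn_ord i.
have := odd_double_half i; have := odd_double_half d; rewrite (negPf d_even) => dE iE.
have k_lt : (i./2 < d./2)%N by lia.
rewrite (bigD1 (Ordinal k_lt)) //= big1 ?addr0 => [|k ki]; last first.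
  have ki' : (k : nat) != i./2 by apply: contraNneq ki => ki; apply/eqP/val_inj.
  have -> : ((i : nat) == k.*2) = false by apply/eqP; lia.
  have -> : ((i : nat) == k.*2.+1) = false by apply/eqP; lia.
  by rewrite !mul0r subrr.
rewrite /magnus_form /partner; case: (boolP (odd i)) => i_odd; rewrite ?i_odd ?(negPf i_odd) /=.
  have -> : ((i : nat) == i./2.*2) = false by apply/eqP; lia.
  have -> : ((i : nat) == i./2.*2.+1) = true by apply/eqP; lia.
  have -> : i.-1 = i./2.*2 by lia.
  by rewrite mul0r mul1r sub0r expr1 mulrN1.
have -> : ((i : nat) == i./2.*2) = true by apply/eqP; lia.
have -> : ((i : nat) == i./2.*2.+1) = false by apply/eqP; lia.
have -> : i./2.*2 = i by lia.
by rewrite mul0r mul1r subr0 expr0 mulr1.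
Qed.

Section Relator.
Variables (E : topGroupType) (x : d.-tuple E) (Phi : E -> magnus).
Hypothesis PhiM : {morph Phi : a b / (a * b)%g}.
Hypothesis Phi_x : forall i, Phi (tnth x i) = magnus_gen i.
Hypotheses (d_even : ~~ odd d) (d_gt0 : (0 < d)%N).

Lemma magnus_relator q : Phi (demushkin_relator q x) =
  (magnus_gen 0 ^+ q * magnus_quad magnus_form)%g.
Proof.
have Phi1 : Phi 1%g = 1%g by apply: (mulgI (Phi 1%g)); rewrite -PhiM !mulg1.
have PhiV e : Phi e^-1%g = (Phi e)^-1%g.
  by apply: (mulgI (Phi e)); rewrite -PhiM !mulgV.
have PhiX e n : Phi (e ^+ n)%g = (Phi e ^+ n)%g.
  by elim: n => [|n IHn]; rewrite ?expg0 // !expgS PhiM IHn.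
have Phi_nth i : (i < d)%N -> Phi (nth 1%g x i) = magnus_gen i.
  by move=> id; rewrite -[i]/(nat_of_ord (Ordinal id)) -Phi_x (tnth_nth 1%g).
rewrite /demushkin_relator PhiM PhiX Phi_nth //; congr (_ * _)%g.
rewrite (big_morph Phi PhiM Phi1).
rewrite (eq_bigr (fun k : 'I_d./2 => magnus_quad (fun i j : 'I_d =>
    ((i : nat) == k.*2)%:R * ((j : nat) == k.*2.+1)%:R -
    ((i : nat) == k.*2.+1)%:R * ((j : nat) == k.*2)%:R))); last first.
  move=> k _; rewrite -magnus_commutator /commg /conjg !PhiM !PhiV !Phi_nth //.
    by have := ltn_ord k; lia.
  by have := odd_double_half d; have := ltn_ord k; rewrite (negPf d_even); lia.
have quad_sum (I : Type) (s : seq I) (w : I -> 'I_d -> 'I_d -> F) :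
    (\prod_(k <- s) magnus_quad (w k))%g = magnus_quad (fun i j => \sum_(k <- s) w k i j).
  elim: s => [|k s IHs].
    by rewrite big_nil; apply: magnus_ext => [i1|i1 i2|i1 i2 i3]; rewrite !magnusE ?big_nil.
  rewrite big_cons IHs magnus_quadM.
  by apply: magnus_ext => [i1|i1 i2|i1 i2 i3]; rewrite !magnusE ?big_cons.
rewrite quad_sum.
by apply: magnus_ext => [i1|i1 i2|i1 i2 i3]; rewrite !magnusE ?magnus_formE.
Qed.

End Relator.

End Magnus.

(** * Minimal models from null-homotopies *)

Section CohomologyAlgebra.
Local Open Scope ring_scope.
Local Open Scope quotient_scope.
Variables (F : fieldType) (A : dga F).
Local Notation H n := (cohomology A n).

Lemma piZ n a (x : cocycle A n) : a *: \pi_(H n) x = \pi_(H n) (a *: x).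
Proof. exact: cohomology_piZ. Qed.

Lemma piD n (x y : cocycle A n) : \pi_(H n) x + \pi_(H n) y = \pi_(H n) (x + y).
Proof. by rewrite cohomology_piD. Qed.

Lemma cohomology_mul_linearl i j n (e : i + j = n) (y : H j) :
  linear (fun x : H i => cohomology_mul e x y).
Proof.
move=> a; elim/quotW: y => y; elim/quotW=> x; elim/quotW=> x'.
rewrite piZ piD !cohomology_mulE piZ piD; congr (\pi_ _ _); apply: val_inj => /=.
exact: dga_mul_linearl.
Qed.

Lemma cohomology_mul_linearr i j n (e : i + j = n) (x : H i) :
  linear (fun y : H j => cohomology_mul e x y).
Proof.
move=> a; elim/quotW: x => x; elim/quotW=> y; elim/quotW=> y'.
rewrite piZ piD !cohomology_mulE piZ piD; congr (\pi_ _ _); apply: val_inj => /=.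
exact: dga_mul_linearr.
Qed.

Lemma cohomology_mulA i j k ij jk n (eij : i + j = ij) (ejk : j + k = jk)
    (el : ij + k = n) (er : i + jk = n) (x : H i) (y : H j) (z : H k) :
  cohomology_mul er x (cohomology_mul ejk y z) =
  cohomology_mul el (cohomology_mul eij x y) z.
Proof.
elim/quotW: x => x; elim/quotW: y => y; elim/quotW: z => z.
rewrite (cohomology_mulE ejk) (cohomology_mulE eij) !cohomology_mulE.
congr (\pi_ _ _); apply: val_inj => /=.
exact: dga_mulA.
Qed.

Lemma cohomology_ind n (P : H n -> Prop) :
  (forall x (dx : dga_d (erefl (n + 1)) x = 0), P (cohomology_class dx)) ->
  forall x, P x.
Proof.
move=> Pc; elim/quotW => x.
have dx : dga_d (erefl (n + 1)) (val x) = 0 by apply/eqP; exact: (valP x).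
have := Pc _ dx; congr P; congr (\pi_ _ _); exact: val_inj.
Qed.

Lemma cohomology_class_eq n (x y : A n) (dx : dga_d (erefl (n + 1)) x = 0)
    (dy : dga_d (erefl (n + 1)) y = 0) :
  cohomology_class dx = cohomology_class dy <->
  exists (m : int) (e : m + 1 = n) (w : A m), dga_d e w = x - y.
Proof.
split=> [/cohomology_eqP/asboolP[m [e [w dw]]]|[m [e [w dw]]]].
  by exists m, e, w; rewrite dw raddfB.
by apply/cohomology_eqP/asboolP; exists m, e, w; rewrite dw raddfB.
Qed.

Lemma cohomology_class_mul i j n (e : i + j = n) (x : A i) (y : A j) (z : A n)
    (dx : dga_d (erefl (i + 1)) x = 0) (dy : dga_d (erefl (j + 1)) y = 0)
    (dz : dga_d (erefl (n + 1)) z = 0) :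
  dga_mul e x y = z ->
  cohomology_mul e (cohomology_class dx) (cohomology_class dy) = cohomology_class dz.
Proof.
by move=> xyz; rewrite cohomology_mulE; congr (\pi_ _ _); apply: val_inj.
Qed.

Lemma cohomology_class_linear n a (x y z : A n) (dx : dga_d (erefl (n + 1)) x = 0)
    (dy : dga_d (erefl (n + 1)) y = 0) (dz : dga_d (erefl (n + 1)) z = 0) :
  a *: x + y = z ->
  a *: cohomology_class dx + cohomology_class dy = cohomology_class dz.
Proof. by move=> e; rewrite piZ piD; congr (\pi_ _ _); apply: val_inj. Qed.

End CohomologyAlgebra.

Section LinearSums.
Local Open Scope ring_scope.
Variables (F : fieldType) (U V : lmodType F) (I : finType).

Lemma linear_sum_fun (s : I -> F) (L : I -> U -> V) :
  (forall i, linear (L i)) -> linear (fun u => \sum_i s i *: L i u).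
Proof.
move=> lL a u v; rewrite scaler_sumr -big_split; apply: eq_bigr => i _ /=.
by rewrite lL scalerDr !scalerA mulrC.
Qed.

Lemma linear_comb (co : I -> U -> F) (w : I -> V) :
  (forall i a u v, co i (a *: u + v) = a * co i u + co i v) ->
  linear (fun u => \sum_i co i u *: w i).
Proof.
move=> lco a u v; rewrite scaler_sumr -big_split; apply: eq_bigr => i _ /=.
by rewrite lco scalerDl scalerA.
Qed.

Lemma linear_fun0 (L : U -> V) : linear L -> L 0 = 0.
Proof. by move=> lL; have := lL (-1) 0 0; rewrite scaler0 addr0 scaleN1r addNr. Qed.

Lemma linear_funZ (L : U -> V) : linear L -> forall a u, L (a *: u) = a *: L u.
Proof. by move=> lL a u; have := lL a u 0; rewrite linear_fun0 // !addr0. Qed.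

Lemma linear_apply_sum (L : U -> V) (s : I -> F) (w : I -> U) : linear L ->
  L (\sum_i s i *: w i) = \sum_i s i *: L (w i).
Proof.
move=> lL; apply: (big_ind2 (fun u v => L u = v)) => [|u v u' v' <- <-|i _].
- exact: linear_fun0.
- by rewrite -{1}[u]scale1r lL scale1r.
- exact: linear_funZ.
Qed.

Lemma linear_add (L L' : U -> V) : linear L -> linear L' ->
  linear (fun u => L u + L' u).
Proof. by move=> lL lL' a u v; rewrite lL lL' scalerDr addrACA. Qed.

Lemma linear_opp (L : U -> V) : linear L -> linear (fun u => - L u).
Proof. by move=> lL a u v; rewrite lL opprD scalerN. Qed.

Lemma linear_scale (b : F) (L : U -> V) : linear L -> linear (fun u => b *: L u).
Proof. by move=> lL a u v; rewrite lL scalerDr !scalerA mulrC. Qed.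

Lemma linear_zero : linear (fun _ : U => 0 : V).
Proof. by move=> a u v; rewrite scaler0 addr0. Qed.

End LinearSums.

Lemma linear_after (F : fieldType) (U V W : lmodType F) (L : U -> V) (L' : V -> W) :
  linear L -> linear L' -> linear (fun u => L' (L u)).
Proof. by move=> lL lL' a u v; rewrite lL lL'. Qed.

Section Assembly.
Local Open Scope ring_scope.
Local Open Scope quotient_scope.
Variables (F : fieldType) (A : connected_dga F) (d : nat).
Local Notation H n := (cohomology A n).
Local Notation z1 := (Posz 1).
Local Notation z2 := (Posz 2).

Definition trilinear i j k n (Phi : H i -> H j -> H k -> A n) :=
  [/\ forall y z, linear (fun x => Phi x y z), forall x z, linear (fun y => Phi x y z) &
      forall x y, linear (Phi x y)].

Definition coordinates n := exists (K : nat) (e : 'I_K -> H n) (co : 'I_K -> H n -> F),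
  (forall i a u v, co i (a *: u + v) = a * co i u + co i v) /\
  forall x, x = \sum_i co i x *: e i.

(** Primitives are chosen on triples from the spanning families and extended through the
    coordinates. *)
Lemma trilinear_lift i j k l m (ed : l + 1 = m) (R : H i -> H j -> H k -> A m) :
  (forall n, coordinates n) -> trilinear R ->
  (forall x y z, exists w : A l, dga_d ed w = R x y z) ->
  exists2 Phi, trilinear Phi & forall x y z, dga_d ed (Phi x y z) = R x y z.
Proof.
move=> cH [R1 R2 R3] RB.
have [K [e [co [lco coE]]]] := cH i.
have [K' [e' [co' [lco' coE']]]] := cH j.
have [K'' [e'' [co'' [lco'' coE'']]]] := cH k.
have [w wE] := choice (fun t : 'I_K * 'I_K' * 'I_K'' => RB (e t.1.1) (e' t.1.2) (e'' t.2)).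
exists (fun x y z => \sum_s co s x *: \sum_s' co' s' y *: \sum_s'' co'' s'' z *: w (s, s', s'')).
  split=> [y z|x z|x y].
  - exact: linear_comb.
  - by apply: linear_sum_fun => s; exact: linear_comb.
  - apply: linear_sum_fun => s; apply: linear_sum_fun => s'; exact: linear_comb.
move=> x y z; rewrite (coE x) (coE' y) (coE'' z).
have ld : linear (dga_d ed : A l -> A m) by move=> a u v; exact: linearP.
rewrite (linear_apply_sum _ _ (R1 _ _)) -(coE x) (linear_apply_sum _ _ ld).
apply: eq_bigr => s _; congr (_ *: _).
rewrite (linear_apply_sum _ _ (R2 _ _)) -(coE' y) (linear_apply_sum _ _ ld).
apply: eq_bigr => s' _; congr (_ *: _).
rewrite (linear_apply_sum _ _ (R3 _ _)) -(coE'' z) (linear_apply_sum _ _ ld).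
by apply: eq_bigr => s'' _; rewrite wE.
Qed.

Variables (chi : 'I_d -> A z1) (co : 'I_d -> A z1 -> F) (t : A z2) (tau : H z2 -> F).
Hypothesis dchi : forall i, dga_d (erefl (z1 + 1)) (chi i) = 0.
Hypothesis co_linear : forall i a x y, co i (a *: x + y) = a * co i x + co i y.
Hypothesis co_chi : forall i j, co i (chi j) = (i == j)%:R.
Hypothesis co_span : forall z : A z1, dga_d (erefl (z1 + 1)) z = 0 ->
  z = \sum_i co i z *: chi i.
Hypothesis dt : dga_d (erefl (z2 + 1)) t = 0.
Hypothesis tau_linear : forall a x y, tau (a *: x + y) = a * tau x + tau y.
Hypothesis tau_inj : forall x, tau x = 0 -> x = 0.
Hypothesis tau_t : tau (cohomology_class dt) = 1.
Hypothesis acyclic : forall n : int, 3 <= n -> forall z : A n,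
  dga_d (erefl (n + 1)) z = 0 ->
  exists (m : int) (e : m + 1 = n) (w : A m), dga_d e w = z.

Definition cohomology_rep n (x : H n) : A n := val (generic_quotient.repr x).

Lemma d_cohomology_rep n (x : H n) : dga_d (erefl (n + 1)) (cohomology_rep x) = 0.
Proof. exact/eqP/(valP (generic_quotient.repr x)). Qed.

Lemma cohomology_class_rep n (x : H n) : cohomology_class (d_cohomology_rep x) = x.
Proof. by rewrite -[RHS]generic_quotient.reprK; congr (\pi_ _ _); exact: val_inj. Qed.

Lemma d_one : dga_d (erefl (Posz 0 + 1)) (dga_one A) = 0.
Proof.
have := dga_leibniz (erefl (Posz 0 + 0)) erefl erefl (erefl (Posz 0 + 1)) erefl erefl
  (dga_one A) (dga_one A).
rewrite !dga_mul1l dga_mul1r expr0z scale1r => /esym/eqP.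
by rewrite -subr_eq0 addrK => /eqP.
Qed.

Lemma d_oneE n (e : Posz 0 + 1 = n) : dga_d e (dga_one A) = 0.
Proof. by case: n / e; exact: d_one. Qed.

Lemma degree0 (x : A (Posz 0)) : exists a, x = a *: dga_one A.
Proof. by have [k _ kK] := cdga_deg0 A; exists (k x); rewrite kK. Qed.

(** The representative is unique: a coboundary of degree at most 1 is 0, because [A 0] consists of
    the multiples of the unit, whose differential vanishes. *)
Lemma cohomology_rep_class n (x : A n) (dx : dga_d (erefl (n + 1)) x = 0) : n <= 1 ->
  cohomology_rep (cohomology_class dx) = x.
Proof.
move=> n1; have := cohomology_class_rep (cohomology_class dx).
move=> /cohomology_class_eq[m [e [w dw]]].
have dw0 : dga_d e w = 0.
  have [m0|] := ltP m 0; first by rewrite (cdga_neg m0 w) linear0.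
  case: m e w {dw} => // -[|m] e w _; last by lia.
  by have [a ->] := degree0 w; rewrite linearZ /= d_oneE scaler0.
by apply/eqP; rewrite -subr_eq0 -dw dw0.
Qed.

Lemma cohomology_rep_linear n : n <= 1 -> linear (@cohomology_rep n).
Proof.
move=> n1 a x y; rewrite -{1}(cohomology_class_rep x) -{1}(cohomology_class_rep y).
have dz : dga_d (erefl (n + 1)) (a *: cohomology_rep x + cohomology_rep y) = 0.
  by rewrite linearP /= !d_cohomology_rep scaler0 addr0.
by rewrite (cohomology_class_linear _ _ dz erefl) cohomology_rep_class.
Qed.

Lemma d_zero n : dga_d (erefl (n + 1)) (0 : A n) = 0.
Proof. exact: linear0. Qed.

Lemma cohomology_class0 n : cohomology_class (d_zero n) = 0.
Proof.
have <- := cohomology_class_linear (d_zero n) (d_zero n) (d_zero n) (etrans (addr0 _) (scaler0 _ (-1))).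
by rewrite scaleN1r addNr.
Qed.

Lemma tau0 : tau 0 = 0.
Proof. by have := tau_linear (-1) 0 0; rewrite scaler0 addr0 mulN1r addNr. Qed.

Lemma tauZ a x : tau (a *: x) = a * tau x.
Proof. by have := tau_linear a x 0; rewrite !addr0 tau0 addr0. Qed.

Lemma tau_eq x y : tau x = tau y -> x = y.
Proof.
move=> e; apply/eqP; rewrite -subr_eq0; apply/eqP/tau_inj.
by rewrite -scaleN1r addrC tau_linear e mulN1r addNr.
Qed.

Lemma cohomology_trivial n : (n < 0) || (3 <= n) -> forall x : H n, x = 0.
Proof.
move=> n_out; apply: cohomology_ind => x dx.
rewrite -cohomology_class0.
  apply/cohomology_class_eq; rewrite subr0.
  have [n0|n0] := ltP n 0; last first.
    by apply: acyclic dx; move: n_out; rewrite ltNge n0.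
  exists (n - 1), (subrK 1 n), 0.
  by rewrite linear0 (cdga_neg n0 x).
Qed.

(** In degree 2 the multiples of [t] replace the chosen representatives, which need not depend
    linearly on the class. *)
Definition formal1 (n : int) : H n -> A n :=
  match n return H n -> A n with
  | Posz 0 => @cohomology_rep (Posz 0)
  | Posz 1 => @cohomology_rep z1
  | Posz 2 => fun x => tau x *: t
  | _ => fun=> 0
  end.

Lemma formal1_linear n : linear (@formal1 n).
Proof.
case: n => [[|[|[|n]]]|n] /=; try exact: cohomology_rep_linear;
  move=> a x y; rewrite ?scaler0 ?addr0 //.
by rewrite tau_linear scalerDl scalerA.
Qed.

Lemma d_formal1 n (x : H n) : dga_d (erefl (n + 1)) (formal1 x) = 0.
Proof.
case: n x => [[|[|[|n]]]|n] x /=; try exact: d_cohomology_rep; try exact: linear0.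
by rewrite linearZ /= dt scaler0.
Qed.

Lemma class_formal1 n (x : H n) : cohomology_class (d_formal1 x) = x.
Proof.
have class_eq (y : A n) (dy : dga_d (erefl (n + 1)) y = 0) :
    formal1 x = y -> cohomology_class (d_formal1 x) = cohomology_class dy.
  move=> e; apply/cohomology_class_eq; exists (n - 1), (subrK 1 n), 0.
  by rewrite linear0 e subrr.
case: n x class_eq => [[|[|[|n]]]|n] x ce.
- by rewrite (ce _ (d_cohomology_rep x)) ?cohomology_class_rep.
- by rewrite (ce _ (d_cohomology_rep x)) ?cohomology_class_rep.
- have dz : dga_d (erefl (z2 + 1)) (tau x *: t + 0) = 0.
    by rewrite addr0 linearZ /= dt scaler0.
  rewrite (ce _ dz) /= ?addr0 // -(cohomology_class_linear dt (d_zero _) dz erefl).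
  by apply: tau_eq; rewrite cohomology_class0 addr0 tauZ tau_t mulr1.
- by rewrite [LHS]cohomology_trivial ?[RHS]cohomology_trivial.
- by rewrite [LHS]cohomology_trivial ?[RHS]cohomology_trivial.
Qed.

Definition coord1 i (x : H z1) := co i (cohomology_rep x).
Definition chiH i : H z1 := cohomology_class (dchi i).

Lemma coord1_linear i a x y : coord1 i (a *: x + y) = a * coord1 i x + coord1 i y.
Proof. by rewrite /coord1 cohomology_rep_linear. Qed.

Lemma coord1_chiH i j : coord1 i (chiH j) = (i == j)%:R.
Proof. by rewrite /coord1 cohomology_rep_class. Qed.

Lemma chiH_span x : x = \sum_i coord1 i x *: chiH i.
Proof.
have rep_inj : injective (@cohomology_rep z1).
  by move=> u v e; rewrite -(cohomology_class_rep u) -(cohomology_class_rep v); apply/cohomology_class_eq;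
     exists (Posz 0), erefl, 0; rewrite linear0 e subrr.
apply: rep_inj; rewrite (@linear_apply_sum F (H z1) (A z1) _ (@cohomology_rep z1) (coord1^~ x) chiH (@cohomology_rep_linear z1 isT)).
rewrite [LHS]co_span; last exact: d_cohomology_rep.
by apply: eq_bigr => i _; rewrite cohomology_rep_class.
Qed.

Lemma t_span x : x = tau x *: cohomology_class dt.
Proof. by apply: tau_eq; rewrite tauZ tau_t mulr1. Qed.

Lemma unit_span (x : H (Posz 0)) : exists a, x = a *: cohomology_class d_one /\
  formal1 x = a *: dga_one A.
Proof.
have [a e] := degree0 (cohomology_rep x); exists a; split=> //=.
rewrite -{1}(cohomology_class_rep x).
have da : dga_d (erefl (Posz 0 + 1)) (a *: dga_one A + 0) = 0.
  by rewrite addr0 linearZ /= d_one scaler0.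
rewrite -[RHS]addr0 -cohomology_class0 (cohomology_class_linear _ _ da erefl).
by apply/cohomology_class_eq; exists (- 1), erefl, 0; rewrite linear0 e addr0 subrr.
Qed.

Lemma coordinates_cohomology n : coordinates n.
Proof.
have triv : (n < 0) || (3 <= n) -> coordinates n.
  move=> n_out; exists 0%N, (fun=> 0), (fun _ _ => 0); split; first by case.
  by move=> x; rewrite big_ord0; exact: cohomology_trivial.
case: n triv => [[|[|[|n]]]|n] triv; try exact: triv.
- have [k kK Kk] := cdga_deg0 A.
  exists 1%N, (fun=> cohomology_class d_one), (fun _ x => k (cohomology_rep x)); split.
    move=> _ a u v; apply: (can_inj kK); rewrite /= Kk cohomology_rep_linear //.
    by rewrite scalerDl -scalerA !Kk.
  move=> x; rewrite big_ord1; have [a [xE rE]] := unit_span x.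
  by rewrite {1}xE; congr (_ *: _); rewrite -[cohomology_rep x]/(formal1 x) rE kK.
- by exists d, chiH, coord1; split; [exact: coord1_linear|exact: chiH_span].
- exists 1%N, (fun=> cohomology_class dt), (fun=> tau).
  by split=> [_|x]; [exact: tau_linear|rewrite big_ord1 -t_span].
Qed.

Variable c : 'I_d -> 'I_d -> F.
Variables (F2 : 'I_d -> 'I_d -> A z1) (g h : 'I_d -> A z2) (F3 : 'I_d -> 'I_d -> 'I_d -> A z1).
Hypothesis dF2 : forall i j, dga_d (erefl : z1 + 1 = z2) (F2 i j) =
  c i j *: t - dga_mul (erefl : z1 + z1 = z2) (chi i) (chi j).
Hypothesis dg : forall k, dga_d (erefl : z2 + 1 = Posz 3) (g k) =
  - dga_mul (erefl : z2 + z1 = Posz 3) t (chi k).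
Hypothesis dh : forall i, dga_d (erefl : z2 + 1 = Posz 3) (h i) =
  - dga_mul (erefl : z1 + z2 = Posz 3) (chi i) t.
Hypothesis dF3 : forall i j k, dga_d (erefl : z1 + 1 = z2) (F3 i j k) =
  c i j *: g k - c j k *: h i +
  dga_mul (erefl : z1 + z1 = z2) (chi i) (F2 j k) +
  dga_mul (erefl : z1 + z1 = z2) (F2 i j) (chi k).

(** [dF2] exhibits [chi i chi j] as cohomologous to [c i j] times [t]. *)
Lemma tau_chi i j : tau (cohomology_mul (erefl : z1 + z1 = z2) (chiH i) (chiH j)) = c i j.
Proof.
have dct : dga_d (erefl (z2 + 1)) (c i j *: t + 0) = 0.
  by rewrite addr0 linearZ /= dt scaler0.
have dcc : dga_d (erefl (z2 + 1)) (dga_mul (erefl : z1 + z1 = z2) (chi i) (chi j)) = 0.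
  have := dga_dd (erefl : z1 + 1 = z2) (erefl (z2 + 1)) (F2 i j).
  by rewrite dF2 linearB linearZ /= dt scaler0 sub0r => /eqP; rewrite oppr_eq0 => /eqP.
rewrite (cohomology_class_mul _ _ dcc erefl).
transitivity (tau (cohomology_class dct)).
  congr tau; apply/esym/cohomology_class_eq; exists z1, erefl, (F2 i j).
  by rewrite dF2 addr0.
by rewrite -(cohomology_class_linear dt (d_zero _) dct erefl) cohomology_class0 addr0 tauZ tau_t mulr1.
Qed.

Variable b : A (Posz 3).
Hypothesis db : dga_d (erefl : Posz 3 + 1 = Posz 4) b =
  - dga_mul (erefl : z2 + z2 = Posz 4) t t.

(** [F2], [h], [g] and [b] are the values on basis classes of degrees (1, 1), (1, 2), (2, 1) and (2,
    2); the value is 0 on units and in the degrees where the cohomology vanishes. *)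
Definition formal2 (i j n : int) : i + j = n + 1 -> H i -> H j -> A n :=
  match i as i0, j as j0, n as n0 return i0 + j0 = n0 + 1 -> H i0 -> H j0 -> A n0 with
  | Posz 1, Posz 1, Posz 1 => fun _ x y => \sum_k coord1 k x *: \sum_l coord1 l y *: F2 k l
  | Posz 1, Posz 2, Posz 2 => fun _ x y => \sum_k coord1 k x *: (tau y *: h k)
  | Posz 2, Posz 1, Posz 2 => fun _ x y => tau x *: \sum_k coord1 k y *: g k
  | Posz 2, Posz 2, Posz 3 => fun _ x y => tau x *: (tau y *: b)
  | _, _, _ => fun _ _ _ => 0
  end.

Lemma tau_linear_scale n (w : A n) : linear (fun x => tau x *: w).
Proof. by move=> a u v; rewrite tau_linear scalerDl scalerA. Qed.

Lemma formal2_linear1 i j n (e : i + j = n + 1) y : linear (fun x => @formal2 i j n e x y).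
Proof.
case: i e => [[|[|[|i]]]|i]; case: j y => [[|[|[|j]]]|j] y; case: n => [[|[|[|[|n]]]]|n] e /=;
  try exact: linear_zero; try (apply: linear_comb; exact: coord1_linear); exact: tau_linear_scale.
Qed.

Lemma formal2_linear2 i j n (e : i + j = n + 1) x : linear (fun y => @formal2 i j n e x y).
Proof.
case: i x e => [[|[|[|i]]]|i] x; case: j => [[|[|[|j]]]|j]; case: n => [[|[|[|[|n]]]]|n] e /=;
  try exact: linear_zero.
- apply: linear_sum_fun => k; apply: linear_comb; exact: coord1_linear.
- apply: linear_sum_fun => k; exact: tau_linear_scale.
- apply: linear_scale; apply: linear_comb; exact: coord1_linear.
- apply: linear_scale; exact: tau_linear_scale.
Qed.

Lemma mul_linearl i j n (e : i + j = n) (y : A j) : linear (fun x : A i => dga_mul e x y).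
Proof. exact: dga_mul_linearl. Qed.

Lemma mul_linearr i j n (e : i + j = n) (x : A i) : linear (fun y : A j => dga_mul e x y).
Proof. exact: dga_mul_linearr. Qed.

(** The differential prescribed for [formal2]. *)
Definition obstruction2 i j n (e : i + j = n) (x : H i) (y : H j) : A n :=
  formal1 (cohomology_mul e x y) - dga_mul e (formal1 x) (formal1 y).

Lemma obstruction2_linear1 i j n (e : i + j = n) y : linear (fun x => obstruction2 e x y).
Proof.
apply: linear_add; last apply: linear_opp.
  exact: (linear_after (cohomology_mul_linearl e y) (@formal1_linear n)).
exact: (linear_after (@formal1_linear i) (mul_linearl e (formal1 y))).
Qed.

Lemma obstruction2_linear2 i j n (e : i + j = n) x : linear (fun y => obstruction2 e x y).
Proof.
apply: linear_add; last apply: linear_opp.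
  exact: (linear_after (cohomology_mul_linearr e x) (@formal1_linear n)).
exact: (linear_after (@formal1_linear j) (mul_linearr e (formal1 x))).
Qed.

Lemma formal1_chiH i : formal1 (chiH i) = chi i.
Proof. by rewrite /= cohomology_rep_class. Qed.

Lemma unit_mull j (e : Posz 0 + j = j) (x : H (Posz 0)) : exists2 a,
  formal1 x = a *: dga_one A & forall y, cohomology_mul e x y = a *: y.
Proof.
have [a [xE fx]] := unit_span x; exists a => // y.
rewrite xE (linear_funZ (cohomology_mul_linearl e y)); congr (_ *: _).
move: y; apply: cohomology_ind => y dy.
by apply: cohomology_class_mul; exact: dga_mul1l.
Qed.

Lemma unit_mulr j (e : j + Posz 0 = j) (x : H (Posz 0)) : exists2 a,
  formal1 x = a *: dga_one A & forall y, cohomology_mul e y x = a *: y.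
Proof.
have [a [xE fx]] := unit_span x; exists a => // y.
rewrite xE (linear_funZ (cohomology_mul_linearr e y)); congr (_ *: _).
move: y; apply: cohomology_ind => y dy.
by apply: cohomology_class_mul; exact: dga_mul1r.
Qed.

Lemma obstruction2_unitl j n (e : Posz 0 + j = n) x y : obstruction2 e x y = 0.
Proof.
have jn : j = n by rewrite -e add0r.
subst j; rewrite /obstruction2; have [a -> ->] := unit_mull e x.
rewrite (linear_funZ (@formal1_linear n)) (linear_funZ (mul_linearl e _)).
by rewrite dga_mul1l subrr.
Qed.

Lemma obstruction2_unitr i n (e : i + Posz 0 = n) x y : obstruction2 e x y = 0.
Proof.
have jn : i = n by rewrite -e addr0.
subst i; rewrite /obstruction2; have [a -> ->] := unit_mulr e y.
rewrite (linear_funZ (@formal1_linear n)) (linear_funZ (mul_linearr e _)).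
by rewrite dga_mul1r subrr.
Qed.

Lemma formal2E i j m n (e : i + j = n) (e' : i + j = m + 1) (ed : m + 1 = n) (x : H i) (y : H j) :
  dga_d ed (formal2 e' x y) = obstruction2 e x y.
Proof.
have trivl : (i < 0) || (3 <= i) -> dga_d ed (formal2 e' x y) = obstruction2 e x y.
  move=> i_out; rewrite (cohomology_trivial i_out x).
  rewrite (linear_fun0 (obstruction2_linear1 e y)).
  by rewrite (linear_fun0 (formal2_linear1 e' y)) linear0.
have trivr : (j < 0) || (3 <= j) -> dga_d ed (formal2 e' x y) = obstruction2 e x y.
  move=> j_out; rewrite (cohomology_trivial j_out y).
  rewrite (linear_fun0 (obstruction2_linear2 e x)).
  by rewrite (linear_fun0 (formal2_linear2 e' x)) linear0.
have ld l k (e0 : l + 1 = k) : linear (dga_d e0 : A l -> A k).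
  by move=> a u v; exact: linearP.
case: i x e e' trivl trivr => [[|[|[|i]]]|i] x e e' trivl trivr; try exact: trivl;
  first by rewrite obstruction2_unitl; exact: linear0.
- case: j y e e' trivl trivr => [[|[|[|j]]]|j] y e e' trivl trivr; try exact: trivr.
  + rewrite obstruction2_unitr [formal2 _ _ _](_ : _ = 0) ?linear0 //.
  + have em : m = z1 by lia.
    subst m; case: n / e ed trivl trivr => ed _ _; rewrite (eq_irrelevance ed erefl) /=.
    rewrite (linear_apply_sum _ _ (ld _ _ erefl)).
    rewrite (chiH_span x) (linear_apply_sum _ _ (obstruction2_linear1 _ y)) -(chiH_span x).
    apply: eq_bigr => k _; congr (_ *: _); rewrite (linear_apply_sum _ _ (ld _ _ erefl)).
    rewrite (chiH_span y) (linear_apply_sum _ _ (obstruction2_linear2 _ _)) -(chiH_span y).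
    apply: eq_bigr => l _; congr (_ *: _).
    by rewrite /obstruction2 !formal1_chiH dF2 /= tau_chi.
  + have em : m = z2 by lia.
    subst m; case: n / e ed trivl trivr => ed _ _; rewrite (eq_irrelevance ed erefl) /=.
    rewrite (linear_apply_sum _ _ (ld _ _ erefl)).
    rewrite (chiH_span x) (linear_apply_sum _ _ (obstruction2_linear1 _ y)) -(chiH_span x).
    apply: eq_bigr => k _; congr (_ *: _); rewrite (linear_funZ (ld _ _ erefl)) dh.
    rewrite /obstruction2 formal1_chiH /= sub0r scalerN; congr (- _).
    by rewrite (linear_funZ (mul_linearr _ _)).
- case: j y e e' trivl trivr => [[|[|[|j]]]|j] y e e' trivl trivr; try exact: trivr.
  + rewrite obstruction2_unitr [formal2 _ _ _](_ : _ = 0) ?linear0 //.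
  + have em : m = z2 by lia.
    subst m; case: n / e ed trivl trivr => ed _ _; rewrite (eq_irrelevance ed erefl) /=.
    rewrite (linear_funZ (ld _ _ erefl)) (linear_apply_sum _ _ (ld _ _ erefl)).
    rewrite {2}(t_span x) (linear_funZ (obstruction2_linear1 _ y)); congr (_ *: _).
    rewrite (chiH_span y) (linear_apply_sum _ _ (obstruction2_linear2 _ _)) -(chiH_span y).
    apply: eq_bigr => k _; congr (_ *: _).
    by rewrite dg /obstruction2 formal1_chiH /= sub0r tau_t scale1r.
  + have em : m = Posz 3 by lia.
    subst m; case: n / e ed trivl trivr => ed _ _; rewrite (eq_irrelevance ed erefl) /=.
    rewrite !(linear_funZ (ld _ _ erefl)).
    rewrite {2}(t_span x) (linear_funZ (obstruction2_linear1 _ y)); congr (_ *: _).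
    rewrite {2}(t_span y) (linear_funZ (obstruction2_linear2 _ _)); congr (_ *: _).
    by rewrite db /obstruction2 /= sub0r tau_t !scale1r.
Qed.

Section Obstruction3.
Variables (i j k ij jk a' b' m : int).
Hypotheses (eij : i + j = ij) (ejk : j + k = jk) (ea : i + j = a' + 1) (eb : j + k = b' + 1).
Hypotheses (eib : i + b' = m) (eak : a' + k = m).
Hypotheses (eijk : ij + k = m + 1) (eijk' : i + jk = m + 1).

(** The differential prescribed for [f3], with all other terms of its equation moved to one side. *)
Definition obstruction3 (x : H i) (y : H j) (z : H k) : A m :=
  formal2 eijk (cohomology_mul eij x y) z - formal2 eijk' x (cohomology_mul ejk y z)
  - (-1) ^ i *: dga_mul eib (formal1 x) (formal2 eb y z) + dga_mul eak (formal2 ea x y) (formal1 z).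

Lemma obstruction3_trilinear : trilinear obstruction3.
Proof.
split=> [y z|x z|x y]; apply: linear_add; try apply: linear_add; try apply: linear_add;
  try apply: linear_opp; try apply: linear_scale.
- exact: (linear_after (cohomology_mul_linearl eij y) (formal2_linear1 eijk z)).
- exact: formal2_linear1.
- exact: (linear_after (@formal1_linear i) (mul_linearl eib _)).
- exact: (linear_after (formal2_linear1 ea y) (mul_linearl eak _)).
- exact: (linear_after (cohomology_mul_linearr eij x) (formal2_linear1 eijk z)).
- exact: (linear_after (cohomology_mul_linearl ejk z) (formal2_linear2 eijk' x)).
- exact: (linear_after (formal2_linear1 eb z) (mul_linearr eib _)).
- exact: (linear_after (formal2_linear2 ea x) (mul_linearl eak _)).
- exact: formal2_linear2.
- exact: (linear_after (cohomology_mul_linearr ejk y) (formal2_linear2 eijk' x)).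
- exact: (linear_after (formal2_linear2 eb y) (mul_linearr eib _)).
- exact: (linear_after (@formal1_linear k) (mul_linearr eak _)).
Qed.

(** After substituting [formal2E], the terms cancel in pairs by associativity in [A] and in its
    cohomology. *)
Lemma obstruction3_cocycle x y z : dga_d (erefl (m + 1)) (obstruction3 x y z) = 0.
Proof.
have d1 n n' (e : n + 1 = n') (u : H n) : dga_d e (formal1 u) = 0.
  by case: n' / e; exact: d_formal1.
have eb1 : b' + 1 = jk by rewrite -eb.
have ea1 : a' + 1 = ij by rewrite -ea.
have el1 : (i + 1) + b' = m + 1 by rewrite -eib addrAC.
have er2 : a' + (k + 1) = m + 1 by rewrite -eak addrA.
rewrite /obstruction3 linearD !linearB linearZ /=.
rewrite (formal2E eijk eijk) (formal2E eijk' eijk').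
rewrite (dga_leibniz eib erefl eb1 erefl el1 eijk') d1 dga_mul0l add0r.
rewrite scalerA -expfzMl mulrNN mulr1 exp1rz scale1r.
rewrite (dga_leibniz eak ea1 erefl erefl eijk er2) d1 dga_mul0r scaler0 addr0.
rewrite (formal2E ejk eb) (formal2E eij ea) /obstruction2.
rewrite dga_mulBr dga_mulBl (dga_mulA eij ejk eijk eijk') (cohomology_mulA eij ejk eijk eijk').
rewrite !(opprD, opprK) !addrA.
by rewrite [LHS](ACl ((1*3)*(2*7)*(4*5)*(6*8))) /= !(addNr, addrN) !addr0.
Qed.

End Obstruction3.

Lemma formal2_unitl j n (e : Posz 0 + j = n + 1) x y : formal2 e x y = 0.
Proof. by []. Qed.

Lemma formal2_unitr i n (e : i + Posz 0 = n + 1) x y : formal2 e x y = 0.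
Proof. by case: i e x => [[|[|[|i]]]|i] e x; case: n e => [[|[|[|[|n]]]]|n]. Qed.

(** [formal1] is compatible with multiplication by units and [formal2] vanishes on them; the two
    surviving terms, if any, are equal with opposite signs. *)
Lemma obstruction3_unit i j k ij jk a' b' m eij ejk ea eb eib eak eijk eijk' x y z :
  [|| i == 0, j == 0 | k == 0] ->
  @obstruction3 i j k ij jk a' b' m eij ejk ea eb eib eak eijk eijk' x y z = 0.
Proof.
rewrite /obstruction3; case/or3P => /eqP e0.
- subst i; have e1 : ij = j by rewrite -eij add0r.
  move: eij eijk; rewrite e1 => eij eijk.
  have e2 : b' = m by rewrite -eib add0r.
  move: eb eib; rewrite e2 => eb eib; have [a fx xE] := unit_mull eij x.
  rewrite !formal2_unitl subr0 dga_mul0l addr0 xE fx expr0z scale1r.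
  rewrite (linear_funZ (formal2_linear1 _ _)) (linear_funZ (mul_linearl _ _)) dga_mul1l.
  by rewrite (eq_irrelevance eijk eb) subrr.
- subst j; have e1 : ij = i by rewrite -eij addr0.
  move: eij eijk; rewrite e1 => eij eijk.
  have e2 : jk = k by rewrite -ejk add0r.
  move: ejk eijk'; rewrite e2 => ejk eijk'.
  rewrite formal2_unitl formal2_unitr dga_mul0l dga_mul0r scaler0 subr0 addr0.
  have [a1 [yE _]] := unit_span y.
  rewrite yE (linear_funZ (cohomology_mul_linearr eij x)).
  rewrite (linear_funZ (cohomology_mul_linearl ejk z)).
  have -> : cohomology_mul eij x (cohomology_class d_one) = x.
    by move: x; apply: cohomology_ind => u du; apply: cohomology_class_mul; exact: dga_mul1r.
  have -> : cohomology_mul ejk (cohomology_class d_one) z = z.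
    by move: z; apply: cohomology_ind => u du; apply: cohomology_class_mul; exact: dga_mul1l.
  rewrite (linear_funZ (formal2_linear1 _ _)) (linear_funZ (formal2_linear2 _ _)).
  by rewrite (eq_irrelevance eijk eijk') subrr.
- subst k; have e1 : jk = j by rewrite -ejk addr0.
  move: ejk eijk'; rewrite e1 => ejk eijk'.
  have e2 : a' = m by rewrite -eak addr0.
  move: ea eak; rewrite e2 => ea eak; have [a fz zE] := unit_mulr ejk z.
  rewrite !formal2_unitr sub0r dga_mul0r scaler0 subr0 zE fz.
  rewrite (linear_funZ (formal2_linear2 _ _)) (linear_funZ (mul_linearr _ _)) dga_mul1r.
  by rewrite (eq_irrelevance eijk' ea) addNr.
Qed.

Lemma obstruction3_chi l (ed : l + 1 = z2) eij ejk ea eb eib eak eijk eijk' x y z :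
  exists w : A l, dga_d ed w =
    @obstruction3 z1 z1 z1 z2 z2 z1 z1 z2 eij ejk ea eb eib eak eijk eijk' x y z.
Proof.
have el : l = z1 by lia.
subst l; rewrite (eq_irrelevance ed erefl) (eq_irrelevance eij erefl) (eq_irrelevance ejk erefl)
  (eq_irrelevance eib erefl) (eq_irrelevance eak erefl).
have ld n k (e0 : n + 1 = k) : linear (dga_d e0 : A n -> A k).
  by move=> a u v; exact: linearP.
exists (\sum_i coord1 i x *: \sum_j coord1 j y *: \sum_k coord1 k z *: F3 i j k).
have [O1 O2 O3] := @obstruction3_trilinear z1 z1 z1 z2 z2 z1 z1 z2 erefl erefl ea eb
  erefl erefl eijk eijk'.
rewrite (chiH_span x) (linear_apply_sum _ _ (O1 _ _)) -(chiH_span x).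
rewrite (linear_apply_sum _ _ (ld _ _ erefl)); apply: eq_bigr => i _; congr (_ *: _).
rewrite (chiH_span y) (linear_apply_sum _ _ (O2 _ _)) -(chiH_span y).
rewrite (linear_apply_sum _ _ (ld _ _ erefl)); apply: eq_bigr => j _; congr (_ *: _).
rewrite (chiH_span z) (linear_apply_sum _ _ (O3 _ _)) -(chiH_span z).
rewrite (linear_apply_sum _ _ (ld _ _ erefl)); apply: eq_bigr => k _; congr (_ *: _).
have f2_chi u v (e : z1 + z1 = z1 + 1) : formal2 e (chiH u) (chiH v) = F2 u v.
  rewrite /= (bigD1 u) //= coord1_chiH eqxx scale1r (bigD1 v) //= coord1_chiH eqxx scale1r.
  rewrite big1 ?addr0 => [|w wv]; last by rewrite coord1_chiH (negPf wv) scale0r.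
  by rewrite big1 ?addr0 => [|w wu] //; rewrite coord1_chiH (negPf wu) scale0r.
have f2_t u v (e : z2 + z1 = z2 + 1) : formal2 e u (chiH v) = tau u *: g v.
  rewrite /= (bigD1 v) //= coord1_chiH eqxx scale1r big1 ?addr0 // => w wv.
  by rewrite coord1_chiH (negPf wv) scale0r.
have f2_t' u v (e : z1 + z2 = z2 + 1) : formal2 e (chiH u) v = tau v *: h u.
  rewrite /= (bigD1 u) //= coord1_chiH eqxx scale1r big1 ?addr0 // => w wu.
  by rewrite coord1_chiH (negPf wu) scale0r.
rewrite /obstruction3 !f2_chi f2_t f2_t' !tau_chi !formal1_chiH dF3.
by rewrite expr1z scaleN1r opprK.
Qed.

Lemma obstruction3_degree1 i j k l ij jk a' b' m eij ejk ea eb eib eak eijk eijk'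
    (ed : l + 1 = m) x y z : i = z1 -> j = z1 -> k = z1 ->
  exists w : A l, dga_d ed w =
    @obstruction3 i j k ij jk a' b' m eij ejk ea eb eib eak eijk eijk' x y z.
Proof.
move=> i1 j1 k1; subst i j k.
have e1 : ij = z2 by rewrite -eij.
have e2 : jk = z2 by rewrite -ejk.
have e3 : a' = z1 by lia.
have e4 : b' = z1 by lia.
have e5 : m = z2 by lia.
move: ed eij ejk ea eb eib eak eijk eijk'; rewrite e1 e2 e3 e4 e5 => *.
exact: obstruction3_chi.
Qed.

(** The obstruction has degree [m = i + j + k - 1]. If [m >= 3] it bounds by acyclicity. Otherwise
    an argument is 0 or a unit, or all three have degree 1, where [F3] provides the primitive. *)
Lemma formal3_exists i j k l : i + j + k = l + 2 ->
  exists Phi : H i -> H j -> H k -> A l, trilinear Phi /\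
  forall ij jk a' b' m (ed : l + 1 = m) eij ejk ea eb eib eak eijk eijk' x y z,
    dga_d ed (Phi x y z) =
    @obstruction3 i j k ij jk a' b' m eij ejk ea eb eib eak eijk eijk' x y z.
Proof.
move=> e; pose m := l + 1; pose a' := i + j - 1; pose b' := j + k - 1.
have ea : i + j = a' + 1 by rewrite /a' subrK.
have eb : j + k = b' + 1 by rewrite /b' subrK.
have eib : i + b' = m by rewrite /m /b'; lia.
have eak : a' + k = m by rewrite /m /a'; lia.
have eijk : (i + j) + k = m + 1 by rewrite /m; lia.
have eijk' : i + (j + k) = m + 1 by rewrite /m; lia.
pose O := @obstruction3 i j k _ _ a' b' m erefl erefl ea eb eib eak eijk eijk'.
have OT : trilinear O by exact: obstruction3_trilinear.
have [x y z|Phi PhiT PhiE] := @trilinear_lift i j k l m erefl O coordinates_cohomology OT.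
  have O0 : O x y z = 0 -> exists w : A l, dga_d (erefl : l + 1 = m) w = O x y z.
    by move=> ->; exists 0; rewrite linear0.
  have [O1 O2 O3] := OT.
  have [m3|m3] := lerP 3 m.
    have [m' [e' [w wE]]] := acyclic m3 (obstruction3_cocycle erefl erefl ea eb eib eak eijk eijk' x y z).
    have em : m' = l by apply: (addIr 1); rewrite e'.
    by subst m'; exists w; rewrite (eq_irrelevance erefl e').
  have [i_out|i_in] := boolP ((i < 0) || (3 <= i)).
    by apply: O0; rewrite (cohomology_trivial i_out x) (linear_fun0 (O1 _ _)).
  have [j_out|j_in] := boolP ((j < 0) || (3 <= j)).
    by apply: O0; rewrite (cohomology_trivial j_out y) (linear_fun0 (O2 _ _)).
  have [k_out|k_in] := boolP ((k < 0) || (3 <= k)).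
    by apply: O0; rewrite (cohomology_trivial k_out z) (linear_fun0 (O3 _ _)).
  have [u|nu] := boolP [|| i == 0, j == 0 | k == 0].
    by apply: O0; exact: obstruction3_unit.
  have i1 : i = z1 by move: m3; rewrite /m; lia.
  have j1 : j = z1 by move: m3; rewrite /m; lia.
  have k1 : k = z1 by move: m3; rewrite /m; lia.
  exact: obstruction3_degree1.
exists Phi; split=> // ij jk a1 b1 m1 ed eij ejk ea1 eb1 eib1 eak1 eijk1 eijk1' x y z.
have e1 : a1 = a' by apply: (addIr 1); rewrite -ea1 ea.
have e2 : b1 = b' by apply: (addIr 1); rewrite -eb1 eb.
subst ij jk m1 a1 b1; rewrite PhiE /O.
congr obstruction3; exact: eq_irrelevance.
Qed.

Lemma A3_formal_of_homotopies : A3_formal A.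
Proof.
have [f3 f3P] : exists f3 : forall i j k n : int, i + j + k = n + 2 -> H i -> H j -> H k -> A n,
    forall i j k n (e : i + j + k = n + 2), trilinear (f3 i j k n e) /\
    forall ij jk a' b' m (ed : n + 1 = m) eij ejk ea eb eib eak eijk eijk' x y z,
    dga_d ed (f3 i j k n e x y z) =
    @obstruction3 i j k ij jk a' b' m eij ejk ea eb eib eak eijk eijk' x y z.
  exists (fun i j k n e => projT1 (cid (formal3_exists e))) => i j k n e.
  exact: projT2 (cid (formal3_exists e)).
apply: inhabits; apply: (@A3Formality F A formal1 formal2 f3 formal1_linear formal2_linear1 formal2_linear2 _ _ _ d_formal1).
- by move=> i j k n e y z; have [[]] := f3P i j k n e.
- by move=> i j k n e x z; have [[]] := f3P i j k n e.
- by move=> i j k n e x y; have [[]] := f3P i j k n e.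
- by move=> n; exists id => x; exact: class_formal1.
- by move=> i j m n e e' ed x y; exact: formal2E.
- move=> i j k ij jk a' b' l m eij ejk ea eb el ed eib eak eijk eijk' x y z.
  have [_ f3E] := f3P i j k l el.
  rewrite (f3E _ _ _ _ _ ed eij ejk ea eb eib eak eijk eijk').
  rewrite /obstruction3; set u := formal2 eijk _ _; set v := formal2 eijk' _ _.
  by rewrite addrAC addrK subrK.
Qed.

End Assembly.

(** * Demushkin groups *)

Section LowDegree.
Local Open Scope ring_scope.
Variables (p : nat) (G : topGroupType).
Local Notation A := (cochains p G).
Local Notation z1 := (Posz 1).
Local Notation z2 := (Posz 2).

Lemma locally_constant_cochain (m : nat) (z : cart_power G m -> ('F_p)^o) :
  locally_constant z -> z \in @is_cochain p G (Posz m).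
Proof.
by move=> zc; rewrite unfold_in; apply/asboolP; split=> //; exact/locally_constP.
Qed.

Lemma cochain1_locally_constant (s : G -> 'F_p) : locally_constant s ->
  locally_constant (fun u : cart_power G 1 => s (entry u 0) : ('F_p)^o).
Proof. exact: locally_constant_precomp (@entry_continuous G 1 0). Qed.

Definition cochain1 (s : G -> 'F_p) (sc : locally_constant s) : A z1 :=
  Cochain (locally_constant_cochain (cochain1_locally_constant sc)).

Definition value1 (z : A z1) (g : G) : 'F_p := z (fun=> g).

Lemma value1_cochain1 s (sc : locally_constant s) g : value1 (cochain1 sc) g = s g.
Proof. by rewrite /value1 /= /entry insubT. Qed.

Lemma value1E (z : A z1) (u : cart_power G 1) : z u = value1 z (entry u 0).
Proof.
rewrite /value1; congr (cochain_fun z _); apply/funext => i.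
by rewrite (ord1 i) /entry insubT /=; congr (_ : 'I_1 -> G); exact: val_inj.
Qed.

Lemma value1_locally_constant (z : A z1) : locally_constant (value1 z).
Proof.
apply: (@locally_constant_precomp G (cart_power G 1) _ z (fun g _ => g)).
  by apply: cart_power_continuous => i g; exact: cvg_id.
by move=> u; exact: (@cochain_locally_const p G z1 z u).
Qed.

Lemma d_value1 (z : A z1) (u : cart_power G 2) :
  dga_d (erefl : z1 + 1 = z2) z u =
  value1 z (entry u 1) - value1 z (entry u 0 * entry u 1)%g + value1 z (entry u 0).
Proof.
rewrite -[LHS]/(cobound (cochain_fun z : cart_power G 1 -> 'F_p) u) /cobound big_ord1.
rewrite !value1E expr1 mulN1r expr2 mulrNN mul1r mul1r.
by congr (value1 _ _ - value1 _ _ + value1 _ _); rewrite /entry insubT.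
Qed.

Lemma mul_value1 (z z' : A z1) (u : cart_power G 2) :
  dga_mul (erefl : z1 + z1 = z2) z z' u = value1 z (entry u 0) * value1 z' (entry u 1).
Proof.
rewrite -[LHS]/(cup (cochain_fun z : cart_power G 1 -> 'F_p) (cochain_fun z' : cart_power G 1 -> 'F_p) u) /cup.
by rewrite !value1E; congr (value1 _ _ * value1 _ _); rewrite /entry insubT.
Qed.

Definition pair2 (g h : G) : cart_power G 2 := cut (prepend g (fun=> h)).

Lemma entry_pair2 g h : entry (pair2 g h) 0 = g /\ entry (pair2 g h) 1 = h.
Proof. by rewrite !entry_cut. Qed.

Lemma cochain2_eq (z z' : A z2) :
  (forall g h, z (pair2 g h) = z' (pair2 g h)) -> z = z'.
Proof.
move=> zz'; apply: cochain_eqP => u.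
have -> : u = pair2 (entry u 0) (entry u 1).
  rewrite -{1}(cut_entry u); apply: eq_cut => -[|[|n]] //.
exact: zz'.
Qed.

Lemma d_pair2 (z : A z1) g h :
  dga_d (erefl : z1 + 1 = z2) z (pair2 g h) = value1 z h - value1 z (g * h)%g + value1 z g.
Proof. by rewrite d_value1; have [-> ->] := entry_pair2 g h. Qed.

Lemma mul_pair2 (z z' : A z1) g h :
  dga_mul (erefl : z1 + z1 = z2) z z' (pair2 g h) = value1 z g * value1 z' h.
Proof. by rewrite mul_value1; have [-> ->] := entry_pair2 g h. Qed.

Lemma cochainN n (z : A n) u : (- z) u = - z u.
Proof. by []. Qed.

Lemma cochainD n (z z' : A n) u : (z + z') u = z u + z' u.
Proof. by []. Qed.

Lemma cochainZ n a (z : A n) u : (a *: z) u = a * z u.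
Proof. by []. Qed.

Lemma cocycle1P (z : A z1) : dga_d (erefl (z1 + 1)) z = 0 <->
  {morph value1 z : g h / (g * h)%g >-> g + h}.
Proof.
split=> [dz g h|zM].
  have := d_pair2 z g h; rewrite dz => /esym/eqP.
  by rewrite addrAC subr_eq0 addrC => /eqP.
by apply: cochain2_eq => g h; rewrite d_pair2 zM -[RHS]/(0 : 'F_p); ring.
Qed.

Lemma cochain1_eq (z z' : A z1) : value1 z =1 value1 z' -> z = z'.
Proof. by move=> e; apply: cochain_eqP => u; rewrite !value1E e. Qed.

Local Notation z3 := (Posz 3).
Local Notation "x *11 y" := (dga_mul (erefl : z1 + z1 = z2) x y) (at level 40).
Local Notation "x *21 y" := (dga_mul (erefl : z2 + z1 = z3) x y) (at level 40).
Local Notation "x *12 y" := (dga_mul (erefl : z1 + z2 = z3) x y) (at level 40).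
Local Notation d1 := (dga_d (erefl : z1 + 1 = z2)).
Local Notation d2 := (dga_d (erefl : z2 + 1 = z3)).

Lemma d_mul11 (z z' : A z1) : d2 (z *11 z') = d1 z *21 z' - z *12 d1 z'.
Proof.
rewrite (dga_leibniz (erefl : z1 + z1 = z2) (erefl : z1 + 1 = z2) (erefl : z1 + 1 = z2)
  (erefl : z2 + 1 = z3) (erefl : z2 + z1 = z3) (erefl : z1 + z2 = z3)).
by rewrite expr1z scaleN1r.
Qed.

Lemma mul11A (z z' z'' : A z1) : z *12 (z' *11 z'') = (z *11 z') *21 z''.
Proof. exact: dga_mulA. Qed.

Lemma mul12ZB (z : A z1) a (w w' : A z2) : z *12 (a *: w - w') = a *: (z *12 w) - z *12 w'.
Proof. by rewrite dga_mulBr (linear_funZ (mul_linearr _ _)). Qed.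

Lemma mul21ZB (z : A z1) a (w w' : A z2) : (a *: w - w') *21 z = a *: (w *21 z) - w' *21 z.
Proof. by rewrite dga_mulBl (linear_funZ (mul_linearl _ _)). Qed.

Lemma d2ZD a (w w' : A z2) : d2 (a *: w + w') = a *: d2 w + d2 w'.
Proof. exact: linearP. Qed.

Section TripleProducts.
Variables (I : eqType) (i0 i1 : I) (X : I -> A z1) (F2 : I -> I -> A z1) (c : I -> I -> 'F_p).
Let t := X i0 *11 X i1.
Hypothesis dX : forall i, d1 (X i) = 0.
Hypothesis dF2 : forall i j, d1 (F2 i j) = c i j *: t - X i *11 X j.
Hypotheses (c00 : c i0 i0 = 0) (c11 : c i1 i1 = 0).
Hypothesis c1 : forall k, c i1 k = - (k == i0)%:R.
Hypothesis c0 : forall i, c i i0 = - (i == i1)%:R.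

Definition homotopy_tX k : A z2 :=
  (-1) *: (X i0 *11 F2 i1 k) - (k == i0)%:R *: (F2 i0 i0 *11 X i1).

(** Symmetrically, [X_i t = (X_i X_i0) X_i1], and the remainder for [i = i1] is a multiple of
    [t X_i1 = X_i0 (X_i1 X_i1)]. *)
Definition homotopy_Xt i : A z2 :=
  (i == i1)%:R *: (X i0 *11 F2 i1 i1) + F2 i i0 *11 X i1.

Lemma d_homotopy_tX k : d2 (homotopy_tX k) = - (t *21 X k).
Proof.
rewrite /homotopy_tX -scaleNr d2ZD -[_ *: (F2 _ _ *11 _)]addr0 d2ZD linear0 addr0.
rewrite !d_mul11 !dX dga_mul0l dga_mul0r !dF2 c00 c1 mul12ZB mul21ZB scale0r !sub0r subr0.
rewrite !mul11A -/t; case: eqVneq => [->|_] /=.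
  by rewrite !scaleN1r !opprK addrAC addNr add0r.
by rewrite oppr0 !scale0r addr0 scaleN1r !opprK sub0r.
Qed.

Lemma d_homotopy_Xt i : d2 (homotopy_Xt i) = - (X i *12 t).
Proof.
rewrite /homotopy_Xt d2ZD !d_mul11 !dX dga_mul0l dga_mul0r !dF2 c11 c0 mul12ZB mul21ZB.
rewrite scale0r !sub0r subr0 !mul11A -/t opprK; case: eqVneq => [->|_] /=.
  by rewrite scale1r scaleN1r addrA addrN sub0r.
by rewrite oppr0 !scale0r add0r sub0r.
Qed.

End TripleProducts.

End LowDegree.

(** * Formality and its failure, from the presentation *)

Section Presentation.
Local Open Scope ring_scope.
Variables (p d q : nat) (E G : topGroupType) (x : d.-tuple E) (f : E -> G).
Hypotheses (p_pr : prime p) (p_odd : odd p) (pq : (p %| q)%N).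
Hypotheses (d_ge2 : (1 < d)%N) (d_even : ~~ odd d).
Hypotheses (freeE : is_free_pro_p p x) (pG : pro_p_group p G).
Hypotheses (fc : continuous f) (fM : {morph f : a b / (a * b)%g}).
Hypothesis fs : forall g, exists a, f a = g.
Hypothesis fK :
  (f @^-1` [set 1%g])%classic = closed_normal_closure (demushkin_relator q x).
Local Notation A := (cochains p G).
Local Notation z1 := (Posz 1).
Local Notation z2 := (Posz 2).
Local Notation F := 'F_p.

Let i0 : 'I_d := Ordinal (ltnW d_ge2).
Let i1 : 'I_d := Ordinal d_ge2.
Let r := demushkin_relator q x.
Let hG : hausdorff_space G. Proof. by case: pG.1. Qed.
Let cE : compact [set: E]. Proof. by case: freeE.1.1. Qed.

Lemma Fp_p_group : (p.-group [set: ('F_p : finGroupType)]%SET)%g.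
Proof. by rewrite /pgroup cardsT card_Fp // pnat_id. Qed.

Lemma descent_trivial (c : G -> G -> F) (s : E -> F) : locally_constant s ->
  (forall g, c 1%g g = 0) -> (forall g, c g 1%g = 0) ->
  (forall e e', s (e * e')%g = s e + s e' - c (f e) (f e')) -> s r = 0 ->
  exists2 s' : G -> F, locally_constant s' & s' \o f = s.
Proof.
move=> sc c1l c1r sM sr.
exact: (@descent E G f _ cE hG fc fM fs fK _ (fun _ a => a) c s).
Qed.

Lemma magnus_lift : exists2 Phi : E -> magnus p d, locally_constant Phi &
  {morph Phi : a b / (a * b)%g} /\ forall i, Phi (tnth x i) = magnus_gen p d i.
Proof.
exact: (free_pro_p_lift freeE (fun i => magnus_gen p d i) (magnus_p_group d p_pr)).
Qed.

Lemma magnus1_relator (Phi : E -> magnus p d) i :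
  {morph Phi : a b / (a * b)%g} -> (forall i, Phi (tnth x i) = magnus_gen p d i) ->
  magnus1 (Phi r) i = 0.
Proof.
move=> PhiM Phi_x; rewrite /r (magnus_relator PhiM Phi_x d_even (ltnW d_ge2)).
by rewrite magnusX !magnusE Fp_natr_dvd // mul0r addr0.
Qed.

(** The linear Magnus coefficients are additive and vanish at the relator, because [p] divides [q];
    so they descend to [G]. *)
Lemma dual_basis (Phi : E -> magnus p d) : locally_constant Phi ->
  {morph Phi : a b / (a * b)%g} -> (forall i, Phi (tnth x i) = magnus_gen p d i) ->
  exists chi : 'I_d -> G -> F, forall i, [/\ locally_constant (chi i),
    {morph chi i : g h / (g * h)%g >-> g + h} &
    forall e, chi i (f e) = magnus1 (Phi e) i].
Proof.
move=> Phic PhiM Phi_x.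
suff : forall i, exists chi : G -> F, [/\ locally_constant chi,
    {morph chi : g h / (g * h)%g >-> g + h} & forall e, chi (f e) = magnus1 (Phi e) i].
  by move=> /choice[chi chiP]; exists chi.
move=> i; have [|//|//|||chi chic chiE] := @descent_trivial (fun _ _ => 0) (fun e => magnus1 (Phi e) i).
- exact: (locally_constant_comp (fun m => magnus1 m i) Phic).
- by move=> e e'; rewrite PhiM magnus1M subr0.
- exact: magnus1_relator.
have chi_f e : chi (f e) = magnus1 (Phi e) i by rewrite -[LHS]/((chi \o f) e) chiE.
exists chi; split=> // g h; have [e <-] := fs g; have [e' <-] := fs h.
by rewrite -fM !chi_f PhiM magnus1M.
Qed.

(* If the cochain algebra is formal, [(chi, f2(x, x), - f3(x, x, x))] is a
   homomorphism to the truncated power series in one variable, where the cube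
   of a power series [1 + X + ...] is not [1]. *)
Lemma not_formal : p = 3%N -> q = 3%N -> ~ A3_formal A.
Proof.
move=> p3 q3 [fm].
have [Phi Phic [PhiM Phi_x]] := magnus_lift.
have [chi chiP] := dual_basis Phic PhiM Phi_x.
have [chic chiM chi_f] := chiP i0.
pose X : A z1 := cochain1 chic.
have dX : dga_d (erefl (z1 + 1)) X = 0.
  by apply/cocycle1P => g h; rewrite !value1_cochain1 chiM.
have F3 : 3%:R = 0 :> F by rewrite Fp_natr_dvd // p3.
have [k kK Kk] := fm_f1_iso fm z1.
pose u : cohomology A z1 := k (cohomology_class dX).
have f1u : fm_f1 fm u = X.
  have := Kk (cohomology_class dX); rewrite -/u => e.
  by rewrite -(cohomology_rep_class (fm_df1 fm u)) // e cohomology_rep_class.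
have uu : cohomology_mul (erefl : z1 + z1 = z2) u u = 0.
  (* The square of [chi] has coboundary [-2 chi chi], which is [chi chi] modulo 3; hence
     [u u = 0]. *)
  have sqc : locally_constant (fun g => chi i0 g ^+ 2).
    exact: (locally_constant_comp (fun a : F => a ^+ 2) chic).
  have dN : dga_d (erefl : z1 + 1 = z2) (cochain1 sqc) =
      dga_mul (erefl : z1 + z1 = z2) X X.
    apply: cochain2_eq => g h; rewrite d_pair2 mul_pair2 !value1_cochain1 chiM.
    by rewrite -[LHS]addr0 -(mul0r (chi i0 g * chi i0 h)) -F3; ring.
  have [k2 kK2 _] := fm_f1_iso fm z2.
  rewrite -(kK2 (cohomology_mul _ u u)) -(kK2 0); congr k2; apply/cohomology_class_eq.
  exists z1, erefl, (fm_f2 fm (erefl : z1 + z1 = z1 + 1) u u + cochain1 sqc).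
  have dD (a b : A z1) : dga_d (erefl : z1 + 1 = z2) (a + b) =
      dga_d (erefl : z1 + 1 = z2) a + dga_d (erefl : z1 + 1 = z2) b by exact: linearD.
  apply: (etrans (dD _ _)).
  rewrite dN (fm_f2E fm (erefl : z1 + z1 = z2)) f1u.
  by rewrite (linear_fun0 (@fm_f1_linear _ _ fm _)) subr0 subrK.
pose Y : A z1 := fm_f2 fm (erefl : z1 + z1 = z1 + 1) u u.
have dY : dga_d (erefl : z1 + 1 = z2) Y = - dga_mul (erefl : z1 + z1 = z2) X X.
  rewrite (fm_f2E fm (erefl : z1 + z1 = z2)) uu f1u.
  by rewrite (linear_fun0 (@fm_f1_linear _ _ fm _)) sub0r.
pose W : A z1 := fm_f3 fm (erefl : z1 + z1 + z1 = z1 + 2) u u u.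
have dW : dga_d (erefl : z1 + 1 = z2) W =
    dga_mul (erefl : z1 + z1 = z2) X Y + dga_mul (erefl : z1 + z1 = z2) Y X.
  have := @fm_f3E _ _ fm z1 z1 z1 z2 z2 z1 z1 z1 z2 erefl erefl erefl erefl erefl erefl
    erefl erefl erefl erefl u u u.
  rewrite uu f1u (linear_fun0 (fm_f2_linear1 fm _ _)) (linear_fun0 (fm_f2_linear2 fm _ _)).
  rewrite subrr expr1z scaleN1r => /eqP; rewrite subr_eq0 subr_eq => /eqP ->.
  exact: addrC.
have YM g h : value1 Y (g * h)%g = value1 Y g + chi i0 g * chi i0 h + value1 Y h.
  have := d_pair2 Y g h; rewrite dY cochainN mul_pair2.
  rewrite !value1_cochain1 => e.
  rewrite [LHS](_ : _ = value1 Y h + value1 Y g -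
    (value1 Y h - value1 Y (g * h)%g + value1 Y g)); last by ring.
  by rewrite -e; ring.
have WM g h : value1 W (g * h)%g =
    value1 W g - value1 Y g * chi i0 h - chi i0 g * value1 Y h + value1 W h.
  have := d_pair2 W g h; rewrite dW.
  rewrite cochainD !mul_pair2.
  rewrite !value1_cochain1 => e.
  rewrite [LHS](_ : _ = value1 W h + value1 W g -
    (value1 W h - value1 W (g * h)%g + value1 W g)); last by ring.
  by rewrite -e; ring.
pose Theta (e : E) : magnus p 1 := mk_magnus (fun=> chi i0 (f e))
  (fun _ _ => value1 Y (f e)) (fun _ _ _ => - value1 W (f e)).
have ThetaM : {morph Theta : a b / (a * b)%g}.
  move=> a b; apply: magnus_ext => [i|i j|i j k1]; rewrite !magnusE fM ?chiM ?YM ?WM //; ring.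
have ThetaC a b : commute (Theta a) (Theta b).
  apply: magnus_ext => [i|i j|i j k1]; rewrite !magnusE; ring.
have Theta_r : Theta r = 1%g.
  have Theta1 : Theta 1%g = 1%g by apply: (mulgI (Theta 1%g)); rewrite -ThetaM !mulg1.
  by rewrite -Theta1 /Theta (f_relator fK) (fmorph1 fM).
have := @relator_abelian _ _ x _ Theta q (ltnW d_ge2) ThetaM ThetaC i0 erefl.
rewrite -/r Theta_r magnusX => /(congr1 (fun m => magnus3 m ord0 ord0 ord0)).
rewrite !magnusE q3 binn chi_f Phi_x magnusE eqxx !mulr1.
rewrite F3.
by rewrite !mul0r !add0r => /eqP; rewrite eq_sym oner_eq0.
Qed.

Lemma acyclic_above2 (n : int) : 3 <= n -> forall z : A n,
  dga_d (erefl (n + 1)) z = 0 ->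
  exists (m : int) (e : m + 1 = n) (w : A m), dga_d e w = z.
Proof.
case: n => [[|[|[|j]]]|j] // _ z dz.
have e' : Posz j.+3 + 1 = Posz j.+4 by lia.
have e : Posz j.+2 + 1 = Posz j.+3 by lia.
have dz' : dga_d e' z = 0.
  by apply/eqP; rewrite -(is_cocycleP e' z) (is_cocycleP erefl z) dz.
have [|u|w wc dw] := cocycle_cobound p_pr p_odd pq d_ge2 d_even freeE pG fc fM fs fK
  (z := cochain_fun z).
- exact: (@cochain_locally_const p G (Posz j.+3) z).
- exact: (congr1 (fun w : A (Posz j.+4) => w u) dz').
exists (Posz j.+2), e, (Cochain (locally_constant_cochain wc)).
by apply: cochain_eqP => u; exact: dw.
Qed.

Lemma form01 : magnus_form p i0 i1 = 1.
Proof. by rewrite /magnus_form /= mul1r. Qed.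

(** Composed with [f], both sides are homomorphisms to [F_p] that agree on the generators of [E]. *)
Lemma cocycle1_span (chi : 'I_d -> G -> F) (chic : forall i, locally_constant (chi i))
  (z : A z1) : (forall i, {morph chi i : g h / (g * h)%g >-> g + h}) ->
  (forall i j, chi i (f (tnth x j)) = (j == i)%:R) ->
  dga_d (erefl (z1 + 1)) z = 0 ->
  z = \sum_i value1 z (f (tnth x i)) *: cochain1 (chic i).
Proof.
move=> chiM chi_x /cocycle1P zM; apply: cochain1_eq => g; have [e <-] := fs g.
have vsum (s : seq 'I_d) h : value1 (\sum_(i <- s) value1 z (f (tnth x i)) *: cochain1 (chic i)) h =
    \sum_(i <- s) value1 z (f (tnth x i)) * chi i h.
  elim: s => [|i s IHs]; first by rewrite !big_nil.
  by rewrite !big_cons -IHs -(value1_cochain1 (chic i)).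
rewrite vsum; pose h e := \sum_i value1 z (f (tnth x i)) * chi i (f e) : F.
have hM : {morph h : a b / (a * b)%g >-> a + b}.
  move=> a b; rewrite /h -big_split; apply: eq_bigr => i _ /=.
  by rewrite fM chiM mulrDr.
apply: (free_pro_p_unique freeE (h := value1 z \o f) (h' := h) Fp_p_group).
- exact: locally_constant_precomp fc (value1_locally_constant z).
- move=> a; have : \forall b \near a, forall i, chi i (f b) = chi i (f a).
    apply: (@filter_forall _ _ _ _ (nbhs_filter a)) => i.
    exact: (locally_constant_precomp fc (chic i)).
  by apply: filterS => b hb; apply: eq_bigr => i _; rewrite hb.
- by move=> a b /=; rewrite fM zM.
- exact: hM.
- move=> i; rewrite /h (bigD1 i) //= chi_x eqxx mulr1 big1 ?addr0 // => j ji.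
  by rewrite chi_x eq_sym (negPf ji) mulr0.
Qed.

Lemma form_row1 k : magnus_form p i1 k = - (k == i0)%:R.
Proof. by rewrite /magnus_form /= expr1 mulrN1. Qed.

Lemma form_col0 i : magnus_form p i i0 = - (i == i1)%:R.
Proof.
rewrite /magnus_form -val_eqE /= /partner.
case: (nat_of_ord i) => [|[|n]] /=; rewrite ?mul0r ?oppr0 //.
  by rewrite mul1r expr1.
by case: ifP => _; rewrite ?mul0r ?oppr0.
Qed.

Lemma is_formal : (p %| 'C(q, 2))%N -> (p %| 'C(q, 3))%N ->
  has_dim (cohomology A z2) 1 -> A3_formal A.
Proof.
move=> q2 q3 [phi phi_bij].
have [Phi Phic [PhiM Phi_x]] := magnus_lift.
have [chi chiP] := dual_basis Phic PhiM Phi_x.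
have chic i : locally_constant (chi i) by case: (chiP i).
have chiM i : {morph chi i : g h / (g * h)%g >-> g + h} by case: (chiP i).
have chi_f i e : chi i (f e) = magnus1 (Phi e) i by case: (chiP i).
have chi1 i : chi i 1%g = 0.
  by apply: (addIr (chi i 1%g)); rewrite -chiM mulg1 add0r.
pose c := @magnus_form p d; have c01 : c i0 i1 = 1 := form01.
have Phi_r : Phi r = magnus_quad c.
  by rewrite /r (magnus_relator PhiM Phi_x d_even (ltnW d_ge2)) magnusX_eq1 // mul1g.
(* On [E], the coefficient at [(i, j)] has coboundary [- chi_i chi_j] and value [c i j] at the
   relator. Subtracting [c i j] times the coefficient at [(i0, i1)], whose value there is 1, makes
   it vanish at the relator. *)
have F2_ex (ij : 'I_d * 'I_d) : exists s : G -> F, locally_constant s /\ forall e,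
    s (f e) = magnus2 (Phi e) ij.1 ij.2 - c ij.1 ij.2 * magnus2 (Phi e) i0 i1.
  case: ij => i j /=.
  have [|g|g|e e'||s sc sE] := @descent_trivial
    (fun g h => - (chi i g * chi j h - c i j * (chi i0 g * chi i1 h)))
    (fun e => magnus2 (Phi e) i j - c i j * magnus2 (Phi e) i0 i1).
  - exact: (locally_constant_comp (fun m => magnus2 m i j - c i j * magnus2 m i0 i1) Phic).
  - by rewrite !chi1; ring.
  - by rewrite !chi1; ring.
  - by rewrite PhiM !magnus2M !chi_f; ring.
  - by rewrite Phi_r !magnusE c01 mulr1 subrr.
  by exists s; split=> // e; rewrite -[LHS]/((s \o f) e) sE.
have [F2 F2P] := choice F2_ex; pose F2' i j := F2 (i, j).
have F2c i j : locally_constant (F2' i j) := (F2P (i, j)).1.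
have F2f i j e : F2' i j (f e) = magnus2 (Phi e) i j - c i j * magnus2 (Phi e) i0 i1 :=
  (F2P (i, j)).2 e.
have c1 k : c i1 k = - (k == i0)%:R by exact: form_row1.
have c0 i : c i i0 = - (i == i1)%:R by exact: form_col0.
have c00 : c i0 i0 = 0 by rewrite c0 oppr0.
have c11 : c i1 i1 = 0 by rewrite c1 oppr0.
pose X i := cochain1 (chic i); pose Y i j := cochain1 (F2c i j).
pose t : A z2 := dga_mul (erefl : z1 + z1 = z2) (X i0) (X i1).
have dX i : dga_d (erefl : z1 + 1 = z2) (X i) = 0.
  by apply/cocycle1P => g h; rewrite !value1_cochain1 chiM.
have dY i j : dga_d (erefl : z1 + 1 = z2) (Y i j) =
    c i j *: t - dga_mul (erefl : z1 + z1 = z2) (X i) (X j).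
  apply: cochain2_eq => g h; rewrite d_pair2 cochainD cochainN cochainZ !mul_pair2.
  rewrite !value1_cochain1; have [e <-] := fs g; have [e' <-] := fs h.
  by rewrite -fM !F2f !chi_f PhiM !magnus2M; ring.
(* On [E] let [m] be the coefficient at [(i0, i1)], a primitive of [- t]. Then [u k] and [v i] are
   primitives of [tX k - m X_k] and [Xt i + X_i m]. They correct the cubic coefficient so that its
   coboundary comes from [G]; at the relator everything vanishes, as its image has no cubic
   terms. *)
pose u k e := magnus3 (Phi e) i0 i1 k + (k == i0)%:R * magnus3 (Phi e) i0 i0 i1.
pose v i e := - magnus3 (Phi e) i i0 i1 - (i == i1)%:R * magnus3 (Phi e) i0 i1 i1.
pose tX := homotopy_tX i0 i1 X Y; pose Xt := homotopy_Xt i0 i1 X Y.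
have F3_ex (ijk : 'I_d * 'I_d * 'I_d) : exists s : G -> F,
    locally_constant s /\ forall e, s (f e) =
    - magnus3 (Phi e) ijk.1.1 ijk.1.2 ijk.2 + c ijk.1.1 ijk.1.2 * u ijk.2 e
    - c ijk.1.2 ijk.2 * v ijk.1.1 e.
  case: ijk => -[i j] k /=.
  pose Psi g h := c i j * (- (chi i0 g * F2' i1 k h) - (k == i0)%:R * (F2' i0 i0 g * chi i1 h))
    - c j k * ((i == i1)%:R * (chi i0 g * F2' i1 i1 h) + F2' i i0 g * chi i1 h)
    + chi i g * F2' j k h + F2' i j g * chi k h.
  have Phi1 : Phi 1%g = 1%g by apply: (mulgI (Phi 1%g)); rewrite -PhiM !mulg1.
  have F21 a b : F2' a b 1%g = 0.
    by rewrite -(fmorph1 fM) F2f Phi1 !magnusE mulr0 subr0.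
  have [|g|g|e e'||s sc sE] := @descent_trivial Psi
    (fun e => - magnus3 (Phi e) i j k + c i j * u k e - c j k * v i e).
  - exact: (locally_constant_comp (fun m => - magnus3 m i j k +
      c i j * (magnus3 m i0 i1 k + (k == i0)%:R * magnus3 m i0 i0 i1) -
      c j k * (- magnus3 m i i0 i1 - (i == i1)%:R * magnus3 m i0 i1 i1)) Phic).
  - by rewrite /Psi !chi1 !F21; ring.
  - by rewrite /Psi !chi1 !F21; ring.
  - rewrite /Psi /u /v PhiM !magnus3M !F2f !chi_f c00 c11 c1 c0; ring.
  - by rewrite /u /v Phi_r !magnusE; ring.
  by exists s; split=> // e; rewrite -[LHS]/((s \o f) e) sE.
have [F3 F3P] := choice F3_ex.
pose Z i j k := cochain1 (F3P (i, j, k)).1.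
have dZ i j k : dga_d (erefl : z1 + 1 = z2) (Z i j k) =
    c i j *: tX k - c j k *: Xt i + dga_mul (erefl : z1 + z1 = z2) (X i) (Y j k) +
    dga_mul (erefl : z1 + z1 = z2) (Y i j) (X k).
  apply: cochain2_eq => g h; rewrite d_pair2 /tX /Xt /homotopy_tX /homotopy_Xt.
  rewrite !(cochainD, cochainN, cochainZ) !mul_pair2 !value1_cochain1.
  have [e <-] := fs g; have [e' <-] := fs h.
  rewrite -fM !(F3P _).2 /= /u /v PhiM !magnus3M !F2f !chi_f c00 c11 c1 c0; ring.
have dt : dga_d (erefl (z2 + 1)) t = 0.
  by have := d_mul11 (X i0) (X i1); rewrite !dX dga_mul0l dga_mul0r subr0.
(* If [t] were the coboundary of [w], then [w] plus the coefficient at [(i0, i1)] would be a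
   homomorphism [D] from [E] to [F_p]. At the relator it would be [q] times its value at [x_0],
   hence 0, and also [c i0 i1 = 1]. *)
have t_neq0 : phi (cohomology_class dt) 0 0 != 0.
  apply/eqP => phit0.
  have : cohomology_class dt = cohomology_class (d_zero A z2).
    apply: (bij_inj phi_bij); rewrite cohomology_class0 linear0.
    by apply/matrixP => a b; rewrite !ord1 phit0 mxE.
  move=> /cohomology_class_eq[m [em [w dw]]].
  have m1 : m = z1 by lia.
  subst m; rewrite (eq_irrelevance em erefl) subr0 in dw.
  pose D e := value1 w (f e) + magnus2 (Phi e) i0 i1.
  have wM g h : value1 w (g * h)%g = value1 w g + value1 w h - chi i0 g * chi i1 h.
    have := d_pair2 w g h; rewrite dw mul_pair2 !value1_cochain1 => ->; ring.
  have w1 : value1 w 1%g = 0.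
    have := wM 1%g 1%g; rewrite mulg1 chi1 mul0r subr0 => w11.
    by apply: (addIr (value1 w 1%g)); rewrite add0r -w11.
  have DM : {morph D : a b / (a * b)%g >-> (a * b)%g}.
    by move=> a b; rewrite /D fM wM !chi_f PhiM magnus2M -[RHS]/(D a + D b) /D; ring.
  have DC a b : commute (D a) (D b) by exact: zmod_mulgC.
  have := @relator_abelian _ _ x _ D q (ltnW d_ge2) DM DC i0 erefl.
  rewrite zmodXgE -mulr_natr Fp_natr_dvd // mulr0 /D -/r (f_relator fK) w1 Phi_r.
  by rewrite !magnusE c01 add0r => /eqP; rewrite oner_eq0.
pose tau y := phi y 0 0 / phi (cohomology_class dt) 0 0.
have tau_linear a y y' : tau (a *: y + y') = a * tau y + tau y'.
  by rewrite /tau linearP !mxE mulrDl mulrA.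
have tau_inj y : tau y = 0 -> y = 0.
  move=> /eqP; rewrite mulf_eq0 invr_eq0 (negPf t_neq0) orbF => /eqP y0.
  apply: (bij_inj phi_bij); rewrite linear0; apply/matrixP => a b.
  by rewrite !ord1 y0 mxE.
have tau_t : tau (cohomology_class dt) = 1 by rewrite /tau divff.
have [b db] : exists b : A (Posz 3), dga_d (erefl : Posz 3 + 1 = Posz 4) b =
    - dga_mul (erefl : z2 + z2 = Posz 4) t t.
  have dtt : dga_d (erefl (Posz 4 + 1)) (dga_mul (erefl : z2 + z2 = Posz 4) t t) = 0.
    have := cocycle_mul_subproof (erefl : z2 + z2 = Posz 4)
      (Cocycle (introT eqP dt)) (Cocycle (introT eqP dt)).
    by move=> /eqP.
  have [m [em [w dw]]] := @acyclic_above2 (Posz 4) isT _ dtt.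
  have m3 : m = Posz 3 by lia.
  subst m; rewrite (eq_irrelevance em erefl) in dw.
  by exists (- w); exact: etrans (linearN _ _) (congr1 -%R dw).
pose co i (z : A z1) := value1 z (f (tnth x i)).
have chi_x i j : chi i (f (tnth x j)) = (j == i)%:R.
  by rewrite chi_f Phi_x magnusE eq_sym.
apply: (@A3_formal_of_homotopies _ A d X co t tau _ _ _ _ dt tau_linear tau_inj tau_t acyclic_above2
  c Y tX Xt Z dY _ _ dZ b db).
- exact: dX.
- by [].
- by move=> i j; rewrite /co value1_cochain1 chi_x.
- move=> z dz; exact: (cocycle1_span chic chiM chi_x dz).
- exact: (d_homotopy_tX dX dY c00 c1).
- exact: (d_homotopy_Xt dX dY c11 c0).
Qed.

End Presentation.

(** From [k 'C(q, k) = q 'C(q - 1, k - 1)]. For [p = 3] the bound forces 9 to divide [q], which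
    makes up for the factor [k = 3]. *)
Lemma prime_dvd_bin (p f : nat) : prime p -> odd p -> 0 < f -> 5 <= p ^ f ->
  (p %| 'C(p ^ f, 2)) && (p %| 'C(p ^ f, 3)).
Proof.
move=> p_pr p_odd f_gt0 q5; set q := p ^ f.
have pq : p %| q by rewrite dvdn_exp.
apply/andP; split.
  rewrite -(@Gauss_dvdr p 2); last by rewrite coprimen2.
  by rewrite -mul_bin_diag bin1 dvdn_mulr.
have [p3|p3] := eqVneq p 3; last first.
  rewrite -(@Gauss_dvdr p 3); last by rewrite prime_coprime // dvdn_prime2.
  by rewrite -mul_bin_diag dvdn_mulr.
rewrite -(@dvdn_pmul2l 3) // -mul_bin_diag dvdn_mulr // p3 -[3 * 3]/(3 ^ 2).
rewrite /q p3 dvdn_exp2l //; case: f f_gt0 {pq q} q5 => [|[|f]] //.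
by rewrite p3.
Qed.

Theorem theorem1p2 (p : nat) (G : topGroupType) (d q : nat)
    (hp : prime p) (hp_odd : odd p) (hd : 2 <= d) (hd_even : ~~ odd d)
    (hG : demushkin p G) (hdq : demushkin_invariants p d q G) :
  (p = 3 /\ q = 3 -> ~ A3_formal (cochains p G)) /\
  (q = 0 \/ 5 <= q -> A3_formal (cochains p G)).
Proof.
case: hdq => hq [E [x [f [freeE [fc fM] fs fK]]]].
case: hG => pG _ H2 _.
have pq : p %| q by case: hq => [->|[k k_gt0 ->]]; rewrite ?dvdn0 ?dvdn_exp.
split=> [[p3 q3]|q5].
  exact: (not_formal hp pq hd hd_even freeE pG fc fM fs fK p3 q3).
have /andP[q2 q3] : (p %| 'C(q, 2)) && (p %| 'C(q, 3)).
  case: hq => [->|[k k_gt0 qE]]; first by rewrite !bin0n !dvdn0.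
  case: q5 => [q0|]; first by rewrite q0 !bin0n !dvdn0.
  by rewrite qE; exact: prime_dvd_bin.
exact: (is_formal hp hp_odd pq hd hd_even freeE pG fc fM fs fK q2 q3 H2).
Qed.
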